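(* Let $\psi$ be a translationally invariant pure gapped ground state of a finite range translationally invariant Hamiltonian $H$ on the fermionic chain. Then $\psi$ has string order if and only if $\mathrm{ind}_{\mathbf Z_2}\psi=-1$; equivalently, $\psi$ has no string order if and only if $\mathrm{ind}_{\mathbf Z_2}\psi=1$.
   Context: $\mathfrak A$ is the CAR algebra ($C^*$-algebra) generated by $c_j^*,c_j$ ($j\in\mathbf Z$) with $\{c_i,c_j\}=\{c_i^*,c_j^*\}=0$, $\{c_j^*,c_i\}=\delta_{i,j}1$. The parity automorphism $\Theta$ is determined by $\Theta(c_j)=-c_j$; $\mathfrak A^{(\pm)}=\{Q:\Theta(Q)=\pm Q\}$; $Q_\pm=\frac12(Q\pm\Theta(Q))$. $\mathfrak A_{[n,m]}$ is the subalgebra generated by $c_j,c_j^*$, $n\le j\le m$; $\mathfrak A_{loc}=\bigcup_{n<m}\mathfrak A_{[n,m]}$. $\mathfrak A_L$ (resp. $\mathfrak A_R$) is the $C^*$-subalgebra generated by $c_j,c_j^*$ with $j<0$ (resp. $j\ge0$). The lattice translation $\tau_k$ is the automorphism with $\tau_k(c_i)=c_{i+k}$. Hamiltonian: fix $n>1$ and $h=h^*\in\mathfrak A_{[-n,n]}\cap\mathfrak A^{(+)}$; $H_M=\sum_{-M+n\le k\le M-n}\tau_k(h)$, formally $H=\lim_MH_M$, $[H,Q]=\lim_M[H_M,Q]$ for $Q\in\mathfrak A_{loc}$. A translationally invariant state $\psi$ is a ground state of $H$ if $\psi(h)=\inf\varphi(h)$ over all translationally invariant states $\varphi$; it is gapped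 if there is $m>0$ with $\psi(Q^*[H,Q])\ge m(\psi(Q^*Q)-|\psi(Q)|^2)$ for all $Q\in\mathfrak A_{loc}$. Split property of a state $\psi$: $\psi$ is quasi-equivalent to a graded product state $\psi_L\otimes_{\mathbf Z_2}\psi_R$ with at least one of the states $\psi_L$ of $\mathfrak A_L$, $\psi_R$ of $\mathfrak A_R$ being $\Theta$ invariant, where for $Q\in\mathfrak A_L$, $P\in\mathfrak A_R$, $\psi_L\otimes_{\mathbf Z_2}\psi_R(QP)=\psi_L(Q_+)\psi_R(P)$ if $\psi_L$ is $\Theta$ invariant and $=\psi_L(Q)\psi_R(P_+)$ if $\psi_R$ is. Translationally invariant pure states are $\Theta$ invariant, and translationally invariant pure gapped ground states have the split property. Index: for a $\Theta$ invariant pure state $\psi$ of $\mathfrak A$ with split property, $\mathrm{ind}_{\mathbf Z_2}\psi=1$ if the restriction of $\psi$ to $\mathfrak A_L$ is a factor state, and $\mathrm{ind}_{\mathbf Z_2}\psi=-1$ if it is not a factor state. String order: put $S[0,k-1]=\prod_{j=0}^{k-1}(2c_j^*c_j-1)$. A translationally invariant pure state $\psi$ has string order if there are integers $n<0\le m$ and $Q_1\in\mathfrak A^{(-)}\cap\mathfrak A_{[n,-1]}$, $Q_2\in\mathfrak A^{(-)}\cap\mathfrak A_{[0,m]}$ with $\lim_{k\to\infty}\psi(Q_1S[0,2k-1]\tau_{2k}(Q_2))\ne0$. *)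

(* Defs.v *)
(* MathComp-Analysis; the scalars are the complex numbers R[i] over R : realType. *)
From HB Require Import structures.
From mathcomp Require Import all_boot all_order all_algebra.
From mathcomp Require Import complex.
From mathcomp Require Import all_classical all_reals all_analysis.

Set Implicit Arguments.
Unset Strict Implicit.
Unset Printing Implicit Defensive.

Import Order.TTheory GRing.Theory Num.Theory.
Import numFieldNormedType.Exports.

Local Open Scope classical_set_scope.
Local Open Scope ring_scope.
Local Open Scope complex_scope.

(* Unital C*-algebras. The library's ring and normed-module hierarchies have no
   common join, so the norm is a field of the structure; nbhs_cnorm says that
   the topology of A is the norm topology. *)
HB.mixin Record isCStarAlgebra (R : realType) A
    of GRing.Algebra R[i] A & Topological A := {
  cnorm : A -> R;
  cnormD : forall x y : A, cnorm (x + y) <= cnorm x + cnorm y;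
  cnormZ : forall (a : R[i]) (x : A),
    (cnorm (a *: x))%:C = `|a| * (cnorm x)%:C;
  cnorm_eq0 : forall x : A, cnorm x = 0 -> x = 0;
  cnormM : forall x y : A, cnorm (x * y) <= cnorm x * cnorm y;
  nbhs_cnorm : forall x : A, nbhs x = nbhs_ball_ (ball_ cnorm) x;
  cnorm_complete : forall u : nat -> A,
    (forall e : R, 0 < e -> exists N : nat, forall p q : nat,
       (N <= p)%N -> (N <= q)%N -> cnorm (u p - u q) < e) ->
    exists l : A, u @ \oo --> l;
  adj : A -> A;
  adjK : involutive adj;
  adjD : forall x y : A, adj (x + y) = adj x + adj y;
  adjZ : forall (a : R[i]) (x : A), adj (a *: x) = a^* *: adj x;
  adjM : forall x y : A, adj (x * y) = adj y * adj x;
  cnorm_cstar : forall x : A, cnorm (adj x * x) = cnorm x ^+ 2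
}.

#[short(type="cstarAlgType")]
HB.structure Definition CStarAlgebra (R : realType) :=
  {A of GRing.Algebra R[i] A & Topological A & isCStarAlgebra R A}.

(* Complex Hilbert spaces; the inner product is linear on the left. The norm of
   a normedModType R[i] takes its values in R[i], where x <= y means that y - x
   is real and nonnegative. *)
HB.mixin Record isHilbert (R : realType) H of CompleteNormedModule R[i] H := {
  inner : H -> H -> R[i];
  innerPl : forall (a : R[i]) (x y z : H),
    inner (a *: x + y) z = a * inner x z + inner y z;
  innerC : forall x y : H, inner y x = (inner x y)^*;
  inner_norm : forall x : H, inner x x = `|x| ^+ 2
}.

#[short(type="hilbertType")]
HB.structure Definition Hilbert (R : realType) :=
  {H of CompleteNormedModule R[i] H & isHilbert R H}.

Section Subalgebras.
Context {R : realType} {A : cstarAlgType R}.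

(* Subalgebras are unital; this loses nothing here, since by the CAR any
   subalgebra containing some c_j and its adjoint contains 1. *)
Definition is_subalgebra (B : set A) : Prop :=
  [/\ B 1,
      forall (a : R[i]) (x y : A), B x -> B y -> B (a *: x + y)
    & forall x y : A, B x -> B y -> B (x * y)].

Definition is_cstar_subalgebra (B : set A) : Prop :=
  [/\ is_subalgebra B, forall x : A, B x -> B (adj x) & closed B].

Definition subalgebra_gen (S : set A) : set A :=
  [set x | forall B, is_subalgebra B -> S `<=` B -> B x].

Definition cstar_gen (S : set A) : set A :=
  [set x | forall B, is_cstar_subalgebra B -> S `<=` B -> B x].

Definition star_automorphism (f : {lrmorphism A -> A}) : Prop :=
  bijective f /\ forall x : A, f (adj x) = adj (f x).

End Subalgebras.

Section States.
Context {R : realType} {A : cstarAlgType R}.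

Definition state (psi : {scalar A}) : Prop :=
  psi 1 = 1 /\ forall Q : A, 0 <= psi (adj Q * Q).

(* Pure state = extreme point of the convex set of states. *)
Definition pure (psi : {scalar A}) : Prop :=
  state psi /\
  forall (phi1 phi2 : {scalar A}) (t : R),
    state phi1 -> state phi2 -> 0 < t < 1 ->
    (forall Q, psi Q = t%:C * phi1 Q + (1 - t)%:C * phi2 Q) ->
    phi1 =1 psi /\ phi2 =1 psi.

(* (H, pi, Omega) is a GNS triple of the restriction of psi to the unital
   *-subalgebra B; the values of pi outside B are irrelevant. *)
Record is_gns (B : set A) (psi : A -> R[i]) (H : hilbertType R)
    (pi : A -> H -> H) (Omega : H) : Prop := IsGNS {
  gns_linear : forall Q, B Q -> forall (a : R[i]) (x y : H),
    pi Q (a *: x + y) = a *: pi Q x + pi Q y;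
  gns_bounded : forall Q, B Q -> continuous (pi Q);
  gns_unit : forall x, pi 1 x = x;
  gns_lin : forall (a : R[i]) (P Q : A), B P -> B Q -> forall x,
    pi (a *: P + Q) x = a *: pi P x + pi Q x;
  gns_mul : forall P Q, B P -> B Q -> forall x, pi (P * Q) x = pi P (pi Q x);
  gns_adj : forall Q, B Q -> forall x y,
    inner (pi (adj Q) x) y = inner x (pi Q y);
  gns_state : forall Q, B Q -> psi Q = inner (pi Q Omega) Omega;
  gns_cyclic : closure [set pi Q Omega | Q in B] = setT
}.

End States.

Section VonNeumann.
Context {R : realType} {H : hilbertType R}.

Definition bounded_operator (T : H -> H) : Prop :=
  (forall (a : R[i]) (x y : H), T (a *: x + y) = a *: T x + T y) /\
  continuous T.

Definition commutant (M : set (H -> H)) : set (H -> H) :=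
  [set T | bounded_operator T /\ forall S, M S -> T \o S =1 S \o T].

(* A von Neumann algebra N (with identity) is a factor if its centre is C 1. *)
Definition factor (N : set (H -> H)) : Prop :=
  forall T, N T -> commutant N T -> exists a : R[i], forall x, T x = a *: x.

End VonNeumann.

(* The restriction of psi to B is a factor state: pi(B)'' is a factor for the
   GNS representation pi, which is unique up to unitary equivalence. *)
Definition factor_state {R : realType} {A : cstarAlgType R} (B : set A)
    (psi : A -> R[i]) : Prop :=
  forall (H : hilbertType R) (pi : A -> H -> H) (Omega : H),
    is_gns B psi pi Omega -> factor (commutant (commutant (pi @` B))).

(* The CAR algebra over the lattice Z with its parity automorphism and its
   lattice translations. Any two nonzero C*-algebras generated by elements
   satisfying the CAR are isomorphic through the generators, and theta and tau
   are determined by their values on the generators. *)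
Record fermionChain (R : realType) (A : cstarAlgType R) := FermionChain {
  ann : int -> A;
  car_ann : forall i j, ann i * ann j + ann j * ann i = 0;
  car_cre : forall i j,
    adj (ann i) * adj (ann j) + adj (ann j) * adj (ann i) = 0;
  car_mix : forall i j,
    adj (ann j) * ann i + ann i * adj (ann j) = (i == j)%:R;
  car_gen :
    cstar_gen [set x | exists j, x = ann j \/ x = adj (ann j)] = setT;
  theta : {lrmorphism A -> A};
  theta_aut : star_automorphism theta;
  theta_ann : forall j, theta (ann j) = - ann j;
  tau : int -> {lrmorphism A -> A};
  tau_aut : forall k, star_automorphism (tau k);
  tau_ann : forall k j, tau k (ann j) = ann (j + k)
}.

Section Chain.
Context {R : realType} {A : cstarAlgType R} (F : fermionChain A).
Local Notation c := (ann F).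

Definition even_part : set A := [set Q | theta F Q = Q].
Definition odd_part : set A := [set Q | theta F Q = - Q].

Definition gens (J : set int) : set A :=
  [set x | exists2 j, J j & x = c j \/ x = adj (c j)].

Definition alg_int (n m : int) : set A :=
  subalgebra_gen (gens [set j | n <= j <= m]).

Definition alg_loc : set A :=
  [set Q | exists n m : int, n < m /\ alg_int n m Q].

Definition alg_L : set A := cstar_gen (gens [set j | j < 0]).

Definition translation_invariant (psi : A -> R[i]) : Prop :=
  forall (k : int) (Q : A), psi (tau F k Q) = psi Q.

(* h = h^* in A_[-n,n], even. *)
Definition interaction (n : nat) (h : A) : Prop :=
  [/\ adj h = h, alg_int (- n%:Z) n%:Z h & even_part h].

(* H_M, the sum of tau_k h over -M + n <= k <= M - n; k = i - M below. *)
Definition hamM (n : nat) (h : A) (M : nat) : A :=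
  \sum_(i < (2 * M)%N.+1 |
        - M%:Z + n%:Z <= (i : nat)%:Z - M%:Z <= M%:Z - n%:Z)
    tau F ((i : nat)%:Z - M%:Z) h.

(* [H, Q]; for Q in alg_loc the sequence is eventually constant;
   the limit is the element selected by xget. *)
Definition ham_comm (n : nat) (h Q : A) : A :=
  xget 0 [set L : A | (fun M => hamM n h M * Q - Q * hamM n h M) @ \oo --> L].

Definition ti_state (psi : {scalar A}) : Prop :=
  state psi /\ translation_invariant psi.

(* psi h is real because h is self-adjoint. *)
Definition ground_state (h : A) (psi : {scalar A}) : Prop :=
  ti_state psi /\
  complex.Re (psi h) =
    inf [set complex.Re (phi h) | phi in [set phi | ti_state phi]].

Definition gapped (n : nat) (h : A) (psi : {scalar A}) : Prop :=
  exists2 m : R, 0 < m &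
    forall Q, alg_loc Q ->
      m%:C * (psi (adj Q * Q) - `|psi Q| ^+ 2)
        <= psi (adj Q * ham_comm n h Q).

(* S[0, k-1] *)
Definition string (k : nat) : A :=
  \prod_(j < k) (2%:R *: (adj (c (j : nat)%:Z) * c (j : nat)%:Z) - 1).

Definition string_order (psi : {scalar A}) : Prop :=
  exists (n m : int) (Q1 Q2 : A),
    [/\ n < 0 /\ 0 <= m,
        odd_part Q1 /\ alg_int n (- 1) Q1,
        odd_part Q2 /\ alg_int 0 m Q2 &
        exists2 l : R[i]^o, l != 0 &
          (fun k : nat =>
             psi (Q1 * string (2 * k)%N * tau F (2 * k)%N%:Z Q2) : R[i]^o)
            @ \oo --> l].

(* A total function; it is the Z_2-index when psi is a theta-invariant pure
   state with the split property. *)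
Definition ind_Z2 (psi : {scalar A}) : int :=
  if `[< factor_state alg_L psi >] then 1 else - 1.

End Chain.

(* Main.v *)
Require Import Defs.
From HB Require Import structures.
From mathcomp Require Import all_boot all_order all_algebra.
From mathcomp Require Import complex.
From mathcomp Require Import all_classical all_reals all_analysis.
From mathcomp Require Import ring lra zify.
Import Order.TTheory GRing.Theory Num.Theory.
Import numFieldNormedType.Exports.

Set Implicit Arguments.
Unset Strict Implicit.
Unset Printing Implicit Defensive.

Local Open Scope classical_set_scope.
Local Open Scope ring_scope.
Local Open Scope complex_scope.

(** Write [L] and [R] for the half-chains [j < 0] and [j >= 0], [S] for strings
    and [U] for the unitary translations in the GNS space of [psi].

    A weak limit of the elements [tau_{-2k}(Q1) S[-2k,-1]] of [A_L] is central in
    the von Neumann algebra of [A_L]. It is odd, so it can be a scalar only if it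
    is [0], which a non-zero limit of the string correlations forbids.

    Conversely, the even central elements are scalars because [psi] is pure, so
    a non-trivial centre contains an odd self-adjoint unitary [Z]. It commutes
    with [A_L] and acts as the parity automorphism on [A_R]. Hence
    [zeta = Z Omega] satisfies [U_{-1} zeta = s sigma_{-1} zeta] with [s = 1] or
    [s = -1], which gives [S[0,2k-1] zeta = U_{2k} zeta], and the mixing of
    translations yields
      [psi (Q1 S[0,2k-1] tau_{2k}(Q2)) --> - <Q2 zeta, Omega> <Q1 zeta, Omega>]
    for odd local [Q1] in [A_L] and [Q2] in [A_R]. Neither factor vanishes
    identically: [zeta] is cyclic for [A_L], and a vanishing on [A_R] would be
    transported to all local elements by the translations. *)

(** * Semi-inner products *)

(** Purity acts through one principle, [pure_dominated]: a bounded functional whose modulus on the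
    elements [P* P] is dominated by [psi] is a multiple of [psi]. It is applied to a limit of
    translates (mixing of even elements), to the functional of an even central operator, and to a
    mixed functional of [U_{-1} zeta] and [sigma_{-1} zeta]. Positivity of these functionals is not
    known, so only their modulus is bounded.

    The factor property lives on the GNS space [K] of the restriction to [A_L], while the whole
    chain acts on the GNS space [H] of [psi]. An isometry [V : K -> H] links them. A central
    operator acts on [K] only, so it is moved past [pi r] inside matrix elements between vectors of
    [V K].

    The vectors [U_{-1} zeta] and [sigma_{-1} zeta] are proportional because both induce the same
    functional, the limit of [psi] conjugated by strings that start at site -1. The factor [s] has
    modulus 1 because both operators are isometric, and it is real because [Z] is self-adjoint.
    Strings of even length remove the remaining sign. *)

Section Modulus.
Context {R : realType}.
Implicit Types a b z : R[i].

Definition cabs z : R := complex.Re `|z|.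

Lemma cabsE z : `|z| = (cabs z)%:C.
Proof. by rewrite /cabs normc_def. Qed.

Lemma cabs_ge0 z : 0 <= cabs z.
Proof. by rewrite -lecR -cabsE normr_ge0. Qed.

Lemma cabsM a b : cabs (a * b) = cabs a * cabs b.
Proof. by apply: complexI; rewrite rmorphM /= -!cabsE normrM. Qed.

Lemma cabsD a b : cabs (a + b) <= cabs a + cabs b.
Proof. by rewrite -lecR rmorphD /= -!cabsE ler_normD. Qed.

Lemma cabsN a : cabs (- a) = cabs a.
Proof. by rewrite /cabs normrN. Qed.

Lemma cabsB a b : cabs (a - b) <= cabs a + cabs b.
Proof. by rewrite -(cabsN b) cabsD. Qed.

Lemma cabs0 : cabs 0 = 0.
Proof. by rewrite /cabs normr0. Qed.

Lemma cabs1 : cabs 1 = 1.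
Proof. by rewrite /cabs normr1. Qed.

Lemma cabs_eq0 z : (cabs z == 0) = (z == 0).
Proof. by rewrite -(inj_eq (@complexI _)) -cabsE normr_eq0. Qed.

Lemma cabs_real (x : R) : cabs x%:C = `|x|.
Proof. by rewrite /cabs normc_def /= expr0n addr0 sqrtr_sqr. Qed.

Lemma mul_conjC z : z * conjc z = (cabs z ^+ 2)%:C.
Proof.
rewrite /cabs normc_def /= sqr_sqrtr ?addr_ge0 ?sqr_ge0 //.
by case: z => x y; apply/eqP; rewrite eq_complex /=; apply/andP; split; apply/eqP; ring.
Qed.

Lemma conjcM a b : conjc (a * b) = conjc a * conjc b.
Proof. exact: rmorphM. Qed.

Lemma conjcD a b : conjc (a + b) = conjc a + conjc b.
Proof. exact: rmorphD. Qed.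

Lemma conjcN a : conjc (- a) = - conjc a.
Proof. exact: rmorphN. Qed.

Lemma cabsJ z : cabs (conjc z) = cabs z.
Proof. by case: z => x y; rewrite /cabs !normc_def /= sqrrN. Qed.

Lemma Re_le_cabs z : complex.Re z <= cabs z.
Proof.
case: z => x y; rewrite /cabs normc_def /= (le_trans (ler_norm x)) //.
by rewrite -sqrtr_sqr ler_wsqrtr // lerDl sqr_ge0.
Qed.

Lemma Re_real z : 0 <= z -> z = (complex.Re z)%:C.
Proof. by move=> z0; rewrite RRe_real ?ger0_real. Qed.

Lemma cabs_ge0_Re z : 0 <= z -> cabs z = complex.Re z.
Proof. by move=> /ger0_norm zE; rewrite /cabs zE. Qed.

End Modulus.

Record semi_inner (R : realType) (V : lmodType R[i]) (s : V -> V -> R[i])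
    : Prop := SemiInner {
  si_lin : forall (a : R[i]) x y z, s (a *: x + y) z = a * s x z + s y z;
  si_conj : forall x y, s y x = conjc (s x y);
  si_ge0 : forall x, 0 <= s x x
}.

Section SemiInner.
Context {R : realType} {V : lmodType R[i]} (s : V -> V -> R[i]).
Hypothesis si : semi_inner s.
Implicit Types (a : R[i]) (x y z : V).

Definition sn x : R := Num.sqrt (complex.Re (s x x)).

Lemma siDl x y z : s (x + y) z = s x z + s y z.
Proof. by rewrite -[x]scale1r (si_lin si) mul1r scale1r. Qed.

Lemma si0l z : s 0 z = 0.
Proof. by apply: (addrI (s 0 z)); rewrite -siDl !addr0. Qed.

Lemma siZl a x z : s (a *: x) z = a * s x z.
Proof. by rewrite -[a *: x]addr0 (si_lin si) si0l addr0. Qed.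

Lemma siNl x z : s (- x) z = - s x z.
Proof. by rewrite -scaleN1r siZl mulN1r. Qed.

Lemma siBl x y z : s (x - y) z = s x z - s y z.
Proof. by rewrite siDl siNl. Qed.

Lemma siDr x y z : s x (y + z) = s x y + s x z.
Proof. by rewrite (si_conj si) siDl rmorphD /= -!(si_conj si). Qed.

Lemma si0r z : s z 0 = 0.
Proof. by rewrite (si_conj si) si0l conjc0. Qed.

Lemma siZr a x z : s x (a *: z) = conjc a * s x z.
Proof. by rewrite (si_conj si) siZl rmorphM /= -(si_conj si). Qed.

Lemma siNr x z : s x (- z) = - s x z.
Proof. by rewrite (si_conj si) siNl rmorphN /= -(si_conj si). Qed.

Lemma siBr x y z : s x (y - z) = s x y - s x z.
Proof. by rewrite siDr siNr. Qed.

Lemma sn_ge0 x : 0 <= sn x.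
Proof. exact: sqrtr_ge0. Qed.

Lemma si_self x : s x x = (sn x ^+ 2)%:C.
Proof.
have x0 := si_ge0 si x; rewrite sqr_sqrtr -?Re_real //.
by rewrite -lecR -Re_real.
Qed.

Lemma sn0 : sn 0 = 0.
Proof. by rewrite /sn si0l sqrtr0. Qed.

Lemma snZ a x : sn (a *: x) = cabs a * sn x.
Proof.
apply/eqP; rewrite -(@eqrXn2 _ 2%N) ?mulr_ge0 ?sn_ge0 ?cabs_ge0 //.
apply/eqP/complexI; rewrite -si_self siZl siZr mulrA mul_conjC si_self.
by rewrite -rmorphM exprMn.
Qed.

Lemma snN x : sn (- x) = sn x.
Proof. by rewrite -scaleN1r snZ cabsN cabs1 mul1r. Qed.

Lemma sn_sub x y : sn (x - y) = sn (y - x).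
Proof. by rewrite -snN opprB. Qed.

Lemma siDD x y :
  sn (x + y) ^+ 2 = sn x ^+ 2 + 2 * complex.Re (s x y) + sn y ^+ 2.
Proof.
have := si_self (x + y); rewrite siDl !siDr (si_conj si x y).
move: (s x y) => w; rewrite !si_self => /(congr1 (@complex.Re _)).
by case: w => u v /= <-; ring.
Qed.

Lemma si_CS2 x y : cabs (s x y) ^+ 2 <= sn x ^+ 2 * sn y ^+ 2.
Proof.
set m := cabs (s x y) ^+ 2; set X := sn x ^+ 2; set Y := sn y ^+ 2.
have key (t : R) : 0 <= X - 2 * t * m + t ^+ 2 * m * Y.
  have : 0 <= sn (x - (t%:C * s x y) *: y) ^+ 2 by rewrite sqr_ge0.
  have -> : sn (x - (t%:C * s x y) *: y) ^+ 2 = X - 2 * t * m + t ^+ 2 * m * Y.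
    rewrite siDD siNr siZr snN snZ conjcM conjc_real.
    rewrite -mulrA [conjc _ * _]mulrC mul_conjC -/m -rmorphM -rmorphN /=.
    by rewrite cabsM cabs_real !exprMn real_normK ?num_real // -/X -/Y -/m; ring.
  by [].
have m0 : 0 <= m by rewrite sqr_ge0.
have Y0 : 0 <= Y by rewrite sqr_ge0.
have [YE|Yn] := eqVneq Y 0.
  (* For [Y = 0] the bound [key] is affine in [t], and this [t] would give it the value [-1]. *)
  have := key ((X + 1) / (2 * m)); rewrite YE !mulr0 addr0.
  have [->|mn] := eqVneq m 0; first by [].
  suff -> : 2 * ((X + 1) / (2 * m)) * m = X + 1 by lra.
  by field.
have := key Y^-1; rewrite expr2.
have -> : Y^-1 * Y^-1 * m * Y = Y^-1 * m by field.
move=> H; have : 0 <= (X - Y^-1 * m) * Y by rewrite mulr_ge0 //; lra.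
rewrite mulrBl; have -> : Y^-1 * m * Y = m by field.
by lra.
Qed.

Lemma si_CS x y : cabs (s x y) <= sn x * sn y.
Proof.
rewrite -(@ler_pXn2r _ 2%N) ?nnegrE ?mulr_ge0 ?sn_ge0 ?cabs_ge0 //.
by rewrite exprMn si_CS2.
Qed.

Lemma snD x y : sn (x + y) <= sn x + sn y.
Proof.
rewrite -(@ler_pXn2r _ 2%N) ?nnegrE ?addr_ge0 ?sn_ge0 // siDD sqrrD.
have := le_trans (Re_le_cabs (s x y)) (si_CS x y); lra.
Qed.

Lemma snB x y : sn (x - y) <= sn x + sn y.
Proof. by rewrite -(snN y) snD. Qed.

Lemma sn_dist x y z : sn (x - z) <= sn (x - y) + sn (y - z).
Proof. by rewrite -[x - z](subrKA y) snD. Qed.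

Lemma sn_parallelogram x y :
  sn (x + y) ^+ 2 + sn (x - y) ^+ 2 = 2 * sn x ^+ 2 + 2 * sn y ^+ 2.
Proof. by rewrite !siDD siNr snN raddfN; lra. Qed.

End SemiInner.

(** * Hilbert spaces *)

Section RealLemmas.
Context {R : realType}.

(** The form in which approximation arguments end: an error linear in [e], where [e <= 1] allows
    quadratic errors to be absorbed into [C]. *)
Lemma le0_eps (x C : R) : (forall e : R, 0 < e -> e <= 1 -> x <= C * e) -> x <= 0.
Proof.
move=> xC; rewrite leNgt; apply/negP => x0.
have C0 : 0 < C by have := xC 1 ltr01 (lexx _); lra.
pose e := Num.min 1 (x / C / 2).
have e0 : 0 < e by rewrite lt_min ltr01 !divr_gt0.
have e1 : e <= 1 by rewrite ge_min lexx.
have : C * e <= C * (x / C / 2) by rewrite ler_pM2l // ge_min lexx orbT.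
have -> : C * (x / C / 2) = x / 2 by field; rewrite gt_eqF.
by have := xC e e0 e1; lra.
Qed.

Lemma quadratic_min (m N : R) : 0 <= N ->
  (forall t : R, 0 <= t ^+ 2 * m * N - 2 * t * m) -> m <= 0.
Proof.
move=> N0 H; rewrite leNgt; apply/negP => m0.
have N1 : N + 1 != 0 by rewrite gt_eqF //; lra.
(* The minimiser is [1 / N]; [1 / (N + 1)] also covers [N = 0]. *)
have := H (N + 1)^-1.
have -> : (N + 1)^-1 ^+ 2 * m * N - 2 * (N + 1)^-1 * m =
  - (m * (N + 2) / (N + 1) ^+ 2) by field.
rewrite oppr_ge0 leNgt => /negP; apply.
by rewrite divr_gt0 ?mulr_gt0 ?exprn_gt0 //; lra.
Qed.

Lemma eq_eps (a b : R[i]) (C : R) :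
  (forall e : R, 0 < e -> e <= 1 -> cabs (a - b) <= C * e) -> a = b.
Proof.
move=> ab; apply/eqP; rewrite -subr_eq0 -cabs_eq0 eq_le cabs_ge0 andbT.
exact: (le0_eps ab).
Qed.

Lemma invS_lt (e : R) : 0 < e ->
  exists N, forall n, (N <= n)%N -> n.+1%:R^-1 < e.
Proof.
move=> e0; exists (Num.truncn e^-1) => n Nn.
rewrite invf_plt ?posrE ?ltr0n //.
by apply: (lt_le_trans (truncnS_gt _)); rewrite ler_nat ltnS.
Qed.

End RealLemmas.

Notation hn := (sn (@inner _ _)).

Section HilbertBasics.
Context {R : realType} {H : hilbertType R}.
Implicit Types x y z : H.

Lemma inner_si : semi_inner (@inner R H).
Proof.
split; [exact: innerPl | exact: innerC |].
by move=> x; rewrite inner_norm exprn_ge0.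
Qed.

Lemma hnE x : `|x| = (hn x)%:C.
Proof.
apply/eqP; rewrite -(@eqrXn2 _ 2%N) ?normr_ge0 //; last first.
  by rewrite (lecR 0) sn_ge0.
by rewrite -inner_norm (si_self inner_si) rmorphXn.
Qed.

Lemma hn_eq0 x : (hn x == 0) = (x == 0).
Proof. by rewrite -(inj_eq (@complexI _)) -hnE normr_eq0. Qed.

Lemma hn_le0 x : hn x <= 0 -> x = 0.
Proof.
by move=> x0; apply/eqP; rewrite -hn_eq0 eq_le x0 sn_ge0.
Qed.

Lemma closure_hn (D : set H) x :
  closure D x <-> forall e : R, 0 < e -> exists2 y, D y & hn (x - y) < e.
Proof.
split=> [cDx e e0|xD B].
  have /cDx[y [Dy /=]] : nbhs x (ball x e%:C).
    by apply: nbhsx_ballx; rewrite (ltcR 0).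
  by rewrite -ball_normE /= hnE ltcR; exists y.
move=> /nbhs_ballP[e /= e0 xeB].
have [f [f0 eE]] : exists f : R, 0 < f /\ e = f%:C.
  exists (complex.Re e); have eE := Re_real (ltW e0).
  by split => //; rewrite -ltcR -eE.
have [y Dy xy] := xD f f0; exists y; split=> //; apply: xeB.
by rewrite -ball_normE /= hnE eE ltcR.
Qed.

Lemma hilbert_complete (u : nat -> H) :
  (forall e : R, 0 < e -> exists N, forall p q,
     (N <= p)%N -> (N <= q)%N -> hn (u p - u q) < e) ->
  exists l, forall e : R, 0 < e -> exists N, forall p,
     (N <= p)%N -> hn (u p - l) < e.
Proof.
move=> cu.
have /cauchy_cvgP : cauchy (u @ \oo).
  apply: cauchy_exP => e e0.
  have eE := Re_real (ltW e0).
  have [|N uN] := cu (complex.Re e); first by rewrite -ltcR -eE.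
  exists (u N), N => // p /= Np.
  by rewrite -ball_normE /= hnE eE ltcR; apply: uN.
move=> /cvg_ex[l ul]; exists l => e e0.
have /ul[N _ uN] : nbhs l (ball l e%:C).
  by apply: nbhsx_ballx; rewrite (ltcR 0).
exists N => p Np; have := uN p Np.
by rewrite -ball_normE /= hnE ltcR (sn_sub inner_si).
Qed.

End HilbertBasics.

Definition linear_op (R : realType) (H1 H2 : hilbertType R) (T : H1 -> H2) :=
  forall (a : R[i]) x y, T (a *: x + y) = a *: T x + T y.

Definition bounded_by (R : realType) (H1 H2 : hilbertType R) (T : H1 -> H2)
  (C : R) := forall x, hn (T x) <= C * hn x.

Section LinearOp.
Context {R : realType} {H1 H2 : hilbertType R} (T : H1 -> H2).
Hypothesis Tl : linear_op T.

Lemma lop0 : T 0 = 0.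
Proof.
have := Tl 1 0 0; rewrite !scale1r addr0 => e.
by apply: (addrI (T 0)); rewrite addr0.
Qed.

Lemma lopD x y : T (x + y) = T x + T y.
Proof. by have := Tl 1 x y; rewrite !scale1r. Qed.

Lemma lopZ a x : T (a *: x) = a *: T x.
Proof. by rewrite -[a *: x]addr0 Tl lop0 addr0. Qed.

Lemma lopN x : T (- x) = - T x.
Proof. by rewrite -scaleN1r lopZ scaleN1r. Qed.

Lemma lopB x y : T (x - y) = T x - T y.
Proof. by rewrite lopD lopN. Qed.

Lemma bounded_continuous C : bounded_by T C -> continuous T.
Proof.
move=> TC x; apply/cvgrPdist_lt => e e0.
have eE := Re_real (ltW e0).
have C0 : 0 < `|C| + 1 by have := normr_ge0 C; lra.
have e'0 : 0 < complex.Re e by rewrite -ltcR -eE.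
apply/nbhs_ballP; exists (complex.Re e / (`|C| + 1))%:C => /=.
  by rewrite (ltcR 0) divr_gt0.
move=> y; rewrite -ball_normE /= hnE ltcR => xy.
rewrite -lopB hnE eE ltcR; apply: (le_lt_trans (TC _)).
rewrite (le_lt_trans (y := (`|C| + 1) * hn (x - y))) //.
  rewrite ler_wpM2r ?sn_ge0 //.
  by have := ler_norm C; lra.
by rewrite mulrC -ltr_pdivlMr.
Qed.

Lemma continuous_bounded : continuous T -> exists2 C, 0 < C & bounded_by T C.
Proof.
move=> /(_ 0); rewrite /continuous_at lop0 => /cvgrPdist_lt /(_ 1 ltr01).
move=> /nbhs_ballP[e /= e0 Te].
have eE := Re_real (ltW e0).
have e'0 : 0 < complex.Re e by rewrite -ltcR -eE.
move: (complex.Re e) eE e'0 => d eE d0.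
exists (2 / d); first by rewrite divr_gt0.
move=> x; have [->|x0] := eqVneq x 0.
  by rewrite lop0 !(sn0 inner_si) mulr0.
have hx0 : 0 < hn x by rewrite lt_def sn_ge0 hn_eq0 x0.
have tx : hn ((d / (2 * hn x))%:C *: x) = d / 2.
  rewrite (snZ inner_si) cabs_real ger0_norm; last first.
    by rewrite divr_ge0 ?mulr_ge0 ?ltW.
  by field; rewrite gt_eqF.
have := Te ((d / (2 * hn x))%:C *: x).
rewrite -ball_normE /= !sub0r !normrN !hnE tx eE !ltcR.
have d2 : d / 2 < d by lra.
move=> /(_ d2); rewrite lopZ (snZ inner_si) cabs_real ger0_norm; last first.
  by rewrite divr_ge0 ?mulr_ge0 ?ltW.
move=> lt1.
have -> : 2 / d * hn x = (d / (2 * hn x))^-1 by field; rewrite !gt_eqF.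
rewrite -[X in _ <= X]mul1r ler_pdivlMr ?divr_gt0 ?mulr_gt0 //.
by rewrite mulrC ltW // -ltcR.
Qed.

End LinearOp.

(** * Riesz representation *)

Section Riesz.
Context {R : realType} {H : hilbertType R}.

Lemma inner_ext (x y : H) : (forall z, inner x z = inner y z) -> x = y.
Proof.
move=> xy; apply/eqP; rewrite -subr_eq0; apply/eqP/hn_le0.
suff : hn (x - y) ^+ 2 = 0 by move=> /eqP; rewrite sqrf_eq0 => /eqP ->.
apply: complexI; rewrite -(si_self inner_si) (siBl inner_si) xy.
by rewrite subrr.
Qed.

Lemma inner_extr (x y : H) : (forall z, inner z x = inner z y) -> x = y.
Proof.
by move=> xy; apply: inner_ext => z; rewrite innerC xy -innerC.
Qed.

(** The representing vector is a multiple of the vector [v0] of least norm on the hyperplane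
    [g = 1]. The parallelogram identity makes minimising sequences Cauchy, and minimality makes [v0]
    orthogonal to the kernel of [g]. *)
Lemma riesz (g : H -> R[i]) (C : R) :
  (forall (a : R[i]) x y, g (a *: x + y) = a * g x + g y) ->
  (forall x, cabs (g x) <= C * hn x) ->
  exists v, forall x, g x = inner x v.
Proof.
move=> gl gC.
have g0 : g 0 = 0.
  have := gl 1 0 0; rewrite scale1r mul1r addr0 => e.
  by apply: (addrI (g 0)); rewrite addr0.
have gZ a x : g (a *: x) = a * g x by rewrite -[a *: x]addr0 gl g0 addr0.
have gD x y : g (x + y) = g x + g y by rewrite -[x]scale1r gl mul1r scale1r.
have gB x y : g (x - y) = g x - g y by rewrite gD -scaleN1r gZ mulN1r.
have [gz|[x0 gx0]] : (forall x, g x = 0) \/ exists x0, g x0 != 0.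
- have [|ng] := pselect (exists x0, g x0 != 0); first by right.
  left => x; apply/eqP/negPn/negP => gx; apply: ng; by exists x.
- by exists 0 => x; rewrite gz (si0r inner_si).
pose S := [set hn x | x in [set x | g x = 1]].
have S0 : S !=set0.
  by exists (hn ((g x0)^-1 *: x0)), ((g x0)^-1 *: x0) => //=; rewrite gZ mulVf.
have Sl : has_lbound S by exists 0 => _ [x _ <-]; exact: sn_ge0.
pose d := inf S.
have dle x : g x = 1 -> d <= hn x by move=> gx; apply: ge_inf => //; exists x.
have d0 : 0 <= d by apply: lb_le_inf => // _ [x _ <-]; exact: sn_ge0.
have [u uP] : exists u : nat -> H, forall k, g (u k) = 1 /\ hn (u k) < d + k.+1%:R^-1.
  suff /choice[u uP] : forall k : nat, exists x, g x = 1 /\ hn x < d + k.+1%:R^-1.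
    by exists u.
  move=> k; have [||_ [x gx <-] xd] := @inf_adherent _ S k.+1%:R^-1.
  - by rewrite invr_gt0 ltr0n.
  - by split.
  - by exists x.
have half x y : g x = 1 -> g y = 1 -> 2 * d <= hn (x + y).
  move=> gx gy; have := dle (2^-1%:C *: (x + y)).
  rewrite gZ gD gx gy (snZ inner_si) cabs_real ger0_norm ?invr_ge0 //.
  have -> : 2^-1%:C * (1 + 1) = 1 :> R[i].
    by rewrite (_ : 1 + 1 = 2%:C) -?rmorphM ?mulVf ?rmorph1 ?pnatr_eq0 // rmorphD.
  by move=> /(_ erefl); lra.
have [v0 uv] : exists l, forall e : R, 0 < e -> exists N, forall p,
     (N <= p)%N -> hn (u p - l) < e.
  apply: hilbert_complete => e e0.
  (* By the parallelogram identity the squared distance is at most [4 (d + f)^2 - 4 d^2], hence at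
     most [(8 d + 4) f] when [f <= 1]. *)
  have e2 : 0 < e ^+ 2 / (8 * d + 4) by rewrite divr_gt0 ?exprn_gt0 //; lra.
  pose f := Num.min 1 (e ^+ 2 / (8 * d + 4)).
  have f0 : 0 < f by rewrite lt_min ltr01.
  have [N fN] := invS_lt f0.
  exists N => p q Np Nq.
  have bnd r : (N <= r)%N -> hn (u r) < d + f.
    move=> Nr; apply: (lt_trans (uP r).2); rewrite ltrD2l.
    exact: fN.
  rewrite -(@ltr_pXn2r _ 2%N) ?nnegrE ?sn_ge0 ?ltW //.
  have := sn_parallelogram inner_si (u p) (u q).
  have pq := half _ _ (uP p).1 (uP q).1.
  have pq2 : (2 * d) ^+ 2 <= hn (u p + u q) ^+ 2.
    by rewrite ler_pXn2r ?nnegrE ?sn_ge0 // mulr_ge0.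
  have hsq r : (N <= r)%N -> hn (u r) ^+ 2 < (d + f) ^+ 2.
    move=> Nr; rewrite ltr_pXn2r ?nnegrE ?sn_ge0 ?bnd //.
    by rewrite addr_ge0 // ltW.
  have := hsq _ Np; have := hsq _ Nq.
  have f1 : f <= 1 by rewrite ge_min lexx.
  have fe : f * (8 * d + 4) <= e ^+ 2.
    by rewrite -ler_pdivlMr ?ge_min ?lexx ?orbT //; lra.
  have ff : f ^+ 2 <= f by rewrite expr2 ler_piMl // ltW.
  nra.
have C0 : 0 <= C.
  have := le_trans (cabs_ge0 _) (gC x0); rewrite pmulr_lge0 //.
  rewrite lt_def sn_ge0 hn_eq0 andbT; apply: contra gx0 => /eqP ->.
  by rewrite g0.
have gv : g v0 = 1.
  apply/eqP; rewrite -subr_eq0 -cabs_eq0 eq_le cabs_ge0 andbT.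
  apply: (@le0_eps _ _ C) => e /uv[N /(_ N (leqnn N)) uNe] _.
  rewrite -(uP N).1 -gB (le_trans (gC _)) // ler_wpM2l //.
  by rewrite (sn_sub inner_si) ltW.
have vd : hn v0 <= d.
  suff : hn v0 - d <= 0 by lra.
  apply: (@le0_eps _ _ 2) => e e0 _; have [N uN] := uv e e0.
  have [N' N'e] := invS_lt e0; pose M := maxn N N'.
  have := uN M (leq_maxl _ _); have := (uP M).2; have := N'e M (leq_maxr _ _).
  have := sn_dist inner_si v0 (u M) 0; rewrite !subr0.
  rewrite (sn_sub inner_si v0); move: (M.+1%:R^-1) => w.
  lra.
have {}vd : hn v0 = d by apply/eqP; rewrite eq_le vd dle.
have vperp y : g y = 0 -> inner v0 y = 0.
  move=> gy; apply/eqP; rewrite -cabs_eq0 -sqrf_eq0 eq_le sqr_ge0 andbT.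
  apply: (@quadratic_min _ _ (hn y ^+ 2)); first exact: sqr_ge0.
  move=> t; set m := cabs _ ^+ 2.
  have : d ^+ 2 <= hn (v0 - (t%:C * inner v0 y) *: y) ^+ 2.
    rewrite ler_pXn2r ?nnegrE ?sn_ge0 ?dle //.
    by rewrite gB gZ gy mulr0 subr0.
  have -> : hn (v0 - (t%:C * inner v0 y) *: y) ^+ 2
     = d ^+ 2 - 2 * t * m + t ^+ 2 * m * hn y ^+ 2.
    rewrite (siDD inner_si) (siNr inner_si) (siZr inner_si).
    rewrite (snN inner_si) (snZ inner_si) conjcM conjc_real.
    rewrite -mulrA [conjc _ * _]mulrC mul_conjC -/m -rmorphM -rmorphN /=.
    by rewrite cabsM cabs_real !exprMn real_normK ?num_real // -/m vd; ring.
  by lra.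
have dn : d%:C != 0.
  rewrite -vd -hnE normr_eq0; apply/negP => /eqP v00.
  by move: gv; rewrite v00 g0 => /eqP; rewrite eq_sym oner_eq0.
(* [x - g x *: v0] lies in the kernel of [g], so it is orthogonal to [v0], and
   [inner v0 v0 = d ^ 2]. *)
exists ((d%:C ^- 2) *: v0) => x.
have : inner (x - g x *: v0) v0 = 0.
  by rewrite innerC vperp ?conjc0 // gB gZ gv mulr1 subrr.
rewrite (siBl inner_si) (siZl inner_si) (si_self inner_si) vd.
move=> /eqP; rewrite subr_eq0 => /eqP E.
rewrite (siZr inner_si) E -rmorphXn -fmorphV conjc_real.
by rewrite rmorphXn fmorphV rmorphXn mulrCA mulVf ?mulr1 // expf_neq0.
Qed.

End Riesz.

Section Adjoint.
Context {R : realType} {H1 H2 : hilbertType R} (T : H1 -> H2) (C : R).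
Hypotheses (Tl : linear_op T) (TC : bounded_by T C).

Lemma adjoint_exists : exists T' : H2 -> H1,
  [/\ linear_op T', exists C', bounded_by T' C'
    & forall x y, inner (T x) y = inner x (T' y)].
Proof.
have ex y : exists v, forall x, inner (T x) y = inner x v.
  apply: (@riesz _ _ _ (C * hn y)) => [a x z|x].
    by rewrite Tl innerPl.
  apply: (le_trans (si_CS inner_si _ _)).
  by rewrite mulrAC ler_wpM2r ?sn_ge0 ?TC.
have [T' TT'] := choice ex.
exists T'; split=> [a x y||x y]; last exact: TT'.
  apply: inner_extr => z.
  by rewrite (siDr inner_si) (siZr inner_si) -!TT' (siDr inner_si) (siZr inner_si).
exists `|C| => y; have := si_self inner_si (T' y); rewrite -TT' => E.
have [->|T'y0] := eqVneq (T' y) 0.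
  by rewrite (sn0 inner_si) mulr_ge0 ?sn_ge0.
have hT : 0 < hn (T' y) by rewrite lt_def sn_ge0 hn_eq0 T'y0.
have : hn (T' y) ^+ 2 <= hn (T (T' y)) * hn y.
  have := si_CS inner_si (T (T' y)) y; rewrite E cabs_real ger0_norm //.
  exact: sqr_ge0.
have : hn (T (T' y)) * hn y <= `|C| * hn (T' y) * hn y.
  rewrite ler_wpM2r ?sn_ge0 // (le_trans (TC _)) // ler_wpM2r ?sn_ge0 //.
  exact: ler_norm.
rewrite expr2 => h1 h2; rewrite -(ler_pM2l hT); apply: (le_trans h2).
by apply: (le_trans h1); rewrite mulrCA mulrA.
Qed.

End Adjoint.

(** * Completion *)

Section Completeness.
Context {R : realType}.

Lemma real_complete (u : nat -> R) :
  (forall e : R, 0 < e -> exists N, forall p q,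
     (N <= p)%N -> (N <= q)%N -> `|u p - u q| < e) ->
  exists l, forall e : R, 0 < e -> exists N, forall p,
     (N <= p)%N -> `|u p - l| < e.
Proof.
move=> cu.
have /cauchy_cvgP : cauchy (u @ \oo).
  apply: cauchy_exP => e /cu[N uN]; exists (u N), N => // p /= Np.
  by rewrite -ball_normE /=; apply: uN.
move=> /cvg_ex[l /cvgrPdist_lt ul]; exists l => e /ul[N _ uN].
by exists N => p /uN /=; rewrite distrC.
Qed.

Lemma cabs_Re_Im (z : R[i]) : cabs z <= `|complex.Re z| + `|complex.Im z|.
Proof.
have {1}-> : z = (complex.Re z)%:C + 'i * (complex.Im z)%:C by exact: complexE.
apply: (le_trans (cabsD _ _)); rewrite cabsM !cabs_real lerD2l.
by rewrite /cabs normc_def /= expr0n add0r expr1n sqrtr1 mul1r.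
Qed.

Lemma Im_le_cabs (z : R[i]) : `|complex.Im z| <= cabs z.
Proof.
case: z => x y; rewrite /cabs normc_def /= -sqrtr_sqr.
by rewrite ler_wsqrtr // lerDr sqr_ge0.
Qed.

Lemma absRe_le_cabs (z : R[i]) : `|complex.Re z| <= cabs z.
Proof.
case: z => x y; rewrite /cabs normc_def /= -sqrtr_sqr.
by rewrite ler_wsqrtr // lerDl sqr_ge0.
Qed.

Lemma complex_complete (u : nat -> R[i]) :
  (forall e : R, 0 < e -> exists N, forall p q,
     (N <= p)%N -> (N <= q)%N -> cabs (u p - u q) < e) ->
  exists l, forall e : R, 0 < e -> exists N, forall p,
     (N <= p)%N -> cabs (u p - l) < e.
Proof.
move=> cu.
have [a ua] : exists l, forall e : R, 0 < e -> exists N, forall p,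
    (N <= p)%N -> `|complex.Re (u p) - l| < e.
  apply: real_complete => e /cu[N uN]; exists N => p q Np Nq.
  by apply: (le_lt_trans _ (uN p q Np Nq)); rewrite -raddfB absRe_le_cabs.
have [b ub] : exists l, forall e : R, 0 < e -> exists N, forall p,
    (N <= p)%N -> `|complex.Im (u p) - l| < e.
  apply: real_complete => e /cu[N uN]; exists N => p q Np Nq.
  by apply: (le_lt_trans _ (uN p q Np Nq)); rewrite -raddfB Im_le_cabs.
exists (a +i* b) => e e0.
have e2 : 0 < e / 2 by rewrite divr_gt0.
have [N uN] := ua _ e2; have [M uM] := ub _ e2; exists (maxn N M) => p.
rewrite geq_max => /andP[/uN h1 /uM h2].
apply: (le_lt_trans (cabs_Re_Im _)).
by case: (u p) h1 h2 => x y /= h1 h2; lra.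
Qed.

End Completeness.

(** Bundled so that the type [completion] and its structures depend on one parameter. The form may
    be degenerate; [ph_sub] is the subspace to be completed. *)
Record preHilbert (R : realType) := PreHilbert {
  ph_car : lmodType R[i];
  ph_form : ph_car -> ph_car -> R[i];
  ph_si : semi_inner ph_form;
  ph_sub : set ph_car;
  ph_sub0 : ph_sub 0;
  ph_subl : forall (a : R[i]) x y, ph_sub x -> ph_sub y -> ph_sub (a *: x + y)
}.

(* The completion of the subspace [W] is realised inside the antidual of [V]:
   it consists of the norm limits of the functionals [s w], [w] in [W]. *)
Section Completion.
Context {R : realType} (P : preHilbert R).
Local Notation V := (ph_car P).
Local Notation s := (@ph_form R P).
Local Notation W := (@ph_sub R P).
Local Notation N := (sn s).
Let si := ph_si P.

(** Distance at most [e] between [f] and [s w] in the antidual norm, written pointwise because [N x]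
    may vanish. *)
Definition approx (f : V -> R[i]) (w : V) (e : R) : Prop :=
  W w /\ forall x, cabs (f x - s w x) <= e * N x.

Definition in_completion (f : V -> R[i]^o) : Prop :=
  forall e : R, 0 < e -> exists w, approx f w e.

Definition completion_pred : {pred V -> R[i]^o} :=
  fun f => `[< in_completion f >].

Lemma approx_lin (a : R[i]) f g w v e d : approx f w e -> approx g v d ->
  approx (fun x => a * f x + g x) (a *: w + v) (cabs a * e + d).
Proof.
move=> [Ww fw] [Wv gv]; split; first exact: ph_subl.
move=> x; rewrite (si_lin si).
have -> : a * f x + g x - (a * s w x + s v x) =
  a * (f x - s w x) + (g x - s v x) by ring.
rewrite (le_trans (cabsD _ _)) // mulrDl lerD // cabsM -mulrA.
by rewrite ler_wpM2l ?cabs_ge0.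
Qed.

Lemma approx_sn f w v e d : 0 <= e -> 0 <= d ->
  approx f w e -> approx f v d -> N (w - v) <= e + d.
Proof.
move=> e0 d0 [Ww fw] [Wv fv]; set n := N (w - v).
have [->|n0] := eqVneq n 0; first by rewrite addr_ge0.
have n1 : 0 < n by rewrite lt_def n0 sn_ge0.
rewrite -(ler_pM2r n1) -expr2.
have := si_self si (w - v); rewrite [LHS](siBl si) => E.
have -> : n ^+ 2 = cabs (s w (w - v) - s v (w - v)).
  by rewrite E cabs_real ger0_norm // sqr_ge0.
have -> : s w (w - v) - s v (w - v) =
  (f (w - v) - s v (w - v)) - (f (w - v) - s w (w - v)) by ring.
rewrite (le_trans (cabsB _ _)) // addrC mulrDl; exact: lerD.
Qed.

Lemma completion_submod : submod_closed completion_pred.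
Proof.
split=> [|a f g /asboolP fc /asboolP gc].
  apply/asboolP => e e0; exists 0; split; first exact: ph_sub0.
  by move=> x; rewrite (si0l si) subrr cabs0 mulr_ge0 ?sn_ge0 // ltW.
apply/asboolP => e e0.
have a1 : 0 < cabs a + 1 by have := cabs_ge0 a; lra.
have [|w fw] := fc (e / 2 / (cabs a + 1)); first by rewrite !divr_gt0.
have [|v gv] := gc (e / 2); first by rewrite divr_gt0.
exists (a *: w + v).
have [Ww H] := approx_lin a fw gv; split => // x.
apply: (le_trans (H x)); rewrite ler_wpM2r ?sn_ge0 //.
suff : cabs a * (e / 2 / (cabs a + 1)) <= e / 2 by lra.
rewrite mulrCA ler_piMr ?divr_ge0 ?ltW // ltr_pdivrMr //; lra.
Qed.

HB.instance Definition _ := GRing.isSubmodClosed.Build _ _ completion_pred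
  completion_submod.

Record completion := MkCompletion {
  completion_fun :> V -> R[i]^o;
  completion_in : completion_fun \in completion_pred
}.
HB.instance Definition _ := [isSub for completion_fun].
HB.instance Definition _ := [Choice of completion by <:].
HB.instance Definition _ := [SubChoice_isSubLmodule of completion by <:].

Implicit Types f g h : completion.

Lemma completionP f e : 0 < e -> exists w, approx f w e.
Proof. by move=> e0; have /asboolP := completion_in f; apply. Qed.

Lemma completion_ext f g : (forall x, f x = g x) -> f = g.
Proof. by move=> fg; apply: val_inj; apply/funext. Qed.

Lemma cplE (a : R[i]) f g x : (a *: f + g) x = a * f x + g x.
Proof. by []. Qed.

Lemma cplB f g x : (f - g) x = f x - g x.
Proof. by []. Qed.

Lemma completion_anti f (a : R[i]) x y : f (a *: x + y) = conjc a * f x + f y.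
Proof.
pose C := N (a *: x + y) + cabs a * N x + N y.
apply: (@eq_eps _ _ _ C) => e e0 _; have [w [_ fw]] := completionP f e0.
have := siDr si w (a *: x) y; rewrite (siZr si) => E.
have -> : f (a *: x + y) - (conjc a * f x + f y) =
  (f (a *: x + y) - s w (a *: x + y)) - conjc a * (f x - s w x) - (f y - s w y).
  by rewrite E; ring.
rewrite (le_trans (cabsB _ _)) // /C !mulrDl lerD //; last by rewrite mulrC.
rewrite (le_trans (cabsB _ _)) // lerD //; first by rewrite mulrC.
by rewrite cabsM cabsJ -mulrA ler_wpM2l ?cabs_ge0 // mulrC.
Qed.

Lemma completionB f x y : f (x - y) = f x - f y.
Proof.
by rewrite addrC -scaleN1r completion_anti conjcN conjc1 mulN1r addrC.
Qed.

Lemma completion_bounded f : exists2 M, 0 <= M & forall x, cabs (f x) <= M * N x.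
Proof.
have [w [_ fw]] := completionP f ltr01; exists (N w + 1).
  by rewrite addr_ge0 ?sn_ge0.
move=> x; rewrite -[f x](subrK (s w x)) (le_trans (cabsD _ _)) //.
by rewrite mulrDl addrC lerD // si_CS.
Qed.

Lemma approx_sn_le f w e M : 0 <= e -> 0 <= M ->
  (forall x, cabs (f x) <= M * N x) -> approx f w e -> N w <= M + e.
Proof.
move=> e0 M0 fM [_ fw].
have [->|n0] := eqVneq (N w) 0; first by rewrite addr_ge0.
have n1 : 0 < N w by rewrite lt_def n0 sn_ge0.
rewrite -(ler_pM2r n1) -expr2 mulrDl.
have -> : N w ^+ 2 = cabs (f w - (f w - s w w)).
  by rewrite opprB addrCA subrr addr0 (si_self si) cabs_real ger0_norm // sqr_ge0.
by rewrite (le_trans (cabsB _ _)) // lerD.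
Qed.

(** [f w] has to be the inner product of [f] with [vec w], so the value at [g] is the limit of [f w]
    as [vec w] tends to [g]. The explicit rate [M * e] determines it without reference to a chosen
    sequence. *)
Definition cinner_spec f g (z : R[i]) : Prop :=
  forall M e w, 0 <= M -> (forall x, cabs (f x) <= M * N x) -> 0 < e ->
    approx g w e -> cabs (f w - z) <= M * e.

Lemma cinner_exists f g : exists z, cinner_spec f g z.
Proof.
have /choice[w wP] : forall k : nat, exists v, approx g v k.+1%:R^-1.
  by move=> k; apply: completionP; rewrite invr_gt0 ltr0n.
have diff M e v d u : 0 <= M -> (forall x, cabs (f x) <= M * N x) ->
    0 <= e -> 0 <= d -> approx g v e -> approx g u d ->
    cabs (f v - f u) <= M * (e + d).
  move=> M0 fM e0 d0 gv gu; rewrite -completionB (le_trans (fM _)) //.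
  by rewrite ler_wpM2l // (approx_sn e0 d0 gv gu).
have i0 k : 0 <= k.+1%:R^-1 :> R by rewrite invr_ge0.
have [z zP] : exists l, forall e : R, 0 < e -> exists N, forall p,
    (N <= p)%N -> cabs (f (w p) - l) < e.
  apply: complex_complete => e e0.
  have [M M0 fM] := completion_bounded f.
  have M1 : 0 < 2 * (M + 1) by lra.
  have [K KP] := invS_lt (divr_gt0 e0 M1).
  exists K => p q Kp Kq.
  apply: (le_lt_trans (diff M _ _ _ _ M0 fM (i0 p) (i0 q) (wP p) (wP q))).
  have := KP p Kp; have := KP q Kq; rewrite !ltr_pdivlMr // => h1 h2.
  have := i0 p; have := i0 q; move: (p.+1%:R^-1) (q.+1%:R^-1) h1 h2 => a b.
  by nra.
exists z => M e v M0 fM e0 gv; rewrite -subr_le0.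
apply: (@le0_eps _ _ (M + 1)) => d d0 _.
have [K1 K1P] := zP d d0; have [K2 K2P] := invS_lt d0.
have := K1P (maxn K1 K2) (leq_maxl _ _); have := K2P (maxn K1 K2) (leq_maxr _ _).
move: (maxn K1 K2) => k h1 h2.
have := diff M _ _ _ _ M0 fM (ltW e0) (i0 k) gv (wP k).
have := cabsD (f v - f (w k)) (f (w k) - z); rewrite subrKA.
have : M * k.+1%:R^-1 <= M * d by rewrite ler_wpM2l // ltW.
rewrite mulrDr mulrDl; move: (M * k.+1%:R^-1) => m; lra.
Qed.

Definition cinner f g : R[i] := projT1 (cid (cinner_exists f g)).

Lemma cinnerP f g : cinner_spec f g (cinner f g).
Proof. by rewrite /cinner; case: cid. Qed.

Lemma cinner_approx f g : exists C : R, forall e w v, 0 < e -> e <= 1 ->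
  approx f w e -> approx g v e -> cabs (cinner f g - s w v) <= C * e.
Proof.
have [M M0 fM] := completion_bounded f.
have [K K0 gK] := completion_bounded g.
exists (M + (K + 1)) => e w v e0 e1 fw gv.
have h1 := cinnerP M0 fM e0 gv.
have h2 := fw.2 v; have h3 := approx_sn_le (ltW e0) K0 gK gv.
have -> : cinner f g - s w v = (f v - s w v) - (f v - cinner f g) by ring.
rewrite (le_trans (cabsB _ _)) //.
have : e * N v <= e * (K + 1) by rewrite ler_pM2l //; lra.
by rewrite mulrDl; lra.
Qed.

Lemma cinner_si : semi_inner cinner.
Proof.
split=> [a f g h|f g|f].
- have [M M0 fM] := completion_bounded f.
  have [K K0 gK] := completion_bounded g.
  have [L L0 aL] := completion_bounded (a *: f + g).
  apply: (@eq_eps _ _ _ (L + cabs a * M + K)) => e e0 _.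
  have [w hw] := completionP h e0.
  have h1 := cinnerP M0 fM e0 hw; have h2 := cinnerP K0 gK e0 hw.
  have h3 := cinnerP L0 aL e0 hw.
  have -> : cinner (a *: f + g) h - (a * cinner f h + cinner g h) =
    - ((a *: f + g) w - cinner (a *: f + g) h) + a * (f w - cinner f h)
    + (g w - cinner g h) by rewrite cplE; ring.
  rewrite !mulrDl (le_trans (cabsD _ _)) // lerD //.
  rewrite (le_trans (cabsD _ _)) // cabsN lerD //.
  by rewrite cabsM -mulrA ler_wpM2l ?cabs_ge0.
- have [C1 H1] := cinner_approx f g; have [C2 H2] := cinner_approx g f.
  apply: (@eq_eps _ _ _ (C2 + C1)) => e e0 e1.
  have [w fw] := completionP f e0; have [v gv] := completionP g e0.
  have h1 := H1 _ _ _ e0 e1 fw gv; have h2 := H2 _ _ _ e0 e1 gv fw.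
  have -> : cinner g f - conjc (cinner f g) =
    (cinner g f - s v w) - conjc (cinner f g - s w v).
    by rewrite conjcD conjcN -(si_conj si); ring.
  by rewrite (le_trans (cabsB _ _)) // cabsJ mulrDl lerD.
- have [C H] := cinner_approx f f; set z := cinner f f.
  have key e : 0 < e -> e <= 1 -> `|complex.Im z| <= C * e /\ - complex.Re z <= C * e.
    move=> e0 e1; have [w fw] := completionP f e0.
    have := H _ _ _ e0 e1 fw fw; rewrite (si_self si) -/z => h.
    have := le_trans (Im_le_cabs _) h; have := le_trans (absRe_le_cabs _) h.
    rewrite !raddfB /= subr0 => h1 ->; split => //.
    have := sqr_ge0 (N w); have := ler_norm (- (complex.Re z - N w ^+ 2)).
    by rewrite normrN; lra.
  have Im0 : complex.Im z = 0.
    apply/eqP; rewrite -normr_le0; apply: (@le0_eps _ _ C) => e e0 e1.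
    by have [] := key e e0 e1.
  have Re0 : 0 <= complex.Re z.
    rewrite -oppr_le0; apply: (@le0_eps _ _ C) => e e0 e1.
    by have [] := key e e0 e1.
  by rewrite lecE /= Im0 eqxx.
Qed.

Local Notation cn := (sn cinner).

Lemma cn_le f C : 0 <= C -> (forall x, cabs (f x) <= C * N x) -> cn f <= C.
Proof.
move=> C0 fC; rewrite -(@ler_pXn2r _ 2%N) ?nnegrE ?sn_ge0 // -subr_le0.
apply: (@le0_eps _ _ (2 * C)) => e e0 e1.
have [v fv] := completionP f e0.
have h := cinnerP C0 fC e0 fv.
have h1 : C * N v <= C * (C + e).
  by rewrite ler_wpM2l // (approx_sn_le (ltW e0) C0 fC fv).
have -> : cn f ^+ 2 = cabs (f v - (f v - cinner f f)).
  rewrite opprB addrCA subrr addr0 (si_self cinner_si) cabs_real ger0_norm //.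
  exact: sqr_ge0.
have := cabsB (f v) (f v - cinner f f); have := fC v.
by rewrite expr2; move: h1; rewrite mulrDr; lra.
Qed.

Lemma vec_in w : W w -> (s w : V -> R[i]^o) \in completion_pred.
Proof.
move=> Ww; apply/asboolP => e e0; exists w; split => // x.
by rewrite subrr cabs0 mulr_ge0 ?sn_ge0 // ltW.
Qed.

Definition vec (w : V) : completion :=
  if pselect (W w) is left Ww then MkCompletion (vec_in Ww) else 0.

Lemma vecE w x : W w -> vec w x = s w x.
Proof. by rewrite /vec; case: pselect. Qed.

Lemma vec_lin (a : R[i]) w v : W w -> W v ->
  vec (a *: w + v) = a *: vec w + vec v.
Proof.
move=> Ww Wv; apply: completion_ext => x.
by rewrite cplE !vecE //; [exact: si_lin|exact: ph_subl].
Qed.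

Lemma cinner_vec f w : W w -> cinner f (vec w) = f w.
Proof.
move=> Ww; have [M M0 fM] := completion_bounded f.
apply/esym/(@eq_eps _ _ _ M) => e e0 _; apply: (cinnerP M0 fM e0).
split => // x; rewrite vecE // subrr cabs0 mulr_ge0 ?sn_ge0 //; exact: ltW.
Qed.

Lemma cn_vec w : W w -> cn (vec w) = N w.
Proof. by move=> Ww; rewrite /sn cinner_vec // vecE. Qed.

Lemma vec_approx f w e : 0 <= e -> approx f w e -> cn (f - vec w) <= e.
Proof.
move=> e0 [Ww fw]; by apply: cn_le => // x; rewrite cplB vecE.
Qed.

Lemma fun_cn f x : cabs (f x) <= cn f * N x.
Proof.
rewrite -subr_le0; apply: (@le0_eps _ _ (2 * N x)) => e e0 _.
have [w fw] := completionP f e0.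
have h1 := vec_approx (ltW e0) fw.
have := snD cinner_si f (- (f - vec w)); rewrite (snN cinner_si) opprB.
rewrite addrCA subrr addr0 cn_vec; last exact: fw.1.
move=> h2.
have h3 := fw.2 x; have h4 := si_CS si w x.
have := cabsD (f x - s w x) (s w x); rewrite subrK => h5.
have : N w * N x <= (cn f + e) * N x by rewrite ler_wpM2r ?sn_ge0 //; lra.
by rewrite mulrDl; lra.
Qed.

Lemma cn_eq0 f : cn f = 0 -> f = 0.
Proof.
move=> f0; apply: completion_ext => x; apply/eqP.
have := fun_cn f x; rewrite f0 mul0r => h.
by rewrite -cabs_eq0 eq_le h cabs_ge0.
Qed.

Definition completion_norm f : R[i] := (cn f)%:C.

Lemma completion_normD f g :
  completion_norm (f + g) <= completion_norm f + completion_norm g.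
Proof. by rewrite /completion_norm -rmorphD lecR (snD cinner_si). Qed.

Lemma completion_normZ (a : R[i]) f :
  completion_norm (a *: f) = `|a| * completion_norm f.
Proof. by rewrite /completion_norm (snZ cinner_si) rmorphM cabsE. Qed.

Lemma completion_norm0 f : completion_norm f = 0 -> f = 0.
Proof. by move=> /complexI; apply: cn_eq0. Qed.

HB.instance Definition _ := Lmodule_isNormed.Build R[i] completion
  completion_normD completion_normZ completion_norm0.

Lemma completion_ball f g (e : R) : ball f e%:C g = (cn (f - g) < e) :> Prop.
Proof. by rewrite -ball_normE /ball_ /= -ltcR. Qed.

Lemma completion_complete (F : set_system completion) :
  ProperFilter F -> cauchy F -> cvg F.
Proof.
move=> FF /cauchyP Fc.
have pos k : 0 < k.+1%:R^-1 :> R by rewrite invr_gt0.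
(* Centres of balls that belong to [F] replace the filter by a sequence; its pointwise limit is then
   shown to be a norm limit. *)
have /choice[u uP] : forall k : nat, exists f, F (ball f (k.+1%:R^-1 : R)%:C).
  by move=> k; apply: Fc; rewrite (ltcR 0).
have udist p q : cn (u p - u q) <= p.+1%:R^-1 + q.+1%:R^-1.
  have [f [/= h1 h2]] := filter_ex (filterI (uP p) (uP q)).
  move: h1 h2; rewrite !completion_ball => h1 h2.
  apply: (le_trans (sn_dist cinner_si (u p) f (u q))).
  by rewrite (sn_sub cinner_si f) lerD // ltW.
have upt p q x : cabs (u p x - u q x) <= (p.+1%:R^-1 + q.+1%:R^-1) * N x.
  by rewrite -cplB (le_trans (fun_cn _ _)) // ler_wpM2r ?sn_ge0.
have /choice[f fP] : forall x, exists l, forall e : R, 0 < e ->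
    exists K, forall p, (K <= p)%N -> cabs (u p x - l) < e.
  move=> x; apply: complex_complete => e e0.
  have N1 : 0 < 2 * (N x + 1) by have := sn_ge0 s x; lra.
  have [K KP] := invS_lt (divr_gt0 e0 N1); exists K => p q Kp Kq.
  apply: (le_lt_trans (upt p q x)).
  have := KP p Kp; have := KP q Kq; rewrite !ltr_pdivlMr //.
  have := sn_ge0 s x; have := pos p; have := pos q.
  move: (p.+1%:R^-1) (q.+1%:R^-1) => a b; nra.
have fu p x : cabs (f x - u p x) <= p.+1%:R^-1 * N x.
  rewrite -subr_le0; apply: (@le0_eps _ _ (1 + N x)) => e e0 _.
  have [K1 K1P] := fP x e e0; have [K2 K2P] := invS_lt e0.
  have := K1P _ (leq_maxl K1 K2); have := K2P _ (leq_maxr K1 K2).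
  move: (maxn K1 K2) => k h1 h2; have := upt k p x.
  have := cabsB (u k x - u p x) (u k x - f x).
  have -> : u k x - u p x - (u k x - f x) = f x - u p x by ring.
  have : k.+1%:R^-1 * N x <= e * N x by rewrite ler_wpM2r ?sn_ge0 // ltW.
  by move: (k.+1%:R^-1) (p.+1%:R^-1) => a b; lra.
have fin : (f : V -> R[i]^o) \in completion_pred.
  apply/asboolP => e e0; have e2 : 0 < e / 2 by rewrite divr_gt0.
  have [K /(_ K (leqnn K)) Ke] := invS_lt e2.
  have [w [Ww uw]] := completionP (u K) e2; exists w; split => // x.
  have -> : f x - s w x = (f x - u K x) + (u K x - s w x) by ring.
  rewrite (le_trans (cabsD _ _)) // [e]splitr mulrDl lerD //.
  by rewrite (le_trans (fu K x)) // ler_wpM2r ?sn_ge0 // ltW.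
pose g := MkCompletion fin.
have gu p : cn (g - u p) <= p.+1%:R^-1.
  by apply: cn_le => [|x]; [exact: ltW|exact: fu].
apply/cvg_ex; exists g => B /nbhs_ballP[e /= e0 gB].
have eE := Re_real (ltW e0); move: e0; rewrite eE (ltcR 0) => e0.
have e2 : 0 < complex.Re e / 2 by rewrite divr_gt0.
have [K /(_ K (leqnn K)) Ke] := invS_lt e2.
apply: (filterS _ (uP K)) => h; rewrite completion_ball => uh.
apply: gB; rewrite eE completion_ball.
have := sn_dist cinner_si g (u K) h; have := gu K.
by move: (K.+1%:R^-1) uh Ke => a; lra.
Qed.

HB.instance Definition _ := Uniform_isComplete.Build completion
  completion_complete.

Lemma completion_inner_norm f : cinner f f = `|f| ^+ 2.
Proof. by rewrite (si_self cinner_si) rmorphXn. Qed.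

HB.instance Definition _ := isHilbert.Build R completion
  (si_lin cinner_si) (si_conj cinner_si) completion_inner_norm.

End Completion.

Lemma hilbert_completion (R : realType) (V : lmodType R[i])
    (s : V -> V -> R[i]) (W : set V) : semi_inner s -> W 0 ->
  (forall (a : R[i]) x y, W x -> W y -> W (a *: x + y)) ->
  exists (H : hilbertType R) (i : V -> H),
    [/\ forall (a : R[i]) x y, W x -> W y -> i (a *: x + y) = a *: i x + i y,
        forall x y, W x -> W y -> inner (i x) (i y) = s x y
      & forall h (e : R), 0 < e -> exists2 x, W x & hn (h - i x) < e].
Proof.
move=> si W0 Wl; pose P := PreHilbert si W0 Wl.
exists (completion P), (@vec _ P); split.
- by move=> a x y Wx Wy; exact: (@vec_lin R P a x y Wx Wy).
- by move=> x y Wx Wy; rewrite [LHS]cinner_vec // vecE.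
- move=> h e e0; have e2 : 0 < e / 2 by rewrite divr_gt0.
  have [w hw] := completionP h e2; exists w; first exact: hw.1.
  by apply: (le_lt_trans (vec_approx (ltW e2) hw)); lra.
Qed.

(** * Density arguments and extension of bounded maps *)

Section Dense.
Context {R : realType}.

Definition dense_in (H : hilbertType R) (D : set H) : Prop :=
  forall h (e : R), 0 < e -> exists2 x, D x & hn (h - x) < e.

Lemma inner_ext_dense (H : hilbertType R) (D : set H) (x y : H) : dense_in D ->
  (forall z, D z -> inner x z = inner y z) -> x = y.
Proof.
move=> Dd xy; apply/eqP; rewrite -subr_eq0; apply/eqP/hn_le0.
suff : hn (x - y) ^+ 2 <= 0.
  move=> h; have : hn (x - y) ^+ 2 = 0 by apply/eqP; rewrite eq_le h sqr_ge0.
  by move=> /eqP; rewrite sqrf_eq0 => /eqP ->.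
apply: (@le0_eps _ _ (hn (x - y))) => e e0 _.
have [z Dz xz] := Dd (x - y) e e0.
have -> : hn (x - y) ^+ 2 = cabs (inner (x - y) (x - y)).
  by rewrite (si_self inner_si) cabs_real ger0_norm // sqr_ge0.
have -> : inner (x - y) (x - y) = inner (x - y) (x - y - z).
  by rewrite [RHS](siBr inner_si) (siBl inner_si x y z) xy // subrr subr0.
rewrite (le_trans (si_CS inner_si _ _)) // ler_wpM2l ?sn_ge0 //; exact: ltW.
Qed.

Lemma inner_extr_dense (H : hilbertType R) (D : set H) (x y : H) : dense_in D ->
  (forall z, D z -> inner z x = inner z y) -> x = y.
Proof.
move=> Dd xy; apply: (inner_ext_dense Dd) => z Dz.
by rewrite innerC xy // -innerC.
Qed.

Context {H1 H2 : hilbertType R}.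

Lemma bounded_abs (T : H1 -> H2) C : bounded_by T C ->
  forall x e, hn x <= e -> hn (T x) <= `|C| * e.
Proof.
move=> TC x e xe; rewrite (le_trans (TC x)) //.
by rewrite (le_trans (y := `|C| * hn x)) ?ler_wpM2r ?ler_wpM2l ?sn_ge0 ?ler_norm.
Qed.

Lemma lop_ext_dense (D : set H1) (T S : H1 -> H2) C C' : dense_in D ->
  linear_op T -> linear_op S -> bounded_by T C -> bounded_by S C' ->
  (forall x, D x -> T x = S x) -> forall x, T x = S x.
Proof.
move=> Dd Tl Sl TC SC TS x; apply/eqP; rewrite -subr_eq0; apply/eqP/hn_le0.
apply: (@le0_eps _ _ (`|C| + `|C'|)) => e e0 _.
have [z Dz xz] := Dd x e e0.
have -> : T x - S x = T (x - z) - S (x - z).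
  by rewrite (lopB Tl) (lopB Sl) (TS z Dz) opprB addrA subrK.
rewrite (le_trans (snB inner_si _ _)) // mulrDl lerD //.
  by rewrite (bounded_abs TC) // ltW.
by rewrite (bounded_abs SC) // ltW.
Qed.

(** The bound makes [v x] depend on [i x] only, so an operator may be prescribed on representatives
    in [W], where different elements can have the same image under [i]. *)
Lemma dense_extension (V : lmodType R[i]) (W : set V) (i : V -> H1)
    (v : V -> H2) (C : R) : 0 <= C ->
  (forall (a : R[i]) x y, W x -> W y -> W (a *: x + y)) ->
  (forall (a : R[i]) x y, W x -> W y -> i (a *: x + y) = a *: i x + i y) ->
  (forall (a : R[i]) x y, W x -> W y -> v (a *: x + y) = a *: v x + v y) ->
  dense_in (i @` W) ->
  (forall x, W x -> hn (v x) <= C * hn (i x)) ->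
  exists T : H1 -> H2,
    [/\ linear_op T, bounded_by T C & forall x, W x -> T (i x) = v x].
Proof.
move=> C0 Wl il vl id vi.
have iB x y : W x -> W y -> i (x - y) = i x - i y.
  by move=> Wx Wy; rewrite addrC -scaleN1r il // scaleN1r addrC.
have vB x y : W x -> W y -> v (x - y) = v x - v y.
  by move=> Wx Wy; rewrite addrC -scaleN1r vl // scaleN1r addrC.
have WB x y : W x -> W y -> W (x - y).
  by move=> Wx Wy; rewrite addrC -scaleN1r; apply: Wl.
(* [k] is tied to all approximants of [h] at once, so that linearity and the bound can be read off
   after the choice of [T]. *)
pose spec h k := forall e : R, 0 < e -> forall x, W x -> hn (h - i x) <= e ->
  hn (k - v x) <= C * e.
have ex h : exists k, spec h k.
  have /choice[u uP] : forall n : nat, exists x, W x /\ hn (h - i x) < n.+1%:R^-1.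
    move=> n; have n0 : 0 < n.+1%:R^-1 :> R by rewrite invr_gt0.
    by have [_ [x Wx <-] hx] := id h _ n0; exists x.
  have diff x y e d : W x -> W y -> hn (h - i x) <= e -> hn (h - i y) <= d ->
      hn (v x - v y) <= C * (e + d).
    move=> Wx Wy hx hy; rewrite -vB // (le_trans (vi _ _)) //; first exact: WB.
    rewrite ler_wpM2l // iB //.
    apply: (le_trans (sn_dist inner_si (i x) h (i y))).
    by rewrite (sn_sub inner_si (i x)) lerD.
  have [k kP] : exists l, forall e : R, 0 < e -> exists N, forall p,
     (N <= p)%N -> hn (v (u p) - l) < e.
    apply: hilbert_complete => e e0.
    have C1 : 0 < 2 * (C + 1) by lra.
    have [K KP] := invS_lt (divr_gt0 e0 C1); exists K => p q Kp Kq.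
    have [Wp hp] := uP p; have [Wq hq] := uP q.
    apply: (le_lt_trans (diff _ _ _ _ Wp Wq (ltW hp) (ltW hq))).
    have := KP p Kp; have := KP q Kq; rewrite !ltr_pdivlMr //.
    have : 0 < p.+1%:R^-1 :> R by rewrite invr_gt0.
    have : 0 < q.+1%:R^-1 :> R by rewrite invr_gt0.
    move: (p.+1%:R^-1 : R) (q.+1%:R^-1 : R) => a b; nra.
  exists k => e e0 x Wx hx; rewrite -subr_le0.
  apply: (@le0_eps _ _ (1 + C)) => d d0 _.
  have [K1 K1P] := kP d d0; have [K2 K2P] := invS_lt d0.
  have := K1P _ (leq_maxl K1 K2); have := K2P _ (leq_maxr K1 K2).
  move: (maxn K1 K2) => n h2 h1; have [Wn hu] := uP n.
  have := diff _ _ _ _ Wx Wn hx (ltW hu).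
  have := sn_dist inner_si k (v (u n)) (v x).
  rewrite (sn_sub inner_si k (v (u n))) (sn_sub inner_si (v x) (v (u n))).
  have : C * n.+1%:R^-1 <= C * d by rewrite ler_wpM2l // ltW.
  by move: (n.+1%:R^-1 : R) => a; rewrite !mulrDr !mulrDl; lra.
have [T TP] := choice ex.
exists T; split=> [a x y|x|x Wx].
- apply/eqP; rewrite -subr_eq0; apply/eqP/hn_le0.
  apply: (@le0_eps _ _ (C * (cabs a + 1) + cabs a * C + C)) => e e0 _.
  have [_ [p Wp <-] xp] := id x e e0; have [_ [q Wq <-] yq] := id y e e0.
  have h1 := TP _ _ e0 _ Wp (ltW xp); have h2 := TP _ _ e0 _ Wq (ltW yq).
  have e1 : 0 < (cabs a + 1) * e by rewrite mulr_gt0 // ltr_wpDl ?cabs_ge0.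
  have h3 : hn (T (a *: x + y) - v (a *: p + q)) <= C * ((cabs a + 1) * e).
    apply: TP => //; first exact: Wl.
    rewrite il // opprD addrACA -scalerBr (le_trans (snD inner_si _ _)) //.
    by rewrite (snZ inner_si) mulrDl mul1r lerD ?ler_wpM2l ?cabs_ge0 // ltW.
  have -> : T (a *: x + y) - (a *: T x + T y) = T (a *: x + y) - v (a *: p + q)
      - a *: (T x - v p) - (T y - v q).
    rewrite vl // scalerBr !opprB !opprD addrACA !addrA.
    rewrite -!addrA; congr (_ + _); rewrite !addrA.
    by rewrite subrK addNr sub0r.
  rewrite (le_trans (snB inner_si _ _)) // mulrDl lerD //.
  rewrite (le_trans (snB inner_si _ _)) // mulrDl lerD ?mulrA //.
    by rewrite -mulrA.
  by rewrite (snZ inner_si) -mulrA ler_wpM2l ?cabs_ge0.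
- rewrite -subr_le0; apply: (@le0_eps _ _ (2 * C)) => e e0 _.
  have [_ [p Wp <-] xp] := id x e e0; have h1 := TP _ _ e0 _ Wp (ltW xp).
  have h2 := vi p Wp.
  have := snD inner_si (T x - v p) (v p); rewrite subrK => h3.
  have := snB inner_si x (x - i p); rewrite opprB addrCA subrr addr0 => h4.
  have : C * hn (i p) <= C * (hn x + e) by rewrite ler_wpM2l //; lra.
  by rewrite mulrDr; lra.
- apply/eqP; rewrite -subr_eq0; apply/eqP/hn_le0.
  apply: (@le0_eps _ _ C) => e e0 _; apply: TP => //.
  by rewrite subrr (sn0 inner_si) ltW.
Qed.

End Dense.

(** With [T'] the adjoint, [T' \o T] and the identity are bounded and agree on [D], hence
    everywhere. *)
Lemma isometric_inner (R : realType) (H1 H2 : hilbertType R) (D : set H1)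
    (T : H1 -> H2) C : dense_in D ->
  linear_op T -> bounded_by T C ->
  (forall x y, D x -> D y -> inner (T x) (T y) = inner x y) ->
  forall x y, inner (T x) (T y) = inner x y.
Proof.
move=> Dd Tl TC TT.
have [T' [T'l [C' T'C] T'P]] := adjoint_exists Tl TC.
have e : forall y, T' (T y) = y.
  apply: (@lop_ext_dense _ _ _ D (T' \o T) idfun (`|C'| * `|C|) 1 Dd).
  - by move=> a x y /=; rewrite Tl T'l.
  - by [].
  - by move=> x /=; rewrite -mulrA (bounded_abs T'C) // (bounded_abs TC).
  - by move=> x; rewrite mul1r.
  - move=> x Dx; apply: (inner_ext_dense Dd) => z Dz /=.
    by rewrite innerC -T'P TT // -innerC.
by move=> x y; rewrite T'P e.
Qed.

(** * C*-algebras and states *)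

Section CStar.
Context {R : realType} {A : cstarAlgType R}.
Implicit Types (x y z : A) (S : set A).

Lemma cnormZE (a : R[i]) x : cnorm (a *: x) = cabs a * cnorm x.
Proof. by apply: complexI; rewrite cnormZ rmorphM cabsE. Qed.

Lemma cnorm0 : cnorm (0 : A) = 0.
Proof. by rewrite -(scale0r (0 : A)) cnormZE cabs0 mul0r. Qed.

Lemma cnormN x : cnorm (- x) = cnorm x.
Proof. by rewrite -scaleN1r cnormZE cabsN cabs1 mul1r. Qed.

Lemma cnorm_ge0 x : 0 <= cnorm x.
Proof. by have := cnormD x (- x); rewrite subrr cnorm0 cnormN; lra. Qed.

Lemma cnormB x y : cnorm (x - y) <= cnorm x + cnorm y.
Proof. by rewrite -(cnormN y) cnormD. Qed.

Lemma cnorm_sub x y : cnorm (x - y) = cnorm (y - x).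
Proof. by rewrite -cnormN opprB. Qed.

Lemma cnorm_dist x y z : cnorm (x - z) <= cnorm (x - y) + cnorm (y - z).
Proof. by rewrite -[x - z](subrKA y) cnormD. Qed.

Lemma adj0 : adj (0 : A) = 0.
Proof. by apply: (addrI (adj 0)); rewrite -adjD !addr0. Qed.

Lemma adjN x : adj (- x) = - adj x.
Proof. by apply: (addrI (adj x)); rewrite -adjD !subrr adj0. Qed.

Lemma adjB x y : adj (x - y) = adj x - adj y.
Proof. by rewrite adjD adjN. Qed.

Lemma adjZE (a : R[i]) x : adj (a *: x) = conjc a *: adj x.
Proof. exact: Defs.adjZ. Qed.

Lemma adj1 : adj (1 : A) = 1.
Proof.
by rewrite -[LHS]mulr1 -{2}(adjK (1 : A)) -adjM mulr1 adjK.
Qed.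

Lemma cnorm_adj x : cnorm (adj x) = cnorm x.
Proof.
have le y : cnorm y <= cnorm (adj y).
  have [->|n0] := eqVneq (cnorm y) 0; first exact: cnorm_ge0.
  have n1 : 0 < cnorm y by rewrite lt_def n0 cnorm_ge0.
  by rewrite -(ler_pM2r n1) -expr2 -cnorm_cstar cnormM.
by apply/eqP; rewrite eq_le le -{2}(adjK x) le.
Qed.

Lemma closure_cnorm S x :
  closure S x <-> forall e : R, 0 < e -> exists2 y, S y & cnorm (x - y) < e.
Proof.
split=> [cSx e e0|xS B].
  have /cSx[y [Sy xy]] : nbhs x (ball_ cnorm x e).
    by rewrite nbhs_cnorm; exists e.
  by exists y.
rewrite nbhs_cnorm => -[e /= e0 eB]; have [y Sy xy] := xS e e0.
by exists y; split => //; apply: eB.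
Qed.

Lemma cstar_complete (u : nat -> A) :
  (forall e : R, 0 < e -> exists N, forall p q,
     (N <= p)%N -> (N <= q)%N -> cnorm (u p - u q) < e) ->
  exists l, forall e : R, 0 < e -> exists N, forall p,
     (N <= p)%N -> cnorm (u p - l) < e.
Proof.
move=> /cnorm_complete[l ul]; exists l => e e0.
have /ul[N _ uN] : nbhs l (ball_ cnorm l e) by rewrite nbhs_cnorm; exists e.
by exists N => p /uN /=; rewrite cnorm_sub.
Qed.

Lemma cnorm_le0 x : cnorm x <= 0 -> x = 0.
Proof. by move=> x0; apply: cnorm_eq0; apply/eqP; rewrite eq_le x0 cnorm_ge0. Qed.

(* [1 - x] has the square root [1 - z], where [z] is the fixed point of
   [z |-> (x + z ^ 2) / 2], a contraction of the ball of radius [|x|]. *)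
Lemma cstar_sqrt x : adj x = x -> cnorm x < 1 ->
  exists2 y, adj y = y & y * y = 1 - x.
Proof.
move=> xx x1; set r := cnorm x; have r0 : 0 <= r := cnorm_ge0 x.
pose z := fun k => iter k (fun z : A => (2^-1)%:C *: (x + z * z)) 0.
have half y : cnorm ((2^-1)%:C *: y) = cnorm y / 2.
  by rewrite cnormZE cabs_real ger0_norm ?invr_ge0 // mulrC.
have zr k : cnorm (z k) <= r.
  elim: k => [|k IH]; first by rewrite /= cnorm0.
  rewrite /= -/(z k) half.
  have := cnormD x (z k * z k); have := cnormM (z k) (z k).
  have : cnorm (z k) * cnorm (z k) <= r * r by rewrite ler_pM ?cnorm_ge0.
  have : r * r <= r * 1 by rewrite ler_wpM2l // ltW.
  by rewrite -/r; lra.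
have contr y w : cnorm y <= r -> cnorm w <= r ->
    cnorm ((2^-1)%:C *: (x + y * y) - (2^-1)%:C *: (x + w * w))
      <= r * cnorm (y - w).
  move=> yr wr; rewrite -scalerBr half opprD addrACA subrr add0r.
  have -> : y * y - w * w = y * (y - w) + (y - w) * w.
    by rewrite mulrBr mulrBl addrA subrK.
  have := cnormD (y * (y - w)) ((y - w) * w).
  have := cnormM y (y - w); have := cnormM (y - w) w.
  have : cnorm y * cnorm (y - w) <= r * cnorm (y - w).
    by rewrite ler_wpM2r ?cnorm_ge0.
  have : cnorm (y - w) * cnorm w <= r * cnorm (y - w).
    by rewrite mulrC ler_wpM2r ?cnorm_ge0.
  by lra.
have step k : cnorm (z k.+1 - z k) <= r ^+ k.
  elim: k => [|k IH].
    by rewrite subr0 expr0 (le_trans (zr 1%N)) // ltW.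
  rewrite /= -!/(z _) (le_trans (contr _ _ (zr k.+1) (zr k))) //.
  by rewrite exprS ler_wpM2l.
have r1 : 0 < 1 - r by rewrite subr_gt0.
(* A geometric sum of the bounds [step], with the denominator [1 - r] cleared. *)
have tail N j : cnorm (z (N + j)%N - z N) * (1 - r) <= r ^+ N * (1 - r ^+ j).
  elim: j => [|j IH]; first by rewrite addn0 subrr cnorm0 expr0 subrr mul0r mulr0.
  have := cnorm_dist (z (N + j.+1)%N) (z (N + j)%N) (z N).
  have := step (N + j)%N; rewrite -addnS exprD.
  have rN : 0 <= r ^+ N by rewrite exprn_ge0.
  have rj : 0 <= r ^+ j by rewrite exprn_ge0.
  rewrite exprS; move: (r ^+ N) (r ^+ j) rN rj IH => a b.
  by move: (cnorm (z (N + j)%N - z N)) (cnorm (z (N + j.+1)%N - z (N + j)%N))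
    (cnorm (z (N + j.+1)%N - z N)) => c d f; nra.
have tail' N p : (N <= p)%N -> cnorm (z p - z N) * (1 - r) <= r ^+ N.
  move=> Np; have := tail N (p - N)%N; rewrite subnKC // => /le_trans; apply.
  by rewrite ler_piMr ?exprn_ge0 // gerBl exprn_ge0.
have [l lP] : exists l, forall e : R, 0 < e -> exists N, forall p,
     (N <= p)%N -> cnorm (z p - l) < e.
  apply: cstar_complete => e e0.
  have e1 : 0 < e / 2 * (1 - r) by rewrite mulr_gt0 ?divr_gt0.
  have rn : `|r| < 1 by rewrite ger0_norm.
  have /cvgrPdist_lt /(_ _ e1) [N _ NP] := cvg_expr rn.
  have := NP N (leqnn N); rewrite /= sub0r normrN ger0_norm ?exprn_ge0 // => rN.
  exists N => p q Np Nq.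
  have hp : cnorm (z p - z N) < e / 2.
    by rewrite -(ltr_pM2r r1) (le_lt_trans (tail' _ _ Np)).
  have hq : cnorm (z q - z N) < e / 2.
    by rewrite -(ltr_pM2r r1) (le_lt_trans (tail' _ _ Nq)).
  have := cnorm_dist (z p) (z N) (z q); rewrite (cnorm_sub (z N)); lra.
have lr : cnorm l <= r.
  rewrite -subr_le0; apply: (@le0_eps _ _ 1) => e /lP[N /(_ N (leqnn N)) h] _.
  have := cnormB (z N) (z N - l); rewrite opprB addrCA subrr addr0.
  by have := zr N; lra.
have lfix : l = (2^-1)%:C *: (x + l * l).
  apply/eqP; rewrite -subr_eq0; apply/eqP/cnorm_le0.
  apply: (@le0_eps _ _ 2) => e /lP[N NP] _.
  have h1 := NP N (leqnn N); have h2 := NP N.+1 (leqnSn N).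
  have := contr _ _ (zr N) lr.
  have := cnorm_dist l (z N.+1) ((2^-1)%:C *: (x + l * l)).
  rewrite (cnorm_sub l (z N.+1)) /= -/(z N).
  have : r * cnorm (z N - l) <= 1 * cnorm (z N - l).
    by rewrite ler_wpM2r ?cnorm_ge0 // ltW.
  by move: h2; rewrite /= -/(z N); lra.
have zadj k : adj (z k) = z k.
  elim: k => [|k IH]; first by rewrite /= adj0.
  by rewrite /= -/(z k) adjZE conjc_real adjD xx adjM IH.
have ladj : adj l = l.
  apply/eqP; rewrite -subr_eq0; apply/eqP/cnorm_le0.
  apply: (@le0_eps _ _ 2) => e /lP[N /(_ N (leqnn N)) h] _.
  have -> : adj l - l = (z N - l) - adj (z N - l).
    by rewrite adjB zadj opprB [RHS]addrC addrA subrK.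
  by rewrite (le_trans (cnormB _ _)) // cnorm_adj; lra.
exists (1 - l); first by rewrite adjB adj1 ladj.
rewrite mulrBl mul1r mulrBr mulr1 opprB.
have two : l + l = x + l * l.
  rewrite {1 2}lfix -scalerDl -rmorphD /= (_ : 2^-1 + 2^-1 = 1 :> R); last by field.
  by rewrite scale1r.
have -> : x = l + l - l * l by rewrite two addrK.
by rewrite opprB -addrA; congr (_ + _); rewrite addrCA -opprD.
Qed.

(** Positivity of [C - x* x] in the form of an explicit square [y* y]. The strict inequality puts
    [x* x / C] into the domain of the square root. *)
Lemma cstar_dominated x (C : R) : cnorm x ^+ 2 < C ->
  exists y, C%:C *: 1 = adj x * x + adj y * y.
Proof.
move=> xC; have C0 : 0 < C by apply: le_lt_trans xC; exact: sqr_ge0.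
have Cn : C%:C != 0 :> R[i] by rewrite (inj_eq (@complexI _)) gt_eqF.
have := @cstar_sqrt ((C^-1)%:C *: (adj x * x)).
rewrite adjZE conjc_real adjM adjK cnormZE cabs_real ger0_norm; last first.
  by rewrite invr_ge0 ltW.
rewrite cnorm_cstar mulrC ltr_pdivrMr // mul1r => /(_ erefl xC)[y yy y2].
exists ((Num.sqrt C)%:C *: y).
rewrite adjZE conjc_real yy -scalerAl -scalerAr scalerA -rmorphM -expr2.
rewrite sqr_sqrtr ?ltW // y2 scalerBr scalerA fmorphV mulfV // scale1r.
by rewrite addrC subrK.
Qed.

End CStar.

Section SesquilinearForm.
Context {R : realType} {V : lmodType R[i]} (s : V -> V -> R[i]).

(* Polarization: positivity on [x + y] and [x + i y] forces the hermitian
   symmetry. *)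
Lemma sesquilinear_si :
  (forall (a : R[i]) x y z, s (a *: x + y) z = a * s x z + s y z) ->
  (forall (a : R[i]) x y z, s z (a *: x + y) = conjc a * s z x + s z y) ->
  (forall x, 0 <= s x x) -> semi_inner s.
Proof.
move=> sl sr s0; split => // x y.
have key (a : R[i]) : complex.Im (conjc a * s x y + a * s y x) = 0.
  have := ger0_Im (s0 (a *: y + x)); rewrite sl !sr !raddfD /=.
  have := ger0_Im (s0 x); have := ger0_Im (s0 y).
  case: a (s x y) (s y x) (s x x) (s y y) => [a b] [c d] [e f] [g h] [k l] /=.
  by move=> -> ->; lra.
have := key 1; have := key 'i; rewrite !conjc1 !mul1r.
case: (s x y) (s y x) => [a b] [c d] /= h1 h2.
by apply/eqP; rewrite eq_complex /=; apply/andP; split; apply/eqP; lra.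
Qed.

End SesquilinearForm.

(** * States, and functionals dominated by a pure state *)

Section States.
Context {R : realType} {A : cstarAlgType R}.
Implicit Types (x y P Q : A).

Definition sform (psi : A -> R[i]) x y : R[i] := psi (adj y * x).

Section State.
Variable psi : {scalar A}.

Lemma sform_lin (a : R[i]) x y z :
  sform psi (a *: x + y) z = a * sform psi x z + sform psi y z.
Proof. by rewrite /sform mulrDr -scalerAr linearP. Qed.

Lemma sform_linr (a : R[i]) x y z :
  sform psi z (a *: x + y) = conjc a * sform psi z x + sform psi z y.
Proof. by rewrite /sform adjD adjZE mulrDl -scalerAl linearP. Qed.

Lemma positive_si : (forall Q, 0 <= psi (adj Q * Q)) -> semi_inner (sform psi).
Proof.
by move=> p0; apply: sesquilinear_si; [exact: sform_lin|exact: sform_linr|].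
Qed.

Hypothesis psis : state psi.
Local Notation N := (sn (sform psi)).

Lemma sform_si : semi_inner (sform psi).
Proof. by apply: positive_si; have [] := psis. Qed.

Lemma sform_mulC x y Q : sform psi (Q * x) y = sform psi x (adj Q * y).
Proof. by rewrite /sform adjM adjK mulrA. Qed.

Lemma state_sn x : psi (adj x * x) = (N x ^+ 2)%:C.
Proof. by rewrite -(si_self sform_si). Qed.

(** [C |x|^2 = |Q x|^2 + |P x|^2] in the seminorm of [psi]. An algebraic hypothesis survives
    automorphisms and conjugation by unitaries, which gives bounds uniform in the translation. *)
Lemma sn_dominated Q P x (C : R) : 0 <= C -> C%:C *: 1 = adj Q * Q + adj P * P ->
  N (Q * x) <= Num.sqrt C * N x.
Proof.
move=> C0 E; rewrite -(@ler_pXn2r _ 2%N) ?nnegrE ?mulr_ge0 ?sqrtr_ge0 ?sn_ge0 //.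
rewrite exprMn (sqr_sqrtr C0).
have : C * N x ^+ 2 = N (Q * x) ^+ 2 + N (P * x) ^+ 2.
  apply: complexI; rewrite rmorphD rmorphM /= -!state_sn.
  have sq T : adj (T * x) * (T * x) = adj x * (adj T * T) * x.
    by rewrite adjM !mulrA.
  rewrite !sq -linearD -mulrDl -mulrDr -E -scalerAr mulr1 -scalerAl.
  by rewrite linearZ.
by move=> ->; rewrite lerDl sqr_ge0.
Qed.

Lemma sn_mul Q x : N (Q * x) <= cnorm Q * N x.
Proof.
rewrite -subr_le0; apply: (@le0_eps _ _ (N x)) => e e0 _.
have qe : 0 < cnorm Q + e by rewrite ltr_wpDl ?cnorm_ge0.
(* The constant must exceed [cnorm Q ^+ 2] strictly, hence the margin [e]. *)
have [|P QP] := @cstar_dominated _ _ Q ((cnorm Q + e) ^+ 2).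
  by rewrite ltr_pXn2r ?nnegrE ?cnorm_ge0 ?ltW // ltrDl.
have := sn_dominated x (sqr_ge0 _) QP; rewrite sqrtr_sqr gtr0_norm //.
by rewrite mulrDl; lra.
Qed.

Lemma sn1 : N 1 = 1.
Proof.
have : N 1 ^+ 2 = 1.
  by apply: complexI; rewrite -state_sn adj1 mulr1 (proj1 psis) rmorph1.
by move=> /eqP; rewrite sqrf_eq1 => /orP[/eqP //|/eqP e]; have := sn_ge0 (sform psi) 1; rewrite e; lra.
Qed.

Lemma sn_le_cnorm x : N x <= cnorm x.
Proof. by have := sn_mul x 1; rewrite mulr1 sn1 mulr1. Qed.

Lemma state_bounded x : cabs (psi x) <= cnorm x.
Proof.
have := si_CS sform_si x 1; rewrite /sform adj1 mul1r => /le_trans; apply.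
by rewrite sn1 mulr1 sn_le_cnorm.
Qed.

End State.

Definition mk_scalar (f : A -> R[i])
  (fl : forall (a : R[i]) x y, f (a *: x + y) = a * f x + f y) : {scalar A} :=
  HB.pack f (GRing.isLinear.Build R[i] A R[i] *%R f fl).

Lemma mk_scalarE f fl x : @mk_scalar f fl x = f x.
Proof. by []. Qed.

Lemma scomb_lin (f g : {scalar A}) (u v a : R[i]) x y :
  u * f (a *: x + y) + v * g (a *: x + y) =
  a * (u * f x + v * g x) + (u * f y + v * g y).
Proof.
rewrite !linearP; move: (f x) (f y) (g x) (g y) => p q r t /=; ring.
Qed.

Definition scomb (f g : {scalar A}) (u v : R[i]) : {scalar A} :=
  mk_scalar (scomb_lin f g u v).

Lemma scombE f g u v x : scomb f g u v x = u * f x + v * g x.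
Proof. by []. Qed.

Section Pure.
Variable psi : {scalar A}.
Hypothesis psip : pure psi.
Let psis : state psi := proj1 psip.

(** With [c = chi 1], [psi] is the convex combination of [chi / c] and
    [((K + 1) psi - chi) / (K + 1 - c)] with weight [c / (K + 1)]. Taking [K + 1] in place of [K]
    keeps the second weight positive. *)
Lemma pure_positive (chi : {scalar A}) (K : R) :
  (forall P, 0 <= chi (adj P * P)) ->
  (forall P, chi (adj P * P) <= K%:C * psi (adj P * P)) ->
  forall Q, chi Q = chi 1 * psi Q.
Proof.
move=> chi0 chiK Q.
have c1 : 0 <= chi 1 by have := chi0 1; rewrite adj1 mulr1.
have cE := Re_real c1; set c := complex.Re (chi 1) in cE.
have c0 : 0 <= c by move: c1; rewrite cE (lecR 0).
have cK : c <= K.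
  have := chiK 1; rewrite adj1 mulr1 (proj1 psis) mulr1.
  by rewrite cE lecR.
(* If [chi 1 = 0], then [chi] vanishes by the Cauchy-Schwarz inequality. *)
have [cz|cn] := eqVneq c 0.
  have chisi := positive_si chi0.
  have := si_CS chisi Q 1; have := si_self chisi 1.
  rewrite /sform !adj1 !mul1r cE cz => /complexI /eqP.
  rewrite eq_sym sqrf_eq0 => /eqP ->; rewrite mulr0 rmorph0 mul0r => h.
  by apply/eqP; rewrite -cabs_eq0 eq_le h cabs_ge0.
have cp : 0 < c by rewrite lt_def cn.
pose d := K + 1 - c; have d0 : 0 < d by rewrite /d; lra.
have cC : c%:C != 0 :> R[i] by rewrite (inj_eq (@complexI _)).
have dC : d%:C != 0 :> R[i] by rewrite (inj_eq (@complexI _)) gt_eqF.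
pose phi1 := scomb chi psi c%:C^-1 0.
pose phi2 := scomb psi chi (d%:C^-1 * (K + 1)%:C) (- d%:C^-1).
have s1 : state phi1.
  split=> [|P]; rewrite scombE mul0r addr0; first by rewrite cE mulVf.
  by rewrite mulr_ge0 // invr_ge0 (lecR 0).
have s2 : state phi2.
  split=> [|P]; rewrite scombE mulNr -mulrA -mulrBr.
    by rewrite (proj1 psis) mulr1 cE -rmorphB mulVf.
  apply: mulr_ge0; first by rewrite invr_ge0 (lecR 0) ltW.
  rewrite subr_ge0.
  apply: (le_trans (chiK P)); apply: ler_wpM2r; first by have [_] := psis.
  by rewrite lecR; lra.
have t01 : 0 < c / (K + 1) < 1.
  by rewrite divr_gt0 /= ?ltr_pdivrMr ?mul1r; lra.
have [] := (proj2 psip) phi1 phi2 _ s1 s2 t01; last first.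
  by move=> /(_ Q) + _; rewrite scombE mul0r addr0 cE => <-; rewrite mulrA mulfV ?mul1r.
have K1 : K + 1 != 0 by rewrite gt_eqF //; lra.
have K1C : (K + 1)%:C != 0 :> R[i] by rewrite (inj_eq (@complexI _)).
move=> x; rewrite !scombE.
have -> : (1 - c / (K + 1))%:C = d%:C / (K + 1)%:C :> R[i].
  by rewrite -fmorphV -rmorphM; congr (_%:C); rewrite /d; field.
rewrite rmorphM fmorphV /=.
move: (chi x) (psi x) (c%:C) (d%:C) ((K + 1)%:C) cC dC K1C => u v a b q a0 b0 q0.
by field; rewrite a0 b0 q0.
Qed.

(** A Schur lemma for functionals: density extends the domination from [D] to [A], and the hermitian
    and antihermitian parts of [phi] are reduced to the positive case. *)
Lemma pure_dominated (phi : A -> R[i]) (C M : R) (D : set A) :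
  (forall (a : R[i]) x y, phi (a *: x + y) = a * phi x + phi y) ->
  (forall x, cabs (phi x) <= M * cnorm x) ->
  (forall x (e : R), 0 < e -> exists2 y, D y & cnorm (x - y) < e) ->
  (forall P, D P -> cabs (phi (adj P * P)) <= C * cabs (psi (adj P * P))) ->
  0 <= C -> 0 <= M ->
  forall Q, phi Q = phi 1 * psi Q.
Proof.
move=> phil phiM Dd phiD C0 M0.
pose f := mk_scalar phil.
have fC P : cabs (f (adj P * P)) <= C * cabs (psi (adj P * P)).
  rewrite -subr_le0; pose k := cnorm P + (cnorm P + 1).
  apply: (@le0_eps _ _ (M * k + C * k)) => e e0 e1.
  have [P' DP' PP'] := Dd P e e0.
  have dist : cnorm (adj P * P - adj P' * P') <= k * e.
    have -> : adj P * P - adj P' * P' = adj P * (P - P') + adj (P - P') * P'.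
      by rewrite adjB mulrBr mulrBl addrA subrK.
    rewrite (le_trans (cnormD _ _)) // mulrDl lerD //.
      rewrite (le_trans (cnormM _ _)) // cnorm_adj ler_wpM2l ?cnorm_ge0 //.
      exact: ltW.
    rewrite (le_trans (cnormM _ _)) // cnorm_adj mulrC ler_pM ?cnorm_ge0 //.
      have := cnormB P (P - P'); rewrite opprB addrCA subrr addr0; lra.
    exact: ltW.
  have h1 := phiD P' DP'.
  have h2 := phiM (adj P * P - adj P' * P').
  have h3 := state_bounded psis (adj P' * P' - adj P * P).
  have h4 := cabsD (f (adj P * P - adj P' * P')) (f (adj P' * P')).
  have h5 := cabsD (psi (adj P' * P' - adj P * P)) (psi (adj P * P)).
  rewrite -raddfD subrK in h4; rewrite -raddfD subrK cnorm_sub in h5 h3.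
  have h6 : M * cnorm (adj P * P - adj P' * P') <= M * (k * e) by rewrite ler_wpM2l.
  have h7 : C * cabs (psi (adj P' * P')) <= C * (k * e + cabs (psi (adj P * P))).
    by rewrite ler_wpM2l //; lra.
  rewrite mulrDr in h7; rewrite mk_scalarE in h4 *; rewrite !mulrDl -!mulrA; lra.
(* For hermitian [g] the functional [K psi + g] is positive and at most [2 K psi], hence a multiple
   of [psi]. *)
have herm (g : {scalar A}) K : 0 <= K -> (forall x, g (adj x) = conjc (g x)) ->
    (forall P, cabs (g (adj P * P)) <= K * cabs (psi (adj P * P))) ->
    forall Q, g Q = g 1 * psi Q.
  move=> K0 gh gK Q.
  have real P : g (adj P * P) = (complex.Re (g (adj P * P)))%:C.
    have := gh (adj P * P); rewrite adjM adjK; case: (g _) => a b [/eqP].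
    by rewrite -subr_eq0 opprK -mulr2n mulrn_eq0 /= => /eqP ->.
  pose chi := scomb psi g K%:C 1.
  have bnd P : `|complex.Re (g (adj P * P))| <= K * complex.Re (psi (adj P * P)).
    rewrite (le_trans (absRe_le_cabs _)) // (le_trans (gK P)) //.
    by rewrite cabs_ge0_Re //; have [_] := psis.
  have pr P : psi (adj P * P) = (complex.Re (psi (adj P * P)))%:C.
    by apply: Re_real; have [_] := psis.
  have := @pure_positive chi (2 * K).
  have c0 P : 0 <= chi (adj P * P).
    rewrite scombE mul1r real pr -rmorphM -rmorphD (lecR 0).
    by have := bnd P; rewrite ler_norml; lra.
  move=> /(_ c0) H; have {}H := H _ Q; rewrite !scombE !mul1r (proj1 psis) in H.
  have : K%:C * psi Q + g Q = (K%:C * 1 + g 1) * psi Q.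
    apply: H => P; rewrite scombE mul1r real pr -!rmorphM -rmorphD lecR.
    by have := bnd P; rewrite ler_norml; lra.
  by rewrite mulr1 mulrDl => /addrI.
(* [fs] is the adjoint functional of [f]; both [f + fs] and [i (f - fs)] are hermitian. *)
pose fs x := conjc (f (adj x)).
have fsl (a : R[i]) x y : fs (a *: x + y) = a * fs x + fs y.
  by rewrite /fs adjD adjZE linearP conjcD conjcM conjcK.
have fsC P : cabs (fs (adj P * P)) <= C * cabs (psi (adj P * P)).
  by rewrite /fs adjM adjK cabsJ.
pose g1 := scomb f (mk_scalar fsl) 1 1.
pose g2 := scomb f (mk_scalar fsl) 'i (- 'i).
have C2 : 0 <= C + C by rewrite addr_ge0.
have e1 := herm g1 _ C2 _ _; have e2 := herm g2 _ C2 _ _.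
have ci : cabs ('i : R[i]) = 1 by rewrite /cabs normc_def /= expr0n add0r expr1n sqrtr1.
move=> Q; have {}e1 : g1 Q = g1 1 * psi Q.
  apply: e1 => [x|P]; rewrite !scombE !mul1r !(mk_scalarE fsl) /fs.
    by rewrite adjK conjcD conjcK addrC.
  by rewrite (le_trans (cabsD _ _)) // mulrDl lerD // -/(fs _).
have {}e2 : g2 Q = g2 1 * psi Q.
  apply: e2 => [x|P]; rewrite !scombE !mulNr -!mulrBr !(mk_scalarE fsl) /fs.
    rewrite adjK conjcM conjcD conjcN conjcK.
    have -> : conjc 'i%C = - 'i%C :> R[i] by apply/eqP; rewrite eq_complex /= oppr0 !eqxx.
    move: (conjc (f x)) (f (adj x)) => p q; ring.
  by rewrite cabsM ci mul1r (le_trans (cabsB _ _)) // mulrDl lerD // -/(fs _).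
rewrite !scombE !mul1r !(mk_scalarE fsl) in e1.
rewrite !scombE !mulNr -!mulrBr !(mk_scalarE fsl) in e2.
have i0 : 'i != 0 :> R[i] by rewrite -cabs_eq0 ci oner_eq0.
have {}e2 : f Q - fs Q = (f 1 - fs 1) * psi Q.
  by apply: (mulfI i0); rewrite e2 mulrA.
have : f Q = f 1 * psi Q.
  have two : 2 != 0 :> R[i] by rewrite pnatr_eq0.
  apply: (mulfI two).
  have -> : 2 * f Q = (f Q + fs Q) + (f Q - fs Q) by ring.
  by rewrite e1 e2; ring.
by [].
Qed.

End Pure.

End States.

(** * The GNS representation *)

Section GNS.
Context {R : realType} {A : cstarAlgType R}.
Variable psi : {scalar A}.
Hypothesis psis : state psi.
Variable B : set A.
Hypotheses (Bsub : is_subalgebra B) (Badj : forall x, B x -> B (adj x)).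
Local Notation N := (sn (sform psi)).

Let B1 : B 1. Proof. by have [] := Bsub. Qed.
Let Bl (a : R[i]) x y : B x -> B y -> B (a *: x + y).
Proof. by have [_ + _] := Bsub; apply. Qed.
Let BM x y : B x -> B y -> B (x * y).
Proof. by have [_ _] := Bsub; apply. Qed.
Let B0 : B 0.
Proof. by have := Bl (- 1) B1 B1; rewrite scaleN1r addNr. Qed.
Let BB x y : B x -> B y -> B (x - y).
Proof. by move=> Bx By; have := Bl (- 1) By Bx; rewrite scaleN1r addrC. Qed.

Lemma gns_exists : exists (H : hilbertType R) (pi : A -> H -> H) (Omega : H),
  is_gns B psi pi Omega.
Proof.
have [H [i [il iform idense]]] := hilbert_completion (sform_si psis) B0 Bl.
have iN x : B x -> hn (i x) = N x by move=> Bx; rewrite /sn iform.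
have Dd : dense_in (i @` B).
  by move=> h e /(idense h e)[x Bx hx]; exists (i x) => //; exists x.
have /choice[pi piP] : forall Q, exists T : H -> H, B Q ->
    [/\ linear_op T, bounded_by T (cnorm Q) & forall x, B x -> T (i x) = i (Q * x)].
  (* Off [B] any value will do, since [is_gns] constrains [pi] on [B] only. *)
  move=> Q; have [BQ|nBQ] := pselect (B Q); last by exists id.
  have [||T TP] := @dense_extension _ _ _ _ B i (i \o *%R Q) (cnorm Q)
    (cnorm_ge0 Q) Bl il _ Dd.
  - by move=> a x y Bx By /=; rewrite mulrDr -scalerAr il //; exact: BM.
  - by move=> x Bx /=; rewrite !iN // ?sn_mul //; exact: BM.
  - by exists T.
exists H, pi, (i 1); split.
- by move=> Q /piP[].
- by move=> Q /piP[Tl Tb _]; exact: bounded_continuous Tl _ Tb.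
- have [Tl Tb TE] := piP 1 B1.
  apply: (@lop_ext_dense _ _ _ _ _ idfun (cnorm (1 : A)) 1 Dd) => //.
    by move=> x; rewrite mul1r.
  by move=> _ [x Bx <-]; rewrite TE // mul1r.
- move=> a P Q BP BQ.
  have [Pl Pb PE] := piP _ BP; have [Ql Qb QE] := piP _ BQ.
  have [Tl Tb TE] := piP _ (Bl a BP BQ).
  apply: (@lop_ext_dense _ _ _ _ _ (fun x => a *: pi P x + pi Q x)
    (cnorm (a *: P + Q)) (cabs a * cnorm P + cnorm Q) Dd) => //.
  + by move=> b x y; rewrite Pl Ql !scalerDr !scalerA [a * b]mulrC addrACA.
  + move=> x; rewrite mulrDl (le_trans (snD inner_si _ _)) // lerD //.
    by rewrite (snZ inner_si) -mulrA ler_wpM2l ?cabs_ge0.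
  + move=> _ [x Bx <-]; rewrite TE // PE // QE // mulrDl -scalerAl il //; exact: BM.
- move=> P Q BP BQ.
  have [Pl Pb PE] := piP _ BP; have [Ql Qb QE] := piP _ BQ.
  have [Tl Tb TE] := piP _ (BM BP BQ).
  apply: (@lop_ext_dense _ _ _ _ _ (pi P \o pi Q)
    (cnorm (P * Q)) (cnorm P * cnorm Q) Dd) => //.
  + by move=> b x y /=; rewrite Ql Pl.
  + move=> x /=; rewrite (le_trans (Pb _)) // -mulrA ler_wpM2l ?cnorm_ge0 //.
  + by move=> _ [x Bx <-] /=; rewrite TE // QE // PE ?mulrA //; exact: BM.
- move=> Q BQ x y.
  have [Ql Qb QE] := piP _ BQ; have [Sl Sb SE] := piP _ (Badj BQ).
  have [T' [T'l [C T'C] T'E]] := adjoint_exists Ql Qb.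
  rewrite innerC; have -> : pi (adj Q) x = T' x; last by rewrite -T'E -innerC.
  move: x; apply: (@lop_ext_dense _ _ _ _ _ T' _ _ Dd Sl T'l Sb T'C).
  move=> _ [x Bx <-]; apply: (inner_extr_dense Dd) => _ [z Bz <-].
  rewrite -T'E SE // QE // !iform //; [|exact: BM|by apply: BM => //; exact: Badj].
  by rewrite (sform_mulC psi).
- move=> Q BQ; have [_ _ QE] := piP _ BQ.
  by rewrite QE // mulr1 iform // /sform adj1 mul1r.
- rewrite predeqE => h; split => // _; apply/closure_hn => e /(idense h e)[x Bx hx].
  exists (i x) => //; exists x => //.
  by have [_ _ ->] := piP _ Bx; rewrite ?mulr1.
Qed.

Variables (H : hilbertType R) (pi : A -> H -> H) (Om : H).
Hypothesis G : is_gns B psi pi Om.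

Lemma gns_inner P Q : B P -> B Q -> inner (pi P Om) (pi Q Om) = sform psi P Q.
Proof.
move=> BP BQ; rewrite /sform (gns_state G) ?(gns_mul G) //; try exact: BM.
- by rewrite (gns_adj G).
- exact: Badj.
- by apply: BM => //; exact: Badj.
Qed.

Lemma gns_adjl P x y : B P -> inner (pi P x) y = inner x (pi (adj P) y).
Proof. by move=> BP; rewrite -(gns_adj G) ?adjK //; exact: Badj. Qed.

Lemma gns_hn P : B P -> hn (pi P Om) = N P.
Proof. by move=> BP; rewrite /sn gns_inner. Qed.

Lemma gns_sub P Q x : B P -> B Q -> pi (P - Q) x = pi P x - pi Q x.
Proof.
by move=> BP BQ; rewrite addrC -scaleN1r (gns_lin G) // scaleN1r addrC.
Qed.

Lemma gns_dense (D : set A) : D `<=` B ->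
  (forall x (e : R), B x -> 0 < e -> exists2 y, D y & cnorm (x - y) < e) ->
  dense_in [set pi Q Om | Q in D].
Proof.
move=> DB Dd h e e0; have e2 : 0 < e / 2 by rewrite divr_gt0.
have /closure_hn/(_ _ e2)[_ [Q BQ <-] hQ] : closure [set pi Q Om | Q in B] h.
  by rewrite (gns_cyclic G).
have [P DP QP] := Dd Q _ BQ e2; exists (pi P Om); first by exists P.
have := sn_dist inner_si h (pi Q Om) (pi P Om).
rewrite -(gns_sub _ BQ (DB _ DP)) gns_hn; last exact: BB BQ (DB _ DP).
have := sn_le_cnorm psis (Q - P); lra.
Qed.

(** [is_gns] records continuity only. That gives some constant, and the constant [cnorm Q] is then
    obtained on the vectors [pi P Om], where it is [sn_mul]. *)
Lemma gns_bounded_by Q : B Q -> bounded_by (pi Q) (cnorm Q).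
Proof.
move=> BQ x; rewrite -subr_le0.
have [C C0 QC] := continuous_bounded (gns_linear G BQ) (gns_bounded G BQ).
have Dd : dense_in [set pi Q Om | Q in B].
  by apply: gns_dense => // y e By e0; exists y => //; rewrite subrr cnorm0.
apply: (@le0_eps _ _ (C + cnorm Q)) => e e0 _.
have [_ [P BP <-] xP] := Dd x e e0.
have h1 := snD inner_si (pi Q (x - pi P Om)) (pi Q (pi P Om)).
rewrite -(lopD (gns_linear G BQ)) subrK in h1.
have h2 := QC (x - pi P Om).
have h3 : hn (pi Q (pi P Om)) <= cnorm Q * hn (pi P Om).
  by rewrite -(gns_mul G) // !gns_hn ?sn_mul //; exact: BM.
have h4 := snB inner_si x (x - pi P Om); rewrite opprB addrCA subrr addr0 in h4.
have h5 : cnorm Q * hn (pi P Om) <= cnorm Q * (hn x + e).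
  by rewrite ler_wpM2l ?cnorm_ge0 //; lra.
have h6 : C * hn (x - pi P Om) <= C * e by rewrite ler_pM2l // ltW.
by rewrite mulrDr in h5; lra.
Qed.

Lemma gns_bounded_operator Q : B Q -> bounded_operator (pi Q).
Proof. by move=> BQ; split; [exact: (gns_linear G)|exact: (gns_bounded G)]. Qed.

Lemma gns_approx Q P x e : B Q -> B P -> cnorm (Q - P) <= e ->
  hn (pi Q x - pi P x) <= e * hn x.
Proof.
move=> BQ BP QP; rewrite -gns_sub // (le_trans (gns_bounded_by _ _)) //.
  exact: BB.
by rewrite ler_wpM2r ?sn_ge0.
Qed.

End GNS.

(** * Limits along ultrafilters *)

Section UltraLimit.
Context {R : realType}.
Implicit Types (u v : nat -> R[i]).

Definition cbounded u := exists M : R, forall k, cabs (u k) <= M.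

Definition ulim_spec (G : set_system nat) u (l : R[i]) : Prop :=
  forall e : R, 0 < e -> G [set k | cabs (u k - l) < e].

Lemma bounded_ultra_cvg (G : set_system nat) (v : nat -> R) (M : R) :
  UltraFilter G -> (forall k, `|v k| <= M) ->
  exists l, forall e : R, 0 < e -> G [set k | `|v k - l| < e].
Proof.
move=> GU vM; have GP : ProperFilter G := @ultra_proper _ _ GU.
have [|l [_ vl]] := @segment_compact R (- M) M (v @ G) _.
  apply: (@filterS _ G _ setT); last exact: filterT.
  by move=> k _ /=; rewrite in_itv /= -ler_norml.
exists l => e e0.
have [//|Gn] := in_ultra_setVsetC [set k | `|v k - l| < e] GU.
have Gv : (v @ G) [set x | ~ (`|x - l| < e)] by [].
have [x [/= xl]] := vl _ _ Gv (nbhsx_ballx l _ e0).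
by rewrite -ball_normE /= distrC => /xl.
Qed.

(** One filter serves all bounded sequences, so limits along it are linear and respect products with
    fixed elements. [F] is arbitrary so that the limit can be confined to a prescribed infinite set
    of indices. *)
Lemma ultra_limits (F : set_system nat) : ProperFilter F ->
  exists G : set_system nat, [/\ ProperFilter G, F `<=` G &
    forall u, cbounded u -> exists l, ulim_spec G u l].
Proof.
move=> PF; have [G [GU FG]] := ultraFilterLemma PF.
have GP : ProperFilter G := @ultra_proper _ _ GU.
exists G; split => //.
move=> u [M uM].
have [|a ua] := @bounded_ultra_cvg G (fun k => complex.Re (u k)) M GU.
  by move=> k; apply: le_trans (uM k); exact: absRe_le_cabs.
have [|b ub] := @bounded_ultra_cvg G (fun k => complex.Im (u k)) M GU.
  by move=> k; apply: le_trans (uM k); exact: Im_le_cabs.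
exists (a +i* b) => e e0; have e2 : 0 < e / 2 by rewrite divr_gt0.
apply: (filterS _ (filterI (ua _ e2) (ub _ e2))) => k [/= h1 h2]; apply: (le_lt_trans (cabs_Re_Im _)).
by case: (u k) h1 h2 => x y /= h1 h2; lra.
Qed.

End UltraLimit.

Section ULim.
Context {R : realType} (G : set_system nat) {GP : ProperFilter G}.
Hypothesis Gcpt : forall u : nat -> R[i], cbounded u ->
  exists l, ulim_spec G u l.
Implicit Types (u v : nat -> R[i]).

Definition ulim u : R[i] := xget 0 [set l | ulim_spec G u l].

Lemma ulimP u : cbounded u -> ulim_spec G u (ulim u).
Proof. by move=> /Gcpt[l ul]; exact: (@xgetPex _ 0 _ (ex_intro _ l ul)). Qed.

Lemma ulim_unique u l : cbounded u -> ulim_spec G u l -> ulim u = l.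
Proof.
move=> ub ul; apply: (@eq_eps _ _ _ 2) => e e0 _.
have [k [/= h1 h2]] := filter_ex (filterI (ulimP ub e0) (ul e e0)).
have := cabsB (u k - l) (u k - ulim u); rewrite opprB addrC subrKA.
by rewrite addrC; lra.
Qed.

Lemma ulim_lin (a : R[i]) u v : cbounded u -> cbounded v ->
  ulim (fun k => a * u k + v k) = a * ulim u + ulim v.
Proof.
move=> ub vb; apply: ulim_unique.
  have [M uM] := ub; have [M' vM'] := vb; exists (cabs a * M + M') => k.
  rewrite (le_trans (cabsD _ _)) // lerD // cabsM ler_wpM2l ?cabs_ge0 //.
move=> e e0; have a1 : 0 < cabs a + 1 by have := cabs_ge0 a; lra.
have e1 : 0 < e / (cabs a + 1) by rewrite divr_gt0.
apply: (filterS _ (filterI (ulimP ub e1) (ulimP vb e1))) => k [/= h1 h2].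
have -> : a * u k + v k - (a * ulim u + ulim v) =
  a * (u k - ulim u) + (v k - ulim v) by ring.
apply: (le_lt_trans (cabsD _ _)); rewrite cabsM.
have : (cabs a + 1) * (e / (cabs a + 1)) = e by field; rewrite gt_eqF.
have : cabs a * cabs (u k - ulim u) <= cabs a * (e / (cabs a + 1)).
  by rewrite ler_wpM2l ?cabs_ge0 // ltW.
by rewrite mulrDl mul1r; lra.
Qed.

Lemma ulim_le u M : cbounded u -> G [set k | cabs (u k) <= M] ->
  cabs (ulim u) <= M.
Proof.
move=> ub uM; rewrite -subr_le0; apply: (@le0_eps _ _ 1) => e e0 _.
have [k [/= h1 h2]] := filter_ex (filterI (ulimP ub e0) uM).
have := cabsB (u k) (u k - ulim u); rewrite opprB addrCA subrr addr0; lra.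
Qed.

Lemma ulim_eq u v : cbounded u -> cbounded v -> G [set k | u k = v k] ->
  ulim u = ulim v.
Proof.
move=> ub vb uv; apply: ulim_unique => // e e0.
by apply: (filterS _ (filterI (ulimP vb e0) uv)) => k [/= + ->].
Qed.

Lemma ulim_cst u c : cbounded u -> G [set k | u k = c] -> ulim u = c.
Proof.
move=> ub uc; apply: ulim_unique => // e e0.
by apply: (filterS _ uc) => k /= ->; rewrite subrr cabs0.
Qed.

End ULim.

(** * Local algebras of the chain *)

Section Generation.
Context {R : realType} {A : cstarAlgType R}.
Implicit Types (x y : A) (S B : set A).

Lemma sgen_incl S : S `<=` subalgebra_gen S.
Proof. by move=> x Sx B _ SB; apply: SB. Qed.

Lemma sgen_sub S : is_subalgebra (subalgebra_gen S).
Proof.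
split=> [B [] //|a x y Sx Sy B Bs SB|x y Sx Sy B Bs SB].
  by have [_ + _] := Bs; apply; [exact: Sx|exact: Sy].
by have [_ _] := Bs; apply; [exact: Sx|exact: Sy].
Qed.

Lemma sgen_ind S B : is_subalgebra B -> S `<=` B -> subalgebra_gen S `<=` B.
Proof. by move=> Bs SB x; apply. Qed.

Lemma subalg1 B : is_subalgebra B -> B 1. Proof. by case. Qed.

Lemma subalgM B x y : is_subalgebra B -> B x -> B y -> B (x * y).
Proof. by move=> [_ _]; apply. Qed.

Lemma subalg_lin B (a : R[i]) x y : is_subalgebra B -> B x -> B y -> B (a *: x + y).
Proof. by move=> [_ + _]; apply. Qed.

Lemma subalg0 B : is_subalgebra B -> B 0.
Proof.
move=> Bs; have := subalg_lin (- 1) Bs (subalg1 Bs) (subalg1 Bs).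
by rewrite scaleN1r addNr.
Qed.

Lemma subalgZ B (a : R[i]) x : is_subalgebra B -> B x -> B (a *: x).
Proof. by move=> Bs Bx; rewrite -[_ *: _]addr0; apply: subalg_lin => //; apply: subalg0. Qed.

Lemma subalgD B x y : is_subalgebra B -> B x -> B y -> B (x + y).
Proof. by move=> Bs Bx By; rewrite -[x]scale1r; apply: subalg_lin. Qed.

Lemma subalgN B x : is_subalgebra B -> B x -> B (- x).
Proof. by move=> Bs Bx; rewrite -scaleN1r; apply: subalgZ. Qed.

Lemma subalgB B x y : is_subalgebra B -> B x -> B y -> B (x - y).
Proof. by move=> Bs Bx By; apply: subalgD => //; apply: subalgN. Qed.

Lemma closure_cstar B : is_subalgebra B -> (forall x, B x -> B (adj x)) ->
  is_cstar_subalgebra (closure B).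
Proof.
move=> Bs Badj; split; last exact: closed_closure.
  split=> [|a x y /closure_cnorm Bx /closure_cnorm By
          |x y /closure_cnorm Bx /closure_cnorm By].
  - by apply: subset_closure; exact: subalg1.
  - apply/closure_cnorm => e e0.
    have a1 : 0 < cabs a + 1 by have := cabs_ge0 a; lra.
    have [|x' Bx' xx'] := Bx (e / 2 / (cabs a + 1)); first by rewrite !divr_gt0.
    have [|y' By' yy'] := By (e / 2); first by rewrite divr_gt0.
    exists (a *: x' + y'); first exact: (subalg_lin _ Bs).
    rewrite opprD addrACA -scalerBr (le_lt_trans (cnormD _ _)) // cnormZE.
    have : (cabs a + 1) * cnorm (x - x') < e / 2.
      by rewrite mulrC -ltr_pdivlMr.
    by have := cnorm_ge0 (x - x'); rewrite mulrDl; lra.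
  - apply/closure_cnorm => e e0.
    pose d := Num.min 1 (e / (cnorm x + cnorm y + 2)).
    have p0 : 0 < cnorm x + cnorm y + 2.
      by have := cnorm_ge0 x; have := cnorm_ge0 y; lra.
    have d0 : 0 < d by rewrite lt_min ltr01 divr_gt0.
    have d1 : d <= 1 by rewrite ge_min lexx.
    have de : d * (cnorm x + cnorm y + 2) <= e.
      by rewrite -ler_pdivlMr // ge_min lexx orbT.
    have [x' Bx' xx'] := Bx d d0; have [y' By' yy'] := By d d0.
    exists (x' * y'); first exact: (subalgM Bs).
    have -> : x * y - x' * y' = x * (y - y') + (x - x') * y'.
      by rewrite mulrBr mulrBl addrA subrK.
    rewrite (le_lt_trans (cnormD _ _)) //.
    have h1 := cnormM x (y - y'); have h2 := cnormM (x - x') y'.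
    have h3 : cnorm x * cnorm (y - y') <= cnorm x * d.
      by rewrite ler_wpM2l ?cnorm_ge0 // ltW.
    have h5 := cnormB y (y - y'); rewrite opprB addrCA subrr addr0 in h5.
    have h4 : cnorm (x - x') * cnorm y' <= d * (cnorm y + 1).
      by rewrite ler_pM ?cnorm_ge0 // ?ltW //; lra.
    lra.
move=> x /closure_cnorm Bx; apply/closure_cnorm => e /Bx[y By xy].
by exists (adj y); [exact: Badj|rewrite -adjB cnorm_adj].
Qed.

Lemma cgen_sub S : is_cstar_subalgebra (cstar_gen S).
Proof.
split.
- split=> [B [[]] //|a x y Sx Sy B Bs SB|x y Sx Sy B Bs SB].
    by have [[_ + _] _ _] := Bs; apply; [exact: Sx|exact: Sy].
  by have [[_ _ +] _ _] := Bs; apply; [exact: Sx|exact: Sy].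
- by move=> x Sx B Bs SB; have [_ + _] := Bs; apply; exact: Sx.
- move=> x clx B Bs SB; have [_ _] := Bs; apply.
  move=> U /clx[y [Sy Uy]]; exists y; split=> //; exact: Sy.
Qed.

Lemma sgen_cgen S : subalgebra_gen S `<=` cstar_gen S.
Proof.
apply: sgen_ind; first by have [] := cgen_sub S.
by move=> x Sx B _ SB; apply: SB.
Qed.

Lemma sgen_adj S : (forall x, S x -> S (adj x)) ->
  forall x, subalgebra_gen S x -> subalgebra_gen S (adj x).
Proof.
move=> Sadj; have Gs := sgen_sub S.
apply: (@sgen_ind S [set x | subalgebra_gen S (adj x)]).
  split=> [|a x y /= Sx Sy|x y /= Sx Sy].
  - by rewrite /= adj1; exact: (subalg1 Gs).
  - by rewrite adjD adjZE; exact: (subalg_lin _ Gs).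
  - by rewrite adjM; exact: (subalgM Gs).
by move=> x /Sadj; exact: sgen_incl.
Qed.

Lemma sgen_dense S : (forall x, S x -> S (adj x)) ->
  forall x (e : R), cstar_gen S x -> 0 < e ->
  exists2 y, subalgebra_gen S y & cnorm (x - y) < e.
Proof.
move=> Sadj x e Sx; move: e; apply/closure_cnorm.
apply: Sx; first exact: closure_cstar (sgen_sub S) (sgen_adj Sadj).
by move=> y Sy; apply: subset_closure; exact: sgen_incl.
Qed.

End Generation.

Section LocalAlgebras.
Context {R : realType} {A : cstarAlgType R} (F : fermionChain A).
Implicit Types (x y P Q g : A) (J K : set int) (i j : int).
Local Notation c := (ann F).
Local Notation theta := (theta F).
Local Notation tau := (tau F).

(** The algebra of polynomials in the generators, not closed in norm: identities are proved by
    induction on it and carried further by density. Arbitrary index sets treat intervals, half-lines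
    and the whole chain alike. *)
Definition alg J : set A := subalgebra_gen (gens F J).

Lemma alg_sub J : is_subalgebra (alg J).
Proof. exact: sgen_sub. Qed.
Lemma alg1 J : alg J 1.
Proof. exact: subalg1 (alg_sub J). Qed.

Lemma alg0 J : alg J 0.
Proof. exact: subalg0 (alg_sub J). Qed.

Lemma algM J x y : alg J x -> alg J y -> alg J (x * y).
Proof. exact: subalgM (alg_sub J). Qed.

Lemma alg_lin J (a : R[i]) x y : alg J x -> alg J y -> alg J (a *: x + y).
Proof. exact: subalg_lin (alg_sub J). Qed.

Lemma algZ J (a : R[i]) x : alg J x -> alg J (a *: x).
Proof. exact: subalgZ (alg_sub J). Qed.

Lemma algD J x y : alg J x -> alg J y -> alg J (x + y).
Proof. exact: subalgD (alg_sub J). Qed.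

Lemma algN J x : alg J x -> alg J (- x).
Proof. exact: subalgN (alg_sub J). Qed.

Lemma algB J x y : alg J x -> alg J y -> alg J (x - y).
Proof. exact: subalgB (alg_sub J). Qed.

Lemma alg_mono J K : J `<=` K -> alg J `<=` alg K.
Proof.
move=> JK; apply: (sgen_ind (alg_sub K)) => x [j Jj xj]; apply: sgen_incl.
by exists j => //; exact: JK.
Qed.

Lemma alg_le J K x : J `<=` K -> alg J x -> alg K x.
Proof. by move=> JK; exact: alg_mono. Qed.

Lemma gens_adj J x : gens F J x -> gens F J (adj x).
Proof. by move=> [j Jj [->|->]]; exists j => //; [right|left; rewrite adjK]. Qed.

Lemma alg_adj J x : alg J x -> alg J (adj x).
Proof. by move: x; apply: sgen_adj; exact: gens_adj. Qed.

Lemma alg_T J x : alg J x -> alg setT x.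
Proof. by apply: alg_mono. Qed.

Lemma algP J (B : set A) : is_subalgebra B -> (forall j, J j -> B (c j)) ->
  (forall j, J j -> B (adj (c j))) -> alg J `<=` B.
Proof.
by move=> Bs B1 B2; apply: (sgen_ind Bs) => x [j Jj [->|->]]; [exact: B1|exact: B2].
Qed.

Lemma alg_ann J j : J j -> alg J (c j).
Proof. by move=> Jj; apply: sgen_incl; exists j => //; left. Qed.

Lemma alg_cre J j : J j -> alg J (adj (c j)).
Proof. by move=> Jj; apply: sgen_incl; exists j => //; right. Qed.

Lemma theta_adj x : theta (adj x) = adj (theta x).
Proof. by have [_] := theta_aut F; apply. Qed.

Lemma tau_adj k x : tau k (adj x) = adj (tau k x).
Proof. by have [_] := tau_aut F k; apply. Qed.

Lemma theta_cre j : theta (adj (c j)) = - adj (c j).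
Proof. by rewrite theta_adj theta_ann adjN. Qed.

Lemma tau_cre k j : tau k (adj (c j)) = adj (c (j + k)).
Proof. by rewrite tau_adj tau_ann. Qed.

Lemma lrP (f : {lrmorphism A -> A}) (a : R[i]) x y :
  f (a *: x + y) = a *: f x + f y.
Proof. exact: linearP. Qed.

Lemma lrM (f : {lrmorphism A -> A}) x y : f (x * y) = f x * f y.
Proof. exact: rmorphM. Qed.

Lemma lr1 (f : {lrmorphism A -> A}) : f 1 = 1.
Proof. exact: rmorph1. Qed.

Lemma lrN (f : {lrmorphism A -> A}) x : f (- x) = - f x.
Proof. exact: raddfN. Qed.

Lemma lrD (f : {lrmorphism A -> A}) x y : f (x + y) = f x + f y.
Proof. exact: raddfD. Qed.

Lemma lrZ (f : {lrmorphism A -> A}) (a : R[i]) x : f (a *: x) = a *: f x.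
Proof. exact: linearZ. Qed.

Lemma alg_theta J x : alg J x -> alg J (theta x).
Proof.
move: x; apply: (@algP J [set x | alg J (theta x)]) => /=.
- split=> [|a x y /= ex ey|x y /= ex ey]; rewrite /= ?lr1 ?lrP ?lrM.
  + by apply: alg1.
  + by apply: alg_lin.
  + by apply: algM.
- by move=> j Jj; rewrite theta_ann; apply: algN => //; exact: alg_ann.
- by move=> j Jj; rewrite theta_cre; apply: algN => //; exact: alg_cre.
Qed.

Lemma thetaK J x : alg J x -> theta (theta x) = x.
Proof.
move: x; apply: (@algP J [set x | theta (theta x) = x]) => /=.
- split=> [|a x y /= ex ey|x y /= ex ey]; first by rewrite /= !lr1.
    by rewrite !lrP ex ey.
  by rewrite !lrM ex ey.
- by move=> j _; rewrite theta_ann lrN theta_ann opprK.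
- by move=> j _; rewrite theta_cre lrN theta_cre opprK.
Qed.

Definition shift_set J (k : int) : set int := [set j | J (j - k)].

Lemma alg_tau J k x : alg J x -> alg (shift_set J k) (tau k x).
Proof.
move: x; apply: (@algP J [set x | alg (shift_set J k) (tau k x)]) => /=.
- split=> [|a x y /= ex ey|x y /= ex ey]; rewrite /= ?lr1 ?lrP ?lrM.
  + by apply: alg1.
  + by apply: alg_lin.
  + by apply: algM.
- by move=> j Jj; rewrite tau_ann; apply: alg_ann; rewrite /shift_set /= addrK.
- by move=> j Jj; rewrite tau_cre; apply: alg_cre; rewrite /shift_set /= addrK.
Qed.

Lemma tauD J k l x : alg J x -> tau k (tau l x) = tau (l + k) x.
Proof.
move: x; apply: (@algP J [set x | tau k (tau l x) = tau (l + k) x]) => /=.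
- split=> [|a x y /= ex ey|x y /= ex ey]; first by rewrite /= !lr1.
    by rewrite !lrP ex ey.
  by rewrite !lrM ex ey.
- by move=> j _; rewrite !tau_ann addrA.
- by move=> j _; rewrite !tau_cre addrA.
Qed.

Lemma tau0 J x : alg J x -> tau 0 x = x.
Proof.
move: x; apply: (@algP J [set x | tau 0 x = x]) => /=.
- split=> [|a x y /= ex ey|x y /= ex ey]; first by rewrite /= !lr1.
    by rewrite !lrP ex ey.
  by rewrite !lrM ex ey.
- by move=> j _; rewrite tau_ann addr0.
- by move=> j _; rewrite tau_cre addr0.
Qed.

Lemma tauNK J k x : alg J x -> tau (- k) (tau k x) = x.
Proof. by move=> Jx; rewrite (tauD _ _ Jx) subrr (tau0 Jx). Qed.

Lemma theta_tau J k x : alg J x -> theta (tau k x) = tau k (theta x).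
Proof.
move: x; apply: (@algP J [set x | theta (tau k x) = tau k (theta x)]) => /=.
- split=> [|a x y /= ex ey|x y /= ex ey]; first by rewrite /= !lr1.
    by rewrite !lrP ex ey.
  by rewrite !lrM ex ey.
- by move=> j _; rewrite theta_ann !lrN tau_ann theta_ann.
- by move=> j _; rewrite theta_cre !lrN tau_cre theta_cre.
Qed.

Lemma alg_fin J x : alg J x ->
  exists N : nat, alg [set j | J j /\ - N%:Z <= j <= N%:Z] x.
Proof.
pose I (N : nat) := [set j | J j /\ - N%:Z <= j <= N%:Z].
have mono (N M : nat) : (N <= M)%N -> alg (I N) `<=` alg (I M).
  by move=> NM; apply: alg_mono => j [Jj hj]; split => //; lia.
move: x; apply: (@algP J [set x | exists N : nat, alg (I N) x]) => /=.
- split=> [|a x y /= [N Nx] [M My]|x y /= [N Nx] [M My]].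
  + by exists 0%N; apply: alg1.
  + exists (maxn N M); apply: alg_lin => //.
      by apply: mono Nx; rewrite leq_maxl.
    by apply: mono My; rewrite leq_maxr.
  + exists (maxn N M); apply: algM => //.
      by apply: mono Nx; rewrite leq_maxl.
    by apply: mono My; rewrite leq_maxr.
- by move=> j Jj; exists `|j|%N; apply: alg_ann; split => //; lia.
- by move=> j Jj; exists `|j|%N; apply: alg_cre; split => //; lia.
Qed.

Definition disj J K := forall j, J j -> K j -> False.

Lemma comm_ann J i x : ~ J i -> alg J x -> c i * x = theta x * c i.
Proof.
move=> nJ; move: x; apply: (@algP J [set x | c i * x = theta x * c i]) => /=.
- split=> [|a x y /= ex ey|x y /= ex ey]; first by rewrite /= lr1 mulr1 mul1r.
    by rewrite lrP mulrDr mulrDl -scalerAl -scalerAr ex ey.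
  by rewrite lrM mulrA ex -!mulrA ey.
- by move=> j Jj; rewrite theta_ann mulNr; apply/eqP; rewrite -subr_eq0 opprK car_ann.
- move=> j Jj; rewrite theta_cre mulNr; apply/eqP; rewrite -subr_eq0 opprK addrC.
  by rewrite car_mix; have [e|] := eqVneq i j; [case: nJ; rewrite e|].
Qed.

Lemma comm_cre J i x : ~ J i -> alg J x -> adj (c i) * x = theta x * adj (c i).
Proof.
move=> nJ; move: x; apply: (@algP J [set x | adj (c i) * x = theta x * adj (c i)]) => /=.
- split=> [|a x y /= ex ey|x y /= ex ey]; first by rewrite /= lr1 mulr1 mul1r.
    by rewrite lrP mulrDr mulrDl -scalerAl -scalerAr ex ey.
  by rewrite lrM mulrA ex -!mulrA ey.
- move=> j Jj; rewrite theta_ann mulNr; apply/eqP; rewrite -subr_eq0 opprK.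
  by rewrite car_mix; have [e|] := eqVneq j i; [case: nJ; rewrite -e|].
- by move=> j Jj; rewrite theta_cre mulNr; apply/eqP; rewrite -subr_eq0 opprK car_cre.
Qed.

Lemma comm_even J K P Q : disj J K -> alg J P -> alg K Q -> theta P = P ->
  Q * P = P * Q.
Proof.
move=> JK JP KQ eP; move: Q KQ; apply: (@algP K [set Q | Q * P = P * Q]) => /=.
- split=> [|a x y /= ex ey|x y /= ex ey]; first by rewrite /= mulr1 mul1r.
    by rewrite mulrDr mulrDl -scalerAl -scalerAr ex ey.
  by rewrite -mulrA ey mulrA ex mulrA.
- by move=> j Kj; rewrite (comm_ann _ JP) ?eP // => Jj; exact: JK Jj Kj.
- by move=> j Kj; rewrite (comm_cre _ JP) ?eP // => Jj; exact: JK Jj Kj.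
Qed.

(** [Q] need not be homogeneous: [theta] supplies the sign on each of its two parts. *)
Lemma comm_odd J K P Q : disj J K -> alg J P -> alg K Q -> theta P = - P ->
  Q * P = P * theta Q.
Proof.
move=> JK JP KQ oP; move: Q KQ; apply: (@algP K [set Q | Q * P = P * theta Q]) => /=.
- split=> [|a x y /= ex ey|x y /= ex ey]; first by rewrite /= lr1 mulr1 mul1r.
    by rewrite lrP mulrDr mulrDl -scalerAl -scalerAr ex ey.
  by rewrite lrM -mulrA ey mulrA ex mulrA.
- move=> j Kj; rewrite (comm_ann _ JP) ?oP ?theta_ann ?mulNr ?mulrN //.
  by move=> Jj; exact: JK Jj Kj.
- move=> j Kj; rewrite (comm_cre _ JP) ?oP ?theta_cre ?mulNr ?mulrN //.
  by move=> Jj; exact: JK Jj Kj.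
Qed.

Definition homogeneous r := theta r = r \/ theta r = - r.

(* Up to a sign, the generators can be reordered so that those with index in
   [K] come first. *)
Lemma alg_split_ind J K (T : A -> Prop) : disj J K ->
  (forall (a : R[i]) x y, T x -> T y -> T (a *: x + y)) ->
  (forall r x, alg K r -> homogeneous r -> alg J x -> T (r * x)) ->
  forall x, alg (J `|` K) x -> T x.
Proof.
move=> JK Tl Tm.
(* [D] is the linear span of the products [r * x], written as the intersection of all predicates
   closed in this way. It is stable under left multiplication by each generator and contains 1. *)
pose D x := forall T' : A -> Prop,
  (forall (a : R[i]) x y, T' x -> T' y -> T' (a *: x + y)) ->
  (forall r x, alg K r -> homogeneous r -> alg J x -> T' (r * x)) -> T' x.
have D1 : D 1.
  move=> T' T'l T'm; rewrite -(mulr1 1); apply: T'm; [by apply: alg1| |by apply: alg1].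
  by left; rewrite lr1.
have gen g : (forall T' : A -> Prop,
    (forall (a : R[i]) x y, T' x -> T' y -> T' (a *: x + y)) ->
    (forall r x, alg K r -> homogeneous r -> alg J x -> T' (r * x)) ->
    (forall r x, alg K r -> homogeneous r -> alg J x -> T' (g * (r * x)))) ->
    forall d, D d -> D (g * d).
  move=> gT d Dd T' T'l T'm; apply: (Dd (fun d => T' (g * d))).
    by move=> a x y hx hy; rewrite mulrDr -scalerAr; exact: T'l.
  exact: gT.
have T'N (T' : A -> Prop) x : (forall (a : R[i]) x y, T' x -> T' y -> T' (a *: x + y)) ->
    (forall r x, alg K r -> homogeneous r -> alg J x -> T' (r * x)) ->
    T' x -> T' (- x).
  move=> T'l T'm T'x; rewrite -scaleN1r -[_ *: x]addr0; apply: T'l => //.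
  rewrite -(mul0r 0); apply: T'm; try by apply: alg0.
  by left; rewrite raddf0.
have : alg (J `|` K) `<=` [set x | forall d, D d -> D (x * d)].
  apply: algP => /=.
  - split=> [d|a x y ex ey d Dd|x y ex ey d Dd] /=; first by rewrite mul1r.
      move=> T' T'l T'm; rewrite mulrDl -scalerAl.
      by apply: (T'l); [exact: ex|exact: ey].
    by rewrite -mulrA; apply: ex; exact: ey.
  - move=> j [Jj|Kj]; apply: gen => T' T'l T'm r x Kr hr Jx; rewrite mulrA.
      rewrite (comm_ann _ Kr) => [|Kj]; last exact: JK Jj Kj.
      rewrite -mulrA; have h : T' (r * (c j * x)).
        by apply: T'm => //; apply: algM => //; exact: alg_ann.
      by case: hr => ->; rewrite ?mulNr //; exact: T'N.
    apply: T'm => //; first by apply: algM => //; exact: alg_ann.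
    by case: hr => hr; [right|left]; rewrite lrM theta_ann hr ?mulrNN ?mulNr.
  - move=> j [Jj|Kj]; apply: gen => T' T'l T'm r x Kr hr Jx; rewrite mulrA.
      rewrite (comm_cre _ Kr) => [|Kj]; last exact: JK Jj Kj.
      rewrite -mulrA; have h : T' (r * (adj (c j) * x)).
        by apply: T'm => //; apply: algM => //; exact: alg_cre.
      by case: hr => ->; rewrite ?mulNr //; exact: T'N.
    apply: T'm => //; first by apply: algM => //; exact: alg_cre.
    by case: hr => hr; [right|left]; rewrite lrM theta_cre hr ?mulrNN ?mulNr.
by move=> h x /h/(_ 1 D1); rewrite mulr1; apply.
Qed.

Definition odd_of x := (2^-1)%:C *: (x - theta x).
Definition even_of x := (2^-1)%:C *: (x + theta x).

Lemma half2 : 2^-1%:C + 2^-1%:C = 1 :> R[i].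
Proof.
by rewrite -rmorphD (_ : 2^-1 + 2^-1 = 1 :> R) ?rmorph1 //; field.
Qed.

Lemma even_odd_of x : even_of x + odd_of x = x.
Proof.
by rewrite -scalerDr addrACA subrr addr0 scalerDr -scalerDl half2 scale1r.
Qed.

Lemma theta_odd_of J x : alg J x -> theta (odd_of x) = - odd_of x.
Proof.
move=> Jx; rewrite /odd_of lrZ lrD lrN (thetaK Jx) -scalerN opprB.
by [].
Qed.

Lemma theta_even_of J x : alg J x -> theta (even_of x) = even_of x.
Proof.
by move=> Jx; rewrite /even_of lrZ lrD (thetaK Jx) addrC.
Qed.

Lemma alg_odd_of J x : alg J x -> alg J (odd_of x).
Proof.
by move=> Jx; apply: algZ => //; apply: algB => //; exact: alg_theta.
Qed.

Lemma alg_even_of J x : alg J x -> alg J (even_of x).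
Proof.
by move=> Jx; apply: algZ => //; apply: algD => //; exact: alg_theta.
Qed.

Lemma alg_dense x (e : R) : 0 < e -> exists2 y, alg setT y & cnorm (x - y) < e.
Proof.
move=> e0; apply: sgen_dense => //; first by move=> y; exact: gens_adj.
have -> : gens F setT = [set x | exists j, x = c j \/ x = adj (c j)].
  rewrite predeqE => y; split=> [[j _ yj]|[j yj]]; exists j => //.
by rewrite car_gen.
Qed.

Definition neg : set int := [set j | j < 0].
Definition nonneg : set int := [set j | 0 <= j].

Lemma algL_dense x (e : R) : alg_L F x -> 0 < e ->
  exists2 y, alg neg y & cnorm (x - y) < e.
Proof. by move=> Lx e0; apply: sgen_dense => // y; exact: gens_adj. Qed.

Lemma alg_algL x : alg neg x -> alg_L F x.
Proof. exact: sgen_cgen. Qed.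

Lemma algL_sub : is_subalgebra (alg_L F).
Proof. by have [] := cgen_sub (gens F neg). Qed.

Lemma algL_adj x : alg_L F x -> alg_L F (adj x).
Proof. by have [_ + _] := cgen_sub (gens F neg); apply. Qed.

End LocalAlgebras.

(** * Parity strings *)

Section Strings.
Context {R : realType} {A : cstarAlgType R} (F : fermionChain A).
Implicit Types (x y P Q g : A) (J K : set int) (i j : int).
Local Notation c := (ann F).
Local Notation theta := (theta F).
Local Notation tau := (tau F).
Local Notation alg := (alg F).

(** The parity of site [j]: a self-adjoint unitary, [-1] on the empty and [1] on the occupied
    site. *)
Definition sigma j : A := 2%:R *: (adj (c j) * c j) - 1.

Lemma ann_sq j : c j * c j = 0.
Proof.
have := car_ann F j j; rewrite -mulr2n -scaler_nat => /eqP.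
by rewrite scaler_eq0 pnatr_eq0 /= => /eqP.
Qed.

Lemma ann_cre j : c j * adj (c j) = 1 - adj (c j) * c j.
Proof.
have := car_mix F j j; rewrite eqxx mulr1n => <-.
by rewrite addrAC subrr add0r.
Qed.

Lemma alg_sigma j : alg [set j] (sigma j).
Proof.
apply: algB; last exact: alg1.
by apply: algZ; apply: algM; [exact: alg_cre|exact: alg_ann].
Qed.

Lemma sigma_adj j : adj (sigma j) = sigma j.
Proof. by rewrite adjB adj1 adjZE adjM adjK conjc_nat. Qed.

Lemma theta_sigma j : theta (sigma j) = sigma j.
Proof.
by rewrite lrD lrN lr1 lrZ lrM theta_cre theta_ann mulrNN.
Qed.

Lemma tau_sigma k j : tau k (sigma j) = sigma (j + k).
Proof. by rewrite lrD lrN lr1 lrZ lrM tau_cre tau_ann. Qed.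

Lemma sigma_ann j : sigma j * c j = - c j.
Proof.
by rewrite mulrBl mul1r -scalerAl -mulrA ann_sq mulr0 scaler0 sub0r.
Qed.

Lemma ann_sigma j : c j * sigma j = c j.
Proof.
rewrite mulrBr mulr1 -scalerAr mulrA ann_cre mulrBl mul1r -mulrA ann_sq mulr0.
by rewrite subr0 scaler_nat mulr2n addrK.
Qed.

Lemma sigma_cre j : sigma j * adj (c j) = adj (c j).
Proof. by rewrite -[in RHS](ann_sigma j) adjM sigma_adj. Qed.

Lemma cre_sigma j : adj (c j) * sigma j = - adj (c j).
Proof. by rewrite -{1}sigma_adj -adjM sigma_ann adjN. Qed.

Lemma sigma_sq j : sigma j * sigma j = 1.
Proof.
rewrite {1}/sigma mulrBl mul1r -scalerAl -mulrA ann_sigma.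
by rewrite /sigma opprB addrCA subrr addr0.
Qed.

(** Strings with arbitrary left end, a family closed under translation. *)
Definition sstr (a : int) (k : nat) : A := \prod_(i < k) sigma (a + i%:Z).

Lemma sstr0 a : sstr a 0 = 1.
Proof. by rewrite /sstr big_ord0. Qed.

Lemma sstrS a k : sstr a k.+1 = sstr a k * sigma (a + k%:Z).
Proof. by rewrite /sstr big_ord_recr. Qed.

Lemma string_sstr k : string F k = sstr 0 k.
Proof. by apply: eq_bigr => i _; rewrite add0r. Qed.

Lemma sstr_cat a k l : sstr a (k + l) = sstr a k * sstr (a + k%:Z) l.
Proof.
elim: l => [|l IH]; first by rewrite addn0 sstr0 mulr1.
by rewrite addnS !sstrS IH -mulrA PoszD addrA.
Qed.

Lemma tau_sstr l a k : tau l (sstr a k) = sstr (a + l) k.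
Proof.
elim: k => [|k IH]; first by rewrite !sstr0 lr1.
by rewrite !sstrS lrM IH tau_sigma addrAC.
Qed.

Lemma theta_sstr a k : theta (sstr a k) = sstr a k.
Proof.
elim: k => [|k IH]; first by rewrite !sstr0 lr1.
by rewrite !sstrS lrM IH theta_sigma.
Qed.

Definition itv (a : int) (k : nat) : set int := [set j | a <= j < a + k%:Z].

Lemma alg_sstr J a k : itv a k `<=` J -> alg J (sstr a k).
Proof.
elim: k => [|k IH] aJ; first by rewrite sstr0; exact: alg1.
rewrite sstrS; apply: algM.
  by apply: IH => j; rewrite /itv /= => hj; apply: aJ; rewrite /itv /=; lia.
have := @alg_sigma (a + k%:Z); apply: alg_le => _ ->; apply: aJ; rewrite /itv /=; lia.
Qed.

Lemma sstr_comm_out J a k x : disj (itv a k) J -> alg J x ->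
  x * sstr a k = sstr a k * x.
Proof.
move=> d Jx; exact: comm_even d (alg_sstr (@subset_refl _ _)) Jx (theta_sstr _ _).
Qed.

Lemma sstr_comm_sigma a k : sstr a k * sigma (a + k%:Z) = sigma (a + k%:Z) * sstr a k.
Proof.
rewrite (@sstr_comm_out [set (a + k%:Z)]) //; last exact: alg_sigma.
by move=> j; rewrite /itv /= => /[swap] ->; lia.
Qed.

Lemma sstr_adj a k : adj (sstr a k) = sstr a k.
Proof.
elim: k => [|k IH]; first by rewrite !sstr0 adj1.
by rewrite !sstrS adjM sigma_adj IH sstr_comm_sigma.
Qed.

Lemma sstr_sq a k : sstr a k * sstr a k = 1.
Proof.
elim: k => [|k IH]; first by rewrite !sstr0 mulr1.
rewrite sstrS {1}sstr_comm_sigma -mulrA [sstr a k * _]mulrA IH mul1r.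
exact: sigma_sq.
Qed.

Lemma sstr_gen a k j g : alg [set j] g -> sigma j * g = - (g * sigma j) ->
  itv a k j -> sstr a k * g = - (g * sstr a k).
Proof.
move=> jg sg; elim: k => [|k IH]; first by rewrite /itv /=; lia.
move=> hj; rewrite sstrS; have [e|nj] := eqVneq j (a + k%:Z).
  rewrite -e -mulrA sg mulrN !mulrA (@sstr_comm_out [set j]) //.
  by move=> i; rewrite /itv /= => /[swap] ->; lia.
have -> : sigma (a + k%:Z) * g = g * sigma (a + k%:Z) -> 
  sstr a k * sigma (a + k%:Z) * g = - (g * (sstr a k * sigma (a + k%:Z))).
  by move=> e; rewrite -mulrA e mulrA IH ?mulNr ?mulrA //; move: hj nj; rewrite /itv /=; lia.
  by [].
rewrite (comm_even _ (@alg_sigma (a + k%:Z)) jg (theta_sigma _)) //.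
by move=> i /= -> /esym /eqP; rewrite (negbTE nj).
Qed.

(** A generator at a site of the interval anticommutes with the factor at that site and commutes
    with all others, so the string implements [theta] there. *)
Lemma sstr_comm_in J a k x : J `<=` itv a k -> alg J x ->
  sstr a k * x = theta x * sstr a k.
Proof.
move=> Ja; move: x; apply: (@algP _ _ _ J [set x | sstr a k * x = theta x * sstr a k]) => /=.
- split=> [|b x y /= ex ey|x y /= ex ey]; first by rewrite /= lr1 mulr1 mul1r.
    by rewrite lrP mulrDr mulrDl -scalerAl -scalerAr ex ey.
  by rewrite lrM mulrA ex -!mulrA ey.
- move=> j Jj; rewrite theta_ann mulNr; apply: sstr_gen (Ja _ Jj).
    exact: alg_ann.
  by rewrite sigma_ann ann_sigma.
- move=> j Jj; rewrite theta_cre mulNr; apply: sstr_gen (Ja _ Jj).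
    exact: alg_cre.
  by rewrite sigma_cre cre_sigma opprK.
Qed.

Lemma sstr_conj_in J a k x : J `<=` itv a k -> alg J x ->
  sstr a k * x * sstr a k = theta x.
Proof. by move=> Ja Jx; rewrite (sstr_comm_in Ja Jx) -mulrA sstr_sq mulr1. Qed.

Lemma sstr_conj_out J a k x : disj (itv a k) J -> alg J x ->
  sstr a k * x * sstr a k = x.
Proof.
by move=> Ja Jx; rewrite -mulrA (sstr_comm_out Ja Jx) mulrA sstr_sq mul1r.
Qed.

End Strings.

(** * Clustering of pure translation-invariant states *)

Section Clustering.
Context {R : realType} {A : cstarAlgType R} (F : fermionChain A).
Implicit Types (x y P Q w : A) (J K : set int) (i j : int).
Local Notation c := (ann F).
Local Notation theta := (theta F).
Local Notation tau := (tau F).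
Local Notation alg := (alg F).
Variable psi : {scalar A}.
Hypotheses (psip : pure psi) (psi_ti : translation_invariant F psi).
Let psis : state psi := proj1 psip.
Local Notation N := (sn (sform psi)).

Lemma sn_tau k x : N (tau k x) = N x.
Proof. by rewrite /sn /sform -tau_adj -lrM psi_ti. Qed.

Lemma psiD x y : psi (x + y) = psi x + psi y. Proof. exact: linearD. Qed.

Lemma psiZ (a : R[i]) x : psi (a *: x) = a * psi x. Proof. exact: linearZ. Qed.

Lemma cabs_psi_mul x y : cabs (psi (x * y)) <= N (adj x) * N y.
Proof.
have := si_CS (sform_si psis) y (adj x); rewrite /sform adjK mulrC.
by rewrite mulrC [X in _ <= X]mulrC.
Qed.

(** The anticommutator form. It dominates the form of [psi], and odd elements with disjoint supports
    are orthogonal for it, by the CAR. *)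
Definition tform x y : R[i] := psi (adj y * x + x * adj y).

Lemma tform_si : semi_inner tform.
Proof.
apply: sesquilinear_si => [a x y z|a x y z|x]; rewrite /tform.
- by rewrite !mulrDr !mulrDl -!scalerAl -!scalerAr addrACA -scalerDr linearP.
- rewrite adjD adjZE !mulrDr !mulrDl -!scalerAl -!scalerAr addrACA -scalerDr.
  exact: linearP.
- have [_ p0] := psis; rewrite psiD addr_ge0 //.
  by rewrite -{1}(adjK x) p0.
Qed.

Lemma cabs_psi_tform x y : cabs (psi (x * y)) ^+ 2 <= N (adj x) ^+ 2 * sn tform y ^+ 2.
Proof.
have h : N y ^+ 2 <= sn tform y ^+ 2.
  rewrite -lecR -(state_sn psis) -(si_self tform_si) /tform psiD lerDl.
  by have [_ p0] := psis; rewrite -{1}(adjK y) p0.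
have := cabs_psi_mul x y; rewrite -(@ler_pXn2r _ 2%N) ?nnegrE ?mulr_ge0 ?sn_ge0 ?cabs_ge0 //.
move=> /le_trans; apply; rewrite exprMn ler_wpM2l ?sqr_ge0 //.
Qed.

(* Far translates of an odd local element anticommute, so a linear combination
   [w] of them satisfies [psi (w* w + w w* )] = O([sum |z_i|^2]), as for an
   orthogonal family. *)
Lemma odd_mixing P Q (e : R) : alg setT Q -> theta Q = - Q -> 0 < e ->
  exists M : nat, forall k : nat, (M <= k)%N -> cabs (psi (P * tau k%:Z Q)) <= e.
Proof.
move=> TQ oQ e0; apply: contrapT => nex.
have bad (M : nat) : exists2 k : nat, (M <= k)%N & e < cabs (psi (P * tau k%:Z Q)).
  apply: contrapT => nk; apply: nex; exists M => k Mk; rewrite leNgt.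
  by apply/negP => ek; apply: nk; exists k.
have [M MQ] := alg_fin TQ.
pose q : R := sn tform Q ^+ 2.
(* [w] collects [n] bad translates [v_i] with coefficients [conjc z_i], where [z_i = psi (P * v_i)],
   and [S] is the sum of the [|z_i|^2]. *)
have key (n : nat) : exists w (S : R), [/\ alg setT w, theta w = - w,
    n%:R * e ^+ 2 <= S, psi (P * w) = S%:C & sn tform w ^+ 2 = S * q].
  elim: n => [|n [w [S [Tw ow Sn Pw wq]]]].
    exists 0, 0; split; rewrite ?mul0r ?mulr0 ?raddf0 ?oppr0 //; first exact: alg0.
    by rewrite (sn0 tform_si) expr0n.
  have [L Lw] := alg_fin Tw.
  have [k Lk ek] := bad (L + M).+1.
  pose z := psi (P * tau k%:Z Q); pose v := tau k%:Z Q.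
  have Kv : alg [set j | L%:Z < j] v.
    have := alg_tau (k := k%:Z) MQ; apply: alg_le => j; rewrite /shift_set /= => -[_].
    by lia.
  have ov : theta v = - v by rewrite /v (theta_tau _ TQ) oQ lrN.
  have dj : disj [set j | L%:Z < j] [set j | setT j /\ - L%:Z <= j <= L%:Z].
    by move=> j /= h [_]; lia.
  have anti : tform v w = 0.
    rewrite /tform (comm_odd dj Kv (alg_adj Lw) ov) theta_adj ow adjN mulrN.
    by rewrite addNr linear0.
  exists (w + conjc z *: v), (S + cabs z ^+ 2); split.
  - by apply: algD => //; apply: algZ; exact: alg_T Kv.
  - by rewrite lrD lrZ ow ov scalerN opprD.
  - rewrite -natr1 mulrDl mul1r lerD // ler_pXn2r ?nnegrE ?cabs_ge0 ?ltW //.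
  - by rewrite mulrDr -scalerAr psiD psiZ Pw -/z mulrC mul_conjC -rmorphD.
  - rewrite (siDD tform_si) (siZr tform_si) (si_conj tform_si v) anti conjc0 mulr0.
    rewrite mulr0 addr0 (snZ tform_si) cabsJ exprMn wq mulrDl; congr (_ + _ * _).
    congr (_ ^+ 2); rewrite /sn /tform /v -tau_adj -!lrM -lrD psi_ti; by [].
(* The Cauchy-Schwarz inequality gives [S ^ 2 <= N (adj P) ^ 2 * S * q], so [S] is bounded, against
   [n e^2 <= S]. *)
have [n nP] : exists n : nat, N (adj P) ^+ 2 * q < n%:R * e ^+ 2.
  exists (Num.truncn (N (adj P) ^+ 2 * q / e ^+ 2)).+1.
  by rewrite -ltr_pdivrMr ?exprn_gt0 // truncnS_gt.
have [w [S [_ _ Sn Pw wq]]] := key n.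
have := cabs_psi_tform P w; rewrite Pw cabs_real wq real_normK ?num_real //.
have := lt_le_trans nP Sn => S1 S2.
have S0 : 0 < S.
  by apply: le_lt_trans S1; rewrite mulr_ge0 ?sqr_ge0.
have : S * S <= S * (N (adj P) ^+ 2 * q) by rewrite -expr2 [leRHS]mulrCA.
by rewrite ler_pM2l // leNgt S1.
Qed.

(** By translation invariance [psi (tau k Q)] is constant in [k], while mixing with [P = 1] makes it
    tend to 0. *)
Lemma psi_odd Q : alg setT Q -> theta Q = - Q -> psi Q = 0.
Proof.
move=> TQ oQ; apply/eqP; rewrite -cabs_eq0 eq_le cabs_ge0 andbT.
apply: (@le0_eps _ _ 1) => e e0 _.
have [M /(_ M (leqnn M))] := odd_mixing 1 TQ oQ e0.
by rewrite mul1r psi_ti mul1r.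
Qed.

(** Along an ultrafilter, [x |-> lim psi (x * tau_k Q)] is dominated by [psi]: a far even translate
    commutes with a local [X], so the value at [X* X] is the limit of [<tau_k(Q) X, X>]. Purity
    makes the functional equal to [psi Q] times [psi]. *)
Lemma even_mixing P Q (e : R) : alg setT Q -> theta Q = Q -> 0 < e ->
  exists M : nat, forall k : nat, (M <= k)%N ->
    cabs (psi (P * tau k%:Z Q) - psi P * psi Q) <= e.
Proof.
move=> TQ eQ e0; apply: contrapT => nex.
pose bad := [set k : nat | e < cabs (psi (P * tau k%:Z Q) - psi P * psi Q)].
have badP (M : nat) : exists2 k : nat, (M <= k)%N & bad k.
  apply: contrapT => nk; apply: nex; exists M => k Mk; rewrite leNgt.
  by apply/negP => ek; apply: nk; exists k.
(* The ultrafilter is taken inside the infinite set of bad indices, so that the limit contradicts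
   the choice of these indices. *)
have PF : ProperFilter (within bad \oo).
  apply: Build_ProperFilter_ex => B [M _ MB].
  by have [k Mk bk] := badP M; exists k; apply: MB.
have [G [GP FG Gcpt]] := @ultra_limits R _ PF.
have Gbad : G bad by apply: FG; exists 0%N.
have Goo (M : nat) : G [set k | (M <= k)%N] by apply: FG; exists M.
pose u x k := psi (x * tau k%:Z Q).
have ub x k : cabs (u x k) <= N Q * cnorm x.
  rewrite (le_trans (cabs_psi_mul _ _)) // sn_tau mulrC ler_wpM2l ?sn_ge0 //.
  by rewrite (le_trans (sn_le_cnorm psis _)) // cnorm_adj.
have ubd x : cbounded (u x) by exists (N Q * cnorm x) => k; exact: ub.
pose phi x := ulim G (u x).
have c0 : 0 <= cnorm Q ^+ 2 + 1 by rewrite addr_ge0 ?sqr_ge0.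
have phiE : forall x, phi x = phi 1 * psi x.
  apply: (@pure_dominated _ _ psi psip phi (Num.sqrt (cnorm Q ^+ 2 + 1)) (N Q)
    (alg setT)).
  - move=> a x y; rewrite /phi -ulim_lin //; congr (ulim G _); apply/funext => k.
    by rewrite /u mulrDl -scalerAl psiD psiZ.
  - move=> x; apply: ulim_le => //; apply: filterS filterT => k _; exact: ub.
  - by move=> x d d0; exact: alg_dense.
  - move=> X TX; apply: ulim_le => //.
    have [L LX] := alg_fin TX; have [M MQ] := alg_fin TQ.
    apply: filterS (Goo (L + M).+1) => k /= kLM.
    have Kv : alg [set j | L%:Z < j] (tau k%:Z Q).
      have := alg_tau (k := k%:Z) MQ; apply: alg_le => j; rewrite /shift_set /= => -[_].
      by lia.
    have dj : disj [set j | L%:Z < j] [set j | setT j /\ - L%:Z <= j <= L%:Z].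
      by move=> j /= h [_]; lia.
    have ev : theta (tau k%:Z Q) = tau k%:Z Q by rewrite (theta_tau _ TQ) eQ.
    have -> : u (adj X * X) k = sform psi (tau k%:Z Q * X) X.
      by rewrite /u /sform -!mulrA (comm_even dj Kv LX ev).
    rewrite (le_trans (si_CS (sform_si psis) _ _)) //.
    rewrite (state_sn psis) cabs_real ger0_norm ?sqr_ge0 // expr2 mulrA.
    rewrite ler_wpM2r ?sn_ge0 //.
    have [|y yE] := @cstar_dominated _ _ Q (cnorm Q ^+ 2 + 1); first by rewrite ltrDl.
    apply: (sn_dominated psis (P := tau k%:Z y)) => //.
    by rewrite -!tau_adj -!lrM -lrD -yE lrZ lr1.
  - exact: sqrtr_ge0.
  - exact: sn_ge0.
have phi1 : phi 1 = psi Q.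
  apply: ulim_cst => //; apply: filterS filterT => k _ /=.
  by rewrite /u mul1r psi_ti.
have := ulimP Gcpt (ubd P) e0; rewrite -/(phi P) phiE phi1 => Ge.
have [k [/= h1 h2]] := filter_ex (filterI Ge Gbad).
by move: h1; rewrite /u mulrC ltNge ltW.
Qed.

Lemma mixing P Q (e : R) : alg setT Q -> 0 < e ->
  exists M : nat, forall k : nat, (M <= k)%N ->
    cabs (psi (P * tau k%:Z Q) - psi P * psi Q) <= e.
Proof.
move=> TQ e0; have e2 : 0 < e / 2 by rewrite divr_gt0.
have [M1 h1] := odd_mixing P (alg_odd_of TQ) (theta_odd_of TQ) e2.
have [M2 h2] := even_mixing P (alg_even_of TQ) (theta_even_of TQ) e2.
exists (maxn M1 M2) => k; rewrite geq_max => /andP[/h1 H1 /h2 H2].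
rewrite -(even_odd_of F Q) lrD mulrDr !psiD.
rewrite (psi_odd (alg_odd_of TQ) (theta_odd_of TQ)) addr0 addrAC.
by rewrite (le_trans (cabsD _ _)) //; lra.
Qed.

End Clustering.

(** * From string order to a central element *)

Lemma cvg_cabs (R : realType) (u : nat -> R[i]^o) (l : R[i]^o) :
  (u @ \oo --> l) <-> forall e : R, 0 < e ->
    exists N : nat, forall k, (N <= k)%N -> cabs (u k - l) < e.
Proof.
split=> [/cvgrPdist_lt ul e e0|ul].
  have /ul[N _ uN] : 0 < e%:C by rewrite (ltcR 0).
  exists N => k Nk; have := uN k Nk; rewrite /= distrC.
  by rewrite (cabsE (u k - l)) ltcR.
apply/cvgrPdist_lt => e e0; have eE := Re_real (ltW e0).
have e'0 : 0 < complex.Re e by rewrite -ltcR -eE.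
have [N uN] := ul _ e'0; exists N => // k /= /uN.
by rewrite distrC (cabsE (u k - l)) eE ltcR.
Qed.

(** * Bounded operators and weak limits *)

Section Commutants.
Context {R : realType} {H : hilbertType R}.
Implicit Types (T S X : H -> H) (M : set (H -> H)).

Lemma bounded_operatorP T :
  bounded_operator T <-> linear_op T /\ exists2 C, 0 <= C & bounded_by T C.
Proof.
split=> [[Tl Tc]|[Tl [C C0 TC]]].
  by split => //; have [C /ltW C0 TC] := continuous_bounded Tl Tc; exists C.
by split => //; exact: bounded_continuous TC.
Qed.

Lemma operator_adjoint T : bounded_operator T ->
  exists2 T', bounded_operator T' & forall x y, inner (T x) y = inner x (T' y).
Proof.
move=> /bounded_operatorP[Tl [C C0 TC]].
have [T' [T'l [C' T'C] TT']] := adjoint_exists Tl TC.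
exists T' => //; apply/bounded_operatorP; split => //; exists `|C'| => // x.
by rewrite (bounded_abs T'C).
Qed.

(** The a priori bound [K] supplies continuity only; the constant is decided on [D]. This turns
    bounds that vary along a sequence of operators into a uniform one. *)
Lemma bounded_dense (D : set H) T C K : dense_in D -> linear_op T -> 0 <= C ->
  bounded_by T K -> (forall x, D x -> hn (T x) <= C * hn x) -> bounded_by T C.
Proof.
move=> Dd Tl C0 TK TD x; rewrite -subr_le0.
apply: (@le0_eps _ _ (`|K| + C)) => e e0 _; have [z Dz xz] := Dd x e e0.
have := snD inner_si (T (x - z)) (T z); rewrite -(lopD Tl) subrK => h1.
have h2 := bounded_abs TK (ltW xz); have h3 := TD z Dz.
have h4 := snB inner_si x (x - z); rewrite opprB addrCA subrr addr0 in h4.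
have h5 : C * hn z <= C * (hn x + e) by rewrite ler_wpM2l //; lra.
by rewrite mulrDr in h5; lra.
Qed.

Section WeakLimit.
Variables (G : set_system nat) (GP : ProperFilter G).
Hypothesis Gcpt : forall u : nat -> R[i], cbounded u -> exists l, ulim_spec G u l.
Variables (X : nat -> H -> H) (C : R).
Hypotheses (C0 : 0 <= C) (Xl : forall k, linear_op (X k))
  (XC : forall k, bounded_by (X k) C).

Lemma weak_cbounded x y : cbounded (fun k => inner (X k x) y).
Proof.
exists (C * hn x * hn y) => k; rewrite (le_trans (si_CS inner_si _ _)) //.
by rewrite ler_wpM2r ?sn_ge0 // XC.
Qed.

(** Weak compactness of balls of operators: for fixed [x] the conjugate of the limit is a bounded
    linear functional of [y], to which the Riesz theorem applies. *)
Lemma weak_limit : exists2 X', bounded_operator X' &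
  forall x y, inner (X' x) y = ulim G (fun k => inner (X k x) y).
Proof.
have ub x y : cabs (ulim G (fun k => inner (X k x) y)) <= C * hn x * hn y.
  apply: ulim_le => //; first exact: weak_cbounded.
  apply: filterS filterT => k _ /=; rewrite (le_trans (si_CS inner_si _ _)) //.
  by rewrite ler_wpM2r ?sn_ge0 // XC.
have /choice[X' XX'] : forall x, exists v, forall y,
    inner v y = ulim G (fun k => inner (X k x) y).
  move=> x; pose g y := conjc (ulim G (fun k => inner (X k x) y)).
  have [||v gv] := @riesz _ _ g (C * hn x).
  - move=> a y z; apply: (can_inj (@conjcK R)).
    rewrite /g conjcD conjcM !conjcK -ulim_lin //; try exact: weak_cbounded.
    congr (ulim G _); apply/funext => k.
    by rewrite (siDr inner_si) (siZr inner_si).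
  - by move=> y; rewrite cabsJ.
  by exists v => y; rewrite innerC -gv /g conjcK.
exists X' => //; apply/bounded_operatorP; split.
  move=> a x z; apply: inner_ext => y.
  rewrite (siDl inner_si) (siZl inner_si) !XX' -ulim_lin //; try exact: weak_cbounded.
  by congr (ulim G _); apply/funext => k; rewrite Xl innerPl.
exists C => // x; have := ub x (X' x); rewrite -XX' (si_self inner_si).
rewrite cabs_real ger0_norm ?sqr_ge0 // expr2.
have [->|n0] := eqVneq (hn (X' x)) 0; first by rewrite mulr_ge0 ?sn_ge0.
by rewrite ler_pM2r // lt_def n0 sn_ge0.
Qed.

End WeakLimit.

End Commutants.

Section Representations.
Context {R : realType} {A : cstarAlgType R}.
Variable psi : {scalar A}.
Hypothesis psis : state psi.
Variables B D : set A.
Hypotheses (Bsub : is_subalgebra B) (Badj : forall x, B x -> B (adj x)).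
Hypotheses (DB : D `<=` B)
  (Dd : forall x (e : R), B x -> 0 < e -> exists2 y, D y & cnorm (x - y) < e).
Variables (H : hilbertType R) (pi : A -> H -> H) (Om : H).
Hypothesis G : is_gns B psi pi Om.

Lemma commute_dense T : bounded_operator T ->
  (forall P, D P -> forall x, T (pi P x) = pi P (T x)) ->
  forall Q, B Q -> forall x, T (pi Q x) = pi Q (T x).
Proof.
move=> /bounded_operatorP[Tl [C C0 TC]] TD Q BQ x.
apply/eqP; rewrite -subr_eq0; apply/eqP/hn_le0.
apply: (@le0_eps _ _ (C * hn x + hn (T x))) => e e0 _.
have [P DP QP] := Dd BQ e0.
have h1 := gns_approx psis Bsub Badj G x BQ (DB DP) (ltW QP).
have h2 := gns_approx psis Bsub Badj G (T x) BQ (DB DP) (ltW QP).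
have -> : T (pi Q x) - pi Q (T x) =
    T (pi Q x - pi P x) - (pi Q (T x) - pi P (T x)).
  by rewrite (lopB Tl) (TD P DP) opprB addrA subrK.
rewrite (le_trans (snB inner_si _ _)) // mulrDl lerD //; last by rewrite mulrC.
by rewrite (le_trans (TC _)) // -mulrA ler_wpM2l // mulrC.
Qed.

Lemma commutant_piP T : bounded_operator T ->
  (forall P, D P -> forall x, T (pi P x) = pi P (T x)) ->
  commutant (pi @` B) T.
Proof.
move=> Tb TD; split => // _ [Q BQ <-] x /=.
exact: commute_dense.
Qed.

End Representations.

Section StringOrderNotFactor.
Context {R : realType} {A : cstarAlgType R} (F : fermionChain A).
Implicit Types (x y P Q w : A) (J K : set int) (i j : int).
Local Notation c := (ann F).
Local Notation theta := (theta F).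
Local Notation tau := (tau F).
Local Notation alg := (alg F).
Local Notation sstr := (sstr F).
Local Notation L := (alg_L F).
Variable psi : {scalar A}.
Hypotheses (psip : pure psi) (psi_ti : translation_invariant F psi).
Let psis : state psi := proj1 psip.
Local Notation N := (sn (sform psi)).

Let Lsub := algL_sub F.
Let Ladj := @algL_adj R A F.
Let negL : alg neg `<=` L. Proof. by move=> x; exact: alg_algL. Qed.

Section StringOperator.
Variables (n m : int) (Q1 Q2 : A).
Hypotheses (n0 : n < 0) (m0 : 0 <= m) (o1 : odd_part F Q1) (a1 : alg_int F n (- 1) Q1)
  (o2 : odd_part F Q2) (a2 : alg_int F 0 m Q2).

Definition string_elt (k : nat) : A :=
  tau (- (2 * k)%N%:Z) Q1 * sstr (- (2 * k)%N%:Z) (2 * k).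

Lemma string_elt_alg k : alg neg (string_elt k).
Proof.
apply: algM.
  have := alg_tau (k := - (2 * k)%N%:Z) a1; apply: alg_le => j.
  by rewrite /shift_set /neg /=; lia.
by apply: alg_sstr => j; rewrite /itv /neg /=; lia.
Qed.

Lemma string_elt_odd k : theta (string_elt k) = - string_elt k.
Proof. by rewrite lrM (theta_tau _ a1) o1 theta_sstr lrN mulNr. Qed.

(** Passing the odd [tau(Q1)] turns [P] into [theta P], and the string, which covers the support of
    [P] for large [k], turns it back. *)
Lemma string_elt_comm P : alg neg P ->
  exists M : nat, forall k, (M <= k)%N -> P * string_elt k = string_elt k * P.
Proof.
move=> /alg_fin[M MP]; exists M.+1 => k Mk.
pose I := [set j : int | j < - (2 * k)%N%:Z].
have It : alg I (tau (- (2 * k)%N%:Z) Q1).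
  have := alg_tau (k := - (2 * k)%N%:Z) a1; apply: alg_le => j.
  by rewrite /shift_set /I /=; lia.
have ot : theta (tau (- (2 * k)%N%:Z) Q1) = - tau (- (2 * k)%N%:Z) Q1.
  by rewrite (theta_tau _ a1) o1 lrN.
have dj : disj I [set j | neg j /\ - M%:Z <= j <= M%:Z].
  by move=> j; rewrite /I /neg /= => h [_]; lia.
rewrite /string_elt mulrA (comm_odd dj It MP ot) -!mulrA; congr (_ * _).
rewrite (sstr_comm_in (J := [set j | neg j /\ - M%:Z <= j <= M%:Z])) //.
by move=> j; rewrite /neg /itv /= => -[]; lia.
Qed.

(** Translation and conjugation by the string carry [C = Q1* Q1 + y* y] to every [string_elt k], so
    the constant does not depend on [k]. *)
Lemma string_elt_bound : exists2 C : R, 0 <= C &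
  forall k x, N (string_elt k * x) <= C * N x.
Proof.
have [|y yE] := @cstar_dominated _ _ Q1 (cnorm Q1 ^+ 2 + 1); first by rewrite ltrDl.
have c0 : 0 <= cnorm Q1 ^+ 2 + 1 by rewrite addr_ge0 ?sqr_ge0.
exists (Num.sqrt (cnorm Q1 ^+ 2 + 1)) => [|k x]; first exact: sqrtr_ge0.
pose t := - (2 * k)%N%:Z.
apply: (sn_dominated psis (P := tau t y * sstr t (2 * k))) => //.
rewrite /string_elt !adjM sstr_adj -/t !mulrA -mulrDl -2!mulrA -mulrDr.
rewrite -!tau_adj -!lrM -lrD -yE lrZ lr1 -scalerAr mulr1 -scalerAl.
by rewrite sstr_sq.
Qed.

(* [Q2] is moved into the left half-chain by [2r] translations, using
   [S[-2k-2r,-2r-1] = S[-2k-2r,-1] S[-2r,-1]]. *)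
Lemma string_elt_value : exists (r : nat) (P : A), alg neg P /\
  forall k, psi (Q1 * string F (2 * k) * tau (2 * k)%N%:Z Q2) =
    psi (string_elt (k + r) * P).
Proof.
pose r := `|m|.+1%N; pose t := - (2 * r)%N%:Z.
exists r, (sstr t (2 * r) * tau t Q2); split.
  apply: algM; first by apply: alg_sstr => j; rewrite /itv /neg /t /=; lia.
  have := alg_tau (k := t) a2; apply: alg_le => j.
  by rewrite /shift_set /neg /t /r /=; lia.
move=> k; rewrite string_sstr -(psi_ti (- (2 * (k + r))%N%:Z)) !lrM.
rewrite tau_sstr add0r /string_elt mulnDr sstr_cat.
have -> : - (2 * k + 2 * r)%N%:Z + (2 * k)%N%:Z = t by rewrite /t; lia.
rewrite (tauD _ _ a2).
have -> : (2 * k)%N%:Z + - (2 * k + 2 * r)%N%:Z = t by rewrite /t; lia.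
by rewrite -!mulrA [sstr t _ * (sstr t _ * _)]mulrA sstr_sq mul1r.
Qed.

Lemma string_limit_not_factor (l : R[i]^o) : l != 0 ->
  (fun k : nat => psi (Q1 * string F (2 * k) * tau (2 * k)%N%:Z Q2) : R[i]^o)
    @ \oo --> l -> ~ factor_state L psi.
Proof.
move=> l0 /cvg_cabs ul fac.
have [H [pi [Om GG]]] := gns_exists psis Lsub Ladj.
have [G [GP FG Gcpt]] := @ultra_limits R \oo _.
have Goo (M : nat) : G [set k | (M <= k)%N] by apply: FG; exists M.
have [C C0 XC] := string_elt_bound.
have Lx k : L (string_elt k) by apply: negL; exact: string_elt_alg.
have Dd := gns_dense psis Lsub Ladj GG negL (@algL_dense R A F).
have Xb k : bounded_by (pi (string_elt k)) C.
  apply: (bounded_dense Dd (gns_linear GG (Lx k)) C0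
    (gns_bounded_by psis Lsub Ladj GG (Lx k))) => _ [P /negL LP <-].
  rewrite -(gns_mul GG) // !(gns_hn Lsub Ladj GG) //.
  exact: subalgM Lsub (Lx k) LP.
have Xl k : linear_op (pi (string_elt k)) by exact: (gns_linear GG).
have [X Xop XE] := weak_limit GP Gcpt C0 Xl Xb.
have wb := weak_cbounded Xb.
have XM : commutant (pi @` L) X.
  apply: (commutant_piP psis Lsub Ladj negL (@algL_dense R A F) GG Xop).
  move=> P nP x; apply: inner_ext => y; have LP := negL nP.
  rewrite XE (gns_adjl Ladj GG _ _ LP) XE.
  apply: ulim_eq => //; have [M MP] := string_elt_comm nP.
  apply: filterS (Goo M) => k /MP e /=; rewrite -(gns_mul GG) // -e (gns_mul GG) //.
  by rewrite (gns_adjl Ladj GG _ _ LP).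
have XN : commutant (commutant (pi @` L)) X.
  split => // T [Tb TM] x /=; apply: inner_ext => y.
  have [T' T'b TT'] := operator_adjoint Tb.
  rewrite XE TT' XE; congr (ulim G _); apply/funext => k.
  by rewrite -TT'; have /= <- := TM _ (ex_intro2 _ _ _ (Lx k) erefl) x.
(* [X] lies in the bicommutant and commutes with it, because it also lies in the commutant. *)
have [a aX] : exists a : R[i], forall h : H, X h = a *: h.
  by apply: (fac _ _ _ GG) => //; split => // S [_ SN] x; rewrite /= -[LHS](SN X XM).
have val P : alg neg P -> inner (X (pi P Om)) Om = ulim G (fun k => psi (string_elt k * P)).
  move=> /negL LP; rewrite XE; congr (ulim G _); apply/funext => k.
  by rewrite -(gns_mul GG) // -(gns_state GG) //; exact: subalgM Lsub (Lx k) LP.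
(* [a] is a limit of values of [psi] on odd elements, all of which vanish. *)
have a0 : a = 0.
  have := val 1 (@alg1 _ _ F neg); rewrite (gns_unit GG) aX (siZl inner_si).
  rewrite -{1}(gns_unit GG Om) -(gns_state GG); last exact: subalg1 Lsub.
  rewrite (proj1 psis) mulr1 => ->; apply: ulim_cst => //.
    exists 0 => k; rewrite mulr1 (psi_odd psip psi_ti (alg_T (@string_elt_alg k))) ?cabs0 //.
    exact: string_elt_odd.
  apply: filterS filterT => k _ /=; rewrite mulr1.
  by rewrite (psi_odd psip psi_ti (alg_T (@string_elt_alg k))) //; exact: string_elt_odd.
(* As [X = 0], the correlations, read at the shifted index [k - r], tend to 0 along [G], so
   [l = 0]. *)
have [r [P [nP rP]]] := string_elt_value.
have := val P nP; rewrite aX a0 scale0r (si0l inner_si) => /esym E.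
move: l0; rewrite -cabs_eq0 => /eqP; apply; apply/eqP; rewrite eq_le cabs_ge0 andbT.
apply: (@le0_eps _ _ 2) => e e0 _.
have ub : cbounded (fun k => psi (string_elt k * P)).
  have [M MP] := wb (pi P Om) Om; exists M => k; have := MP k.
  by rewrite -(gns_mul GG) // ?(gns_state GG) //; [exact: subalgM Lsub (Lx k) (negL nP)|exact: negL].
have [M uM] := ul e e0; have [k [/= h1 h2]] :=
  filter_ex (filterI (ulimP Gcpt ub e0) (Goo (M + r)%N)).
rewrite E subr0 in h1; have Mk : (M <= k - r)%N by lia.
have := uM _ Mk; rewrite rP subnK; last by lia.
have := cabsB (psi (string_elt k * P)) (psi (string_elt k * P) - l).
by rewrite opprB addrCA subrr addr0; lra.
Qed.

End StringOperator.

Lemma string_order_not_factor : string_order F psi -> ~ factor_state L psi.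
Proof.
move=> [n [m [Q1 [Q2 [[n0 m0] [t1 a1] [t2 a2] [l l0 ul]]]]]].
exact: (string_limit_not_factor n0 m0 t1 a1 a2 l0 ul).
Qed.

End StringOrderNotFactor.

(** * The centre of the left half-chain *)

Section Operators.
Context {R : realType}.

Lemma bop_comp (H1 : hilbertType R) (T S : H1 -> H1) :
  bounded_operator T -> bounded_operator S -> bounded_operator (T \o S).
Proof.
move=> /bounded_operatorP[Tl [C C0 TC]] /bounded_operatorP[Sl [D D0 SD]].
apply/bounded_operatorP; split; first by move=> a x y /=; rewrite Sl Tl.
exists (C * D) => [|x /=]; first exact: mulr_ge0.
by rewrite (le_trans (TC _)) // -mulrA ler_wpM2l.
Qed.

Lemma bop_lin (H1 : hilbertType R) (T S : H1 -> H1) (a b : R[i]) :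
  bounded_operator T -> bounded_operator S ->
  bounded_operator (fun x => a *: T x + b *: S x).
Proof.
move=> /bounded_operatorP[Tl [C C0 TC]] /bounded_operatorP[Sl [D D0 SD]].
apply/bounded_operatorP; split.
  move=> d x y; rewrite Tl Sl !scalerDr !scalerA ![_ * d]mulrC -!scalerA.
  by rewrite addrACA.
exists (cabs a * C + cabs b * D) => [|x].
  by rewrite addr_ge0 ?mulr_ge0 ?cabs_ge0.
rewrite (le_trans (snD inner_si _ _)) // !(snZ inner_si) mulrDl.
by rewrite lerD // -mulrA ler_wpM2l ?cabs_ge0.
Qed.

(* The hypothesis [a j ^ 2 <= a (2 j) a 0] gives
   [a (2 ^ k) >= a 0 (a 1 / a 0) ^ (2 ^ k)]. *)
Lemma doubling_bound (a : nat -> R) (C B : R) : 0 < C ->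
  (forall j, 0 <= a j) -> (forall j, a j ^+ 2 <= a (j + j)%N * a 0%N) ->
  (forall j, a j <= B * C ^+ j) -> a 1%N <= C * a 0%N.
Proof.
move=> C0 a0 a2 aB.
have [z|n0] := eqVneq (a 0%N) 0.
  have := a2 1%N; rewrite z mulr0 => h.
  have : a 1%N ^+ 2 == 0 by rewrite eq_le h sqr_ge0.
  by rewrite sqrf_eq0 mulr0 => /eqP ->.
have p0 : 0 < a 0%N by rewrite lt_def n0 a0.
pose q := a 1%N / a 0%N; have q0 : 0 <= q by rewrite divr_ge0.
have key k : a 0%N * q ^+ (2 ^ k) <= a (2 ^ k)%N.
  elim: k => [|k IH]; first by rewrite expn0 expr1 /q mulrC divfK.
  rewrite -(ler_pM2r p0) expnS mul2n -addnn exprD.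
  apply: le_trans (a2 _).
  have -> : a 0%N * (q ^+ (2 ^ k) * q ^+ (2 ^ k)) * a 0%N = (a 0%N * q ^+ (2 ^ k)) ^+ 2.
    by ring.
  by rewrite ler_pXn2r ?nnegrE ?mulr_ge0 ?exprn_ge0.
rewrite leNgt; apply/negP => lt.
have Cq : C < q by rewrite /q ltr_pdivlMr.
(* If [q > C], Bernoulli's inequality for [(q / C) ^ (2 ^ k)] bounds [2 ^ k * t] by [B / a 0] for
   all [k], which is absurd. *)
pose t := q / C - 1.
have t0 : 0 < t by rewrite /t subr_gt0 ltr_pdivlMr // mul1r.
have bern k : 1 + k%:R * t <= (1 + t) ^+ k.
  elim: k => [|k IH]; first by rewrite mul0r addr0 expr0.
  rewrite exprS -natr1; have k0 : 0 <= k%:R :> R by [].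
  have t2 : 0 <= k%:R * t * t by rewrite !mulr_ge0 // ltW.
  by apply: (le_trans _ (ler_wpM2l _ IH)); nra.
have fin k : (2 ^ k)%:R * t <= B / a 0%N.
  have h1 : a 0%N * (1 + t) ^+ (2 ^ k) <= B.
    have := le_trans (key k) (aB _).
    have -> : q = C * (1 + t) by rewrite /t; field; rewrite gt_eqF.
    by rewrite exprMn mulrCA mulrC ler_pM2r // exprn_gt0.
  rewrite ler_pdivlMr // mulrC (le_trans _ h1) // ler_pM2l //.
  by have := bern (2 ^ k)%N; lra.
have := fin (Num.truncn (B / a 0%N / t)).
rewrite -ler_pdivlMr // leNgt => /negP; apply.
apply: (lt_le_trans (truncnS_gt _)); rewrite ler_nat.
exact: ltn_expl.
Qed.

End Operators.

Section Center.
Context {R : realType} {A : cstarAlgType R} (F : fermionChain A).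
Local Notation theta := (theta F).
Local Notation tau := (tau F).
Local Notation alg := (alg F).
Local Notation sstr := (sstr F).
Local Notation L := (alg_L F).
Variable psi : {scalar A}.
Hypotheses (psip : pure psi) (psi_ti : translation_invariant F psi).
Let psis : state psi := proj1 psip.
Local Notation N := (sn (sform psi)).

Lemma psi_theta Q : alg setT Q -> psi (theta Q) = psi Q.
Proof.
move=> TQ; rewrite -{1}(even_odd_of F Q) lrD (theta_even_of TQ) (theta_odd_of TQ).
rewrite -[in RHS](even_odd_of F Q) !linearD linearN /=.
by rewrite (psi_odd psip psi_ti (alg_odd_of TQ) (theta_odd_of TQ)) oppr0.
Qed.

Let Lsub := algL_sub F.
Let Ladj := @algL_adj R A F.
Let negL : alg neg `<=` L. Proof. by move=> x; exact: alg_algL. Qed.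
Let Ldense := @algL_dense R A F.
Let Tsub : is_subalgebra [set: A]. Proof. by []. Qed.
Let Tadj (x : A) : [set: A] x -> [set: A] (adj x). Proof. by []. Qed.

Variables (K : hilbertType R) (rho : A -> K -> K) (om : K).
Hypothesis GK : is_gns L psi rho om.
Variables (H : hilbertType R) (pi : A -> H -> H) (Om : H).
Hypothesis GH : is_gns setT psi pi Om.

Lemma K_dense : dense_in [set rho a om | a in alg neg].
Proof. exact: (gns_dense psis Lsub Ladj GK negL Ldense). Qed.

Let vec_lin (V : hilbertType R) (B : set A) (p : A -> V -> V) (v : V) :
  is_gns B psi p v -> alg neg `<=` B ->
  forall (a : R[i]) (x y : A), alg neg x -> alg neg y ->
  p (a *: x + y) v = a *: p x v + p y v.
Proof. by move=> G nB a x y nx ny; rewrite (gns_lin G) //; exact: nB. Qed.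

(** [psi] is invariant under [theta], so [rho a om |-> rho (theta a) om] is isometric and extends to
    the unitary implementing the parity. *)
Lemma parity_exists : exists gam : K -> K, [/\ bounded_operator gam,
  forall x, gam (gam x) = x, forall x y, inner (gam x) y = inner x (gam y),
  gam om = om & forall a, alg neg a -> forall x, gam (rho a x) = rho (theta a) (gam x)].
Proof.
have nth a : alg neg a -> L (theta a) by move=> na; apply: negL; exact: alg_theta.
have [|||gam [gl gb gE]] := @dense_extension _ K K _ (alg neg) (fun a => rho a om)
   (fun a => rho (theta a) om) 1 ler01 (fun a x y => @alg_lin _ _ F neg a x y)
   (vec_lin GK negL).
- move=> a x y nx ny; rewrite lrP (gns_lin GK) //; exact: nth.
- exact: K_dense.
- move=> a na; rewrite mul1r !(gns_hn Lsub Ladj GK) //; [|exact: negL|exact: nth].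
  rewrite /sn /sform -theta_adj -lrM psi_theta //.
  by apply: algM; [exact: alg_adj (alg_T na)|exact: alg_T na].
have gO : bounded_operator gam by apply/bounded_operatorP; split => //; exists 1.
have gg x : gam (gam x) = x.
  apply: (@lop_ext_dense _ _ _ _ (gam \o gam) id (1 * 1) 1 K_dense) => //.
  - by move=> a y z /=; rewrite !gl.
  - by move=> y; rewrite -mulrA mul1r (le_trans (gb _)) // mul1r.
  - by move=> y; rewrite mul1r.
  - by move=> _ [a na <-] /=; rewrite !gE ?(thetaK na) //; exact: alg_theta.
have gi : forall x y, inner (gam x) (gam y) = inner x y.
  apply: (isometric_inner K_dense gl gb) => _ _ [a na <-] [b nb <-].
  rewrite !gE // !(gns_inner Lsub Ladj GK) //; try exact: negL; try exact: nth.
  rewrite /sform -theta_adj -lrM psi_theta //.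
  by apply: algM; [exact: alg_adj (alg_T nb)|exact: alg_T na].
exists gam; split => //.
- by move=> x y; rewrite -{1}(gg y) gi.
- by rewrite -{1}(gns_unit GK om) gE ?lr1 ?(gns_unit GK) //; exact: alg1.
move=> a na x.
apply: (@lop_ext_dense _ _ _ _ (gam \o rho a) (rho (theta a) \o gam)
  (1 * cnorm a) (cnorm (theta a) * 1) K_dense).
- by move=> b y z /=; rewrite (gns_linear GK) ?gl //; exact: negL.
- by move=> b y z /=; rewrite gl (gns_linear GK) //; exact: nth.
- move=> y /=; rewrite (le_trans (gb _)) // -mulrA ler_wpM2l //.
  by rewrite (gns_bounded_by psis Lsub Ladj GK) //; exact: negL.
- move=> y /=; rewrite (le_trans (gns_bounded_by psis Lsub Ladj GK (nth _ na) _)) //.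
  by rewrite -mulrA ler_wpM2l ?cnorm_ge0.
move=> _ [b nb <-] /=; rewrite -(gns_mul GK) ?gE ?lrM ?(gns_mul GK) //.
- exact: nth.
- exact: nth.
- exact: algM.
- exact: negL.
- exact: negL.
Qed.

(** Identifies [K] with the closure of [pi(A_L) Om]: on [A_L] both triples have the same form
    [sform psi]. *)
Lemma embedding_exists : exists V : K -> H, [/\ linear_op V, bounded_by V 1,
  forall x y, inner (V x) (V y) = inner x y, V om = Om
  & forall a, alg neg a -> forall x, V (rho a x) = pi a (V x)].
Proof.
have [|||V [Vl Vb VE]] := @dense_extension _ K H _ (alg neg) (fun a => rho a om)
   (fun a => pi a Om) 1 ler01 (fun a x y => @alg_lin _ _ F neg a x y)
   (vec_lin GK negL).
- by move=> a x y nx ny; rewrite (gns_lin GH).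
- exact: K_dense.
- move=> a na; rewrite mul1r (gns_hn Lsub Ladj GK) ?(gns_hn Tsub Tadj GH) //.
  exact: negL.
exists V; split => //.
- apply: (isometric_inner K_dense Vl Vb) => _ _ [a na <-] [b nb <-].
  rewrite !VE // (gns_inner Lsub Ladj GK) ?(gns_inner Tsub Tadj GH) //; exact: negL.
- by rewrite -{1}(gns_unit GK om) VE ?(gns_unit GH) //; exact: alg1.
move=> a na x.
apply: (@lop_ext_dense _ _ _ _ (V \o rho a) (pi a \o V)
  (1 * cnorm a) (cnorm a * 1) K_dense).
- by move=> b y z /=; rewrite (gns_linear GK) ?Vl //; exact: negL.
- by move=> b y z /=; rewrite Vl (gns_linear GH).
- move=> y /=; rewrite (le_trans (Vb _)) // -mulrA ler_wpM2l //.
  by rewrite (gns_bounded_by psis Lsub Ladj GK) //; exact: negL.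
- move=> y /=; rewrite (le_trans (gns_bounded_by psis Tsub Tadj GH I _)) //.
  by rewrite -mulrA ler_wpM2l ?cnorm_ge0.
move=> _ [b nb <-] /=; rewrite -(gns_mul GK) ?VE ?(gns_mul GH) //.
- exact: algM.
- exact: negL.
- exact: negL.
Qed.

(** Membership in the commutant of [rho(A_L)], tested on local elements; [central] below adds that
    [T] commutes with this whole commutant, which places it in the centre. *)
Definition rho_comm (T : K -> K) : Prop := bounded_operator T /\
  forall a, alg neg a -> forall x, T (rho a x) = rho a (T x).

Definition central (T : K -> K) : Prop := rho_comm T /\
  forall S, rho_comm S -> forall x, T (S x) = S (T x).

Lemma centralP T : commutant (commutant (rho @` L)) T ->
  commutant (commutant (commutant (rho @` L))) T -> central T.
Proof.
move=> [Tb T1] [_ T2]; split.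
  split => // a na x; apply: (T2 (rho a)); split.
    by apply: (gns_bounded_operator GK); exact: negL.
  by move=> S [_ SM] y; symmetry; apply: SM; exists a => //; exact: negL.
by move=> S [Sb SM] x; apply: (T1 S); exact: (commutant_piP psis Lsub Ladj negL Ldense GK).
Qed.

Definition selfadj (T : K -> K) := forall x y, inner (T x) y = inner x (T y).

Lemma rho_comm_adjoint T T' : rho_comm T -> bounded_operator T' ->
  (forall x y, inner (T x) y = inner x (T' y)) -> rho_comm T'.
Proof.
move=> [Tb TM] T'b TT'; split => // a na x; apply: inner_extr => y.
rewrite -TT' -(gns_adj GK) -?TT'; last exact: negL.
rewrite -TM; last exact: alg_adj.
by rewrite TT' (gns_adj GK) //; exact: negL.
Qed.

Lemma central_adjoint T T' : central T -> bounded_operator T' ->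
  (forall x y, inner (T x) y = inner x (T' y)) -> central T'.
Proof.
move=> [Tc TS] T'b TT'; split; first exact: rho_comm_adjoint Tc T'b TT'.
move=> S Sc x; have [S' S'b SS'] := operator_adjoint (proj1 Sc).
have S'c := rho_comm_adjoint Sc S'b SS'.
have SSr u v : inner u (S v) = inner (S' u) v by rewrite innerC SS' -innerC.
by apply: inner_extr => y; rewrite -TT' !SSr -TS // TT'.
Qed.

Lemma central_lin T S (a b : R[i]) : central T -> central S ->
  central (fun x => a *: T x + b *: S x).
Proof.
move=> [[Tb TM] TC] [[Sb SM] SC]; split; first split.
- exact: bop_lin.
- move=> p np x; have Lp : L p by exact: negL.
  by rewrite TM // SM // (lopD (gns_linear GK Lp)) !(lopZ (gns_linear GK Lp)).
- move=> Y Yc x; have [/bounded_operatorP[Yl _] _] := Yc.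
  by rewrite (lopD Yl) !(lopZ Yl) TC // SC.
Qed.

Lemma central_comp T S : central T -> central S -> central (T \o S).
Proof.
move=> [[Tb TM] TC] [[Sb SM] SC]; split; first split.
- exact: bop_comp.
- by move=> p np x /=; rewrite SM // TM.
- by move=> Y Yc x /=; rewrite SC // TC.
Qed.

Variable gam : K -> K.
Hypotheses (gb : bounded_operator gam) (gg : forall x, gam (gam x) = x)
  (gsa : selfadj gam) (gom : gam om = om)
  (grho : forall a, alg neg a -> forall x, gam (rho a x) = rho (theta a) (gam x)).

Lemma rho_comm_gam T : rho_comm T -> rho_comm (gam \o T \o gam).
Proof.
move=> [Tb TM]; split; first by apply: bop_comp => //; exact: bop_comp.
move=> a na x /=; rewrite grho // TM ?grho ?(thetaK na) //; exact: alg_theta.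
Qed.

Lemma central_gam T : central T -> central (gam \o T \o gam).
Proof.
move=> [Tc TC]; split; first exact: rho_comm_gam.
move=> S Sc x /=; have := TC _ (rho_comm_gam Sc) (gam x).
by rewrite /= gg => /(congr1 gam); rewrite gg.
Qed.

Variable V : K -> H.
Hypotheses (Vl : linear_op V) (Vb : bounded_by V 1)
  (Vi : forall x y, inner (V x) (V y) = inner x y) (Vom : V om = Om)
  (Vrho : forall a, alg neg a -> forall x, V (rho a x) = pi a (V x)).

Lemma disj_neg : disj nonneg neg.
Proof. by move=> j; rewrite /nonneg /neg /=; lia. Qed.

(* [G] is the compression [V^* (pi r) V]. For [r] in the right half-chain it
   commutes with [rho] if [r] is even, and [G \o gam] does if [r] is odd: this
   is how central operators are moved past [pi r]. *)
Lemma compress_exists r : exists2 G : K -> K, bounded_operator G &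
  forall x y, inner (pi r (V x)) (V y) = inner (G x) y.
Proof.
have [V' [V'l [C V'C] VV']] := adjoint_exists Vl Vb.
exists (fun x => V' (pi r (V x))); last first.
  by move=> x y; rewrite [RHS]innerC -VV' -innerC.
apply/bounded_operatorP; split.
  by move=> a x y; rewrite Vl (gns_linear GH) // V'l.
exists (`|C| * cnorm r) => [|x]; first by rewrite mulr_ge0 ?cnorm_ge0.
rewrite -mulrA (bounded_abs V'C) //.
rewrite (le_trans (gns_bounded_by psis Tsub Tadj GH I _)) //.
by rewrite ler_wpM2l ?cnorm_ge0 // (le_trans (Vb _)) // mul1r.
Qed.

Lemma compress_even T r : central T -> selfadj T ->
  alg nonneg r -> theta r = r -> forall x y,
  inner (pi r (V (T x))) (V y) = inner (pi r (V x)) (V (T y)).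
Proof.
move=> [Tc TC] Ts nr er x y; have [G Gb GE] := compress_exists r.
have Gc : rho_comm G.
  split => // a na z; apply: inner_ext => w.
  have La : L a by exact: negL.
  rewrite -GE Vrho // -(gns_mul GH) // -(comm_even disj_neg nr na er).
  rewrite (gns_mul GH) // (gns_adjl Tadj GH) // -(Vrho (@alg_adj _ _ F _ _ na)).
  by rewrite GE (gns_adjl Ladj GK).
by rewrite !GE -TC // Ts.
Qed.

(** [e] is the sign in the commutation of [T] with [gam]: 1 for an even, [-1] for an odd central
    operator. [T] commutes with [G \o gam], and removing [gam] costs the factor [e]. *)
Lemma compress_odd T r (e : R[i]) : central T -> selfadj T ->
  (forall x, T (gam x) = e *: gam (T x)) -> e * e = 1 -> conjc e = e ->
  alg nonneg r -> theta r = - r -> forall x y,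
  inner (pi r (V (T x))) (V y) = e * inner (pi r (V x)) (V (T y)).
Proof.
move=> [Tc TC] Ts Tg e2 ec nr er x y; have [G Gb GE] := compress_exists r.
have Gr a z : alg neg a -> G (rho (theta a) z) = rho a (G z).
  move=> na; apply: inner_ext => w; have La : L a by exact: negL.
  rewrite -GE Vrho; last exact: alg_theta.
  rewrite -(gns_mul GH) // -(comm_odd disj_neg nr na er) (gns_mul GH) //.
  rewrite (gns_adjl Tadj GH) // -(Vrho (@alg_adj _ _ F _ _ na)).
  by rewrite GE (gns_adjl Ladj GK).
have Gc : rho_comm (G \o gam).
  split; first exact: bop_comp.
  by move=> a na z /=; rewrite grho // Gr.
have /bounded_operatorP[Gl _] := Gb; have /bounded_operatorP[gl _] := gb.
have GT z : T (G z) = e *: G (T z).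
  by have := TC _ Gc (gam z); rewrite /= gg Tg (lopZ gl) gg (lopZ Gl).
rewrite !GE -Ts GT (siZl inner_si) mulrA e2 mul1r.
by [].
Qed.

Lemma neg_nonneg : [set: int] `<=` neg `|` nonneg.
Proof. by move=> j _; rewrite /neg /nonneg /=; case: (ltP j 0); [left|right]. Qed.

Lemma disj_nonneg : disj neg nonneg.
Proof. by move=> j nj /disj_neg; apply. Qed.

Lemma hnV x : hn (V x) = hn x.
Proof. by rewrite /sn Vi. Qed.

Section EvenCentral.
Variable T : K -> K.
Hypotheses (Tc : central T) (Ts : selfadj T) (Tg : forall x, T (gam x) = gam (T x)).

(** The statement that [T] commutes with all of [A], in the matrix elements between vectors of
    [V K]. [Q] is split into products [r * a]: [a] commutes with [T] on [K], and [r] is handled by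
    the compression. *)
Lemma even_central_swap Q : alg setT Q -> forall x y,
  inner (pi Q (V (T x))) (V y) = inner (pi Q (V x)) (V (T y)).
Proof.
move=> /(alg_le neg_nonneg); move: Q.
apply: (alg_split_ind disj_nonneg) => [a P Q hP hQ x y|r a nr hr na x y].
  by rewrite !(gns_lin GH) // !innerPl hP hQ.
rewrite !(gns_mul GH) // -!(Vrho na); have [[_ TM] _] := Tc; rewrite -TM //.
case: hr => hr; first exact: compress_even.
rewrite (@compress_odd T r 1) ?mulr1 ?mul1r ?conjc1 // => z.
by rewrite scale1r.
Qed.

Lemma even_central_iter Q j : alg setT Q -> forall x y,
  inner (pi Q (V (iter j T x))) (V y) = inner (pi Q (V x)) (V (iter j T y)).
Proof.
move=> TQ; elim: j => [//|j IH] x y.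
by rewrite iterSr IH even_central_swap // -iterS.
Qed.

(* [T] defines the functional [Q |-> <Q V T om, Om>], dominated by the pure state
   [psi]. *)
Lemma even_central_scalar : exists a : R[i], forall x, T x = a *: x.
Proof.
have [[Tb TM] _] := Tc; have [Tl Tcont] := Tb.
have [C C0 TC] := continuous_bounded Tl Tcont.
have iterC j x : hn (iter j T x) <= C ^+ j * hn x.
  elim: j => [|j IH]; first by rewrite expr0 mul1r.
  by rewrite iterS (le_trans (TC _)) // exprS -mulrA ler_pM2l.
pose phi Q := inner (pi Q (V (T om))) (V om).
have phiE : forall Q, phi Q = phi 1 * psi Q.
  apply: (@pure_dominated _ _ psi psip phi C (hn (V (T om)) * hn (V om)) (alg setT)).
  - by move=> a P Q; rewrite /phi (gns_lin GH) // innerPl.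
  - move=> Q; rewrite (le_trans (si_CS inner_si _ _)) // mulrAC ler_wpM2r ?sn_ge0 //.
    by rewrite mulrC (gns_bounded_by psis Tsub Tadj GH).
  - by move=> Q e e0; exact: alg_dense.
  - move=> Q TQ; have TQQ : alg setT (adj Q * Q) by apply: algM => //; exact: alg_adj.
    (* Moving half of the powers of [T] to the other side gives [|s j|^2 <= |s (2 j)| |s 0|], and
       [|s j|] grows at most like [C ^ j]; hence [|s 1| <= C |s 0|] without positivity of [T]. *)
    pose s j := inner (pi (adj Q * Q) (V (iter j T om))) (V om).
    have sE j : s j = inner (pi Q (V (iter j T om))) (pi Q (V om)).
      by rewrite /s (gns_mul GH) // (gns_adj GH).
    have := @doubling_bound R (fun j => cabs (s j)) C
      (cnorm (adj Q * Q) * hn om * hn om) C0.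
    have -> : psi (adj Q * Q) = s 0%N by rewrite (gns_state GH) // -Vom.
    apply.
    + by move=> j; exact: cabs_ge0.
    + move=> j; rewrite sE (le_trans (si_CS2 inner_si _ _)) //.
      have sq k : hn (pi Q (V (iter k T om))) ^+ 2 = cabs (s (k + k)%N).
        rewrite -[LHS]ger0_norm ?sqr_ge0 // -cabs_real -(si_self inner_si).
        by rewrite -(gns_adj GH) // -(gns_mul GH) // -even_central_iter // -iterD.
      by rewrite sq (sq 0%N).
    + move=> j; rewrite (le_trans (si_CS inner_si _ _)) // mulrAC hnV.
      rewrite ler_wpM2r ?sn_ge0 //.
      rewrite (le_trans (gns_bounded_by psis Tsub Tadj GH I _)) //.
      by rewrite -mulrA ler_wpM2l ?cnorm_ge0 // hnV mulrC.
  - exact: ltW.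
  - by rewrite mulr_ge0 ?sn_ge0.
exists (phi 1).
(* The vectors [rho b om] are dense, so the scalar action on [om] follows from its matrix elements;
   as [T] commutes with [rho], it spreads to [K]. *)
have Tom : T om = phi 1 *: om.
  apply: (inner_ext_dense K_dense) => _ [b nb <-].
  have Lb : L b by exact: negL.
  have := phiE (adj b); rewrite {1}/phi -Vrho; last exact: alg_adj.
  rewrite Vi (gns_adj GK) // => ->.
  by rewrite (gns_state GK) ?(gns_adj GK) ?(siZl inner_si) //; exact: Ladj.
apply: (@lop_ext_dense _ _ _ _ T (fun x => phi 1 *: x) C (cabs (phi 1)) K_dense) => //.
- by move=> a x y; rewrite scalerDr !scalerA mulrC.
- by move=> x; rewrite (snZ inner_si).
move=> _ [b nb <-]; rewrite TM // Tom (lopZ (gns_linear GK _)) //; exact: negL.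
Qed.

End EvenCentral.

Lemma odd_central_unitary (T : K -> K) : central T ->
  ~ (exists a : R[i], forall x, T x = a *: x) ->
  exists Z : K -> K, [/\ central Z, selfadj Z, forall x, Z (Z x) = x
    & forall x, Z (gam x) = - gam (Z x)].
Proof.
move=> Tc Tn; have /bounded_operatorP[gl _] := gb.
have [T1 [T1c T1s T1n]] : exists T1 : K -> K, [/\ central T1, selfadj T1
    & ~ exists a : R[i], forall x, T1 x = a *: x].
  have [T' T'b TT'] := operator_adjoint (proj1 (proj1 Tc)).
  have T'c := central_adjoint Tc T'b TT'.
  have T'T x y : inner (T' x) y = inner x (T y) by rewrite innerC -TT' -innerC.
  have [[a ha]|n1] := pselect (exists a : R[i], forall x, 1 *: T x + 1 *: T' x = a *: x); last first.
    exists (fun x => 1 *: T x + 1 *: T' x); split => //; first exact: central_lin.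
    by move=> x y; rewrite !scale1r (siDl inner_si) (siDr inner_si) TT' T'T addrC.
  have [[b hb]|n2] := pselect (exists a : R[i], forall x, 'i *: T x + (- 'i) *: T' x = a *: x); last first.
    exists (fun x => 'i *: T x + (- 'i) *: T' x); split => //; first exact: central_lin.
    have ci : conjc 'i%C = - 'i%C :> R[i].
      by apply/eqP; rewrite eq_complex /= oppr0 !eqxx.
    move=> x y; rewrite (siDl inner_si) (siDr inner_si) !(siZl inner_si) !(siZr inner_si).
    by rewrite conjcN ci opprK TT' T'T addrC.
  exfalso; apply: Tn.
  have i2 : 'i * 'i = - 1 :> R[i] by rewrite -expr2 sqr_i.
  exists (2^-1%:C * (a - 'i * b)) => x.
  have -> : T x = 2^-1%:C *: (T x + T x) by rewrite scalerDr -scalerDl half2 scale1r.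
  rewrite -scalerA; congr (_ *: _).
  rewrite scalerBl -ha -scalerA -hb scalerDr !scalerA mulrN i2 opprK !scale1r scaleN1r.
  by rewrite opprD opprK addrA [T x + T' x + T x]addrAC addrK.
have [Tgc Tgs] : central (gam \o T1 \o gam) /\ selfadj (gam \o T1 \o gam).
  by split; [exact: central_gam|move=> x y /=; rewrite gsa T1s gsa].
pose P x := 1 *: T1 x + 1 *: (gam \o T1 \o gam) x.
pose Y x := 1 *: T1 x + (- 1) *: (gam \o T1 \o gam) x.
have PE x : P x = T1 x + gam (T1 (gam x)) by rewrite /P !scale1r.
have YE x : Y x = T1 x - gam (T1 (gam x)) by rewrite /Y scale1r scaleN1r.
have [a aP] : exists a : R[i], forall x, P x = a *: x.
  apply: even_central_scalar; first exact: central_lin.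
    by move=> x y; rewrite !PE (siDl inner_si) (siDr inner_si) T1s gsa T1s gsa.
  by move=> x; rewrite !PE gg (lopD gl) gg addrC.
have Yc : central Y by exact: central_lin.
have Ys : selfadj Y.
  by move=> x y; rewrite !YE (siBl inner_si) (siBr inner_si) T1s gsa T1s gsa.
have Yg x : Y (gam x) = - gam (Y x) by rewrite !YE gg (lopB gl) gg opprB.
have [c cY] : exists c : R[i], forall x, (Y \o Y) x = c *: x.
  apply: even_central_scalar; first exact: central_comp.
    by move=> x y /=; rewrite !Ys.
  have [[/bounded_operatorP[Yl _] _] _] := Yc.
  by move=> x /=; rewrite !Yg (lopN Yl) Yg opprK.
have [x0 Yx0] : exists x, Y x != 0.
  apply: contrapT => nex; apply: T1n; exists (2^-1%:C * a) => x.
  have Y0 : Y x = 0 by apply: contrapT => /eqP Yx; apply: nex; exists x.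
  rewrite -scalerA -aP; have -> : P x = T1 x + T1 x.
    by rewrite -[LHS]addr0 -Y0 PE YE addrACA subrr addr0.
  by rewrite scalerDr -scalerDl half2 scale1r.
have x00 : x0 != 0.
  apply: contra Yx0 => /eqP ->.
  have [[/bounded_operatorP[Yl _] _] _] := Yc; by rewrite (lop0 Yl).
have hx0 : 0 < hn x0 by rewrite lt_def sn_ge0 hn_eq0 x00.
have hY0 : 0 < hn (Y x0) by rewrite lt_def sn_ge0 hn_eq0 Yx0.
pose t := hn (Y x0) / hn x0; have t0 : 0 < t by rewrite divr_gt0.
have ct : c = (t ^+ 2)%:C.
  have := si_self inner_si (Y x0); rewrite -Ys -/((Y \o Y) x0) cY.
  rewrite (siZl inner_si) (si_self inner_si) => e.
  have n0 : (hn x0 ^+ 2)%:C != 0 :> R[i].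
    by rewrite (inj_eq (@complexI _)) sqrf_eq0 gt_eqF.
  apply: (mulIf n0); rewrite e -rmorphM; congr (_%:C).
  by rewrite /t; field; rewrite gt_eqF.
have tC : t%:C != 0 :> R[i] by rewrite (inj_eq (@complexI _)) gt_eqF.
(* The zero summand gives [Z] the shape required by [central_lin]. *)
pose Z x := t%:C^-1 *: Y x + 0 *: Y x.
have ZE x : Z x = t%:C^-1 *: Y x by rewrite /Z scale0r addr0.
have [[/bounded_operatorP[Yl _] _] _] := Yc.
exists Z; split.
- exact: central_lin.
- by move=> x y; rewrite !ZE (siZl inner_si) (siZr inner_si) Ys -fmorphV conjc_real.
- move=> x; rewrite !ZE (lopZ Yl) -/((Y \o Y) x) cY !scalerA ct rmorphXn expr2.
  by rewrite mulrA -[_^-1 * _ * _]mulrA mulVf // mulr1 mulVf // scale1r.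
- by move=> x; rewrite !ZE Yg (lopZ gl) scalerN.
Qed.

(** * The vector of the odd central unitary *)

Section ParityVector.
Variable Z : K -> K.
Hypotheses (Zc : central Z) (Zs : selfadj Z) (ZZ : forall x, Z (Z x) = x)
  (Zg : forall x, Z (gam x) = - gam (Z x)).
Let zeta := V (Z om).

Let hnZ x : hn (Z x) = hn x.
Proof. by rewrite /sn Zs ZZ. Qed.

Let Zrho a x : alg neg a -> Z (rho a x) = rho a (Z x).
Proof. by move=> na; have [[_ ZM] _] := Zc; exact: ZM. Qed.

(* On a local [Q] and for large [k], conjugation by [sstr 0 k] is the parity
   automorphism of the right half-chain. *)
Lemma parity_vector_state Q : alg setT Q ->
  exists M : nat, forall k : nat, (M <= k)%N ->
  inner (pi Q zeta) zeta = psi (sstr 0 k * Q * sstr 0 k).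
Proof.
move=> /(alg_le neg_nonneg); move: Q.
apply: (alg_split_ind disj_nonneg) => [a P Q [M1 h1] [M2 h2]|r a nr hr na].
  exists (maxn M1 M2) => k; rewrite geq_max => /andP[/h1 e1 /h2 e2].
  rewrite (gns_lin GH) // innerPl e1 e2 mulrDr mulrDl -scalerAr -scalerAl.
  by rewrite linearP.
have [M Mr] := alg_fin nr; exists M.+1 => k Mk.
have Ik : [set j | nonneg j /\ - M%:Z <= j <= M%:Z] `<=` itv 0 k.
  by move=> j; rewrite /nonneg /itv /= => -[]; lia.
have dk : disj (itv 0 k) neg by move=> j; rewrite /itv /neg /=; lia.
have -> : sstr 0 k * (r * a) * sstr 0 k = theta r * a.
  rewrite -!mulrA (sstr_comm_out dk na) !mulrA.
  by rewrite (sstr_conj_in Ik Mr).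
have raom : pi a (V om) = V (rho a om) by rewrite Vrho.
have val : inner (pi r (V (rho a om))) (V om) = psi (r * a).
  by rewrite -raom Vom -(gns_mul GH) // -(gns_state GH).
rewrite /zeta (gns_mul GH) // -Vrho // -Zrho //.
case: hr => hr; rewrite hr.
  by rewrite (compress_even Zc Zs nr hr) ZZ val.
have m1 : -1 * -1 = 1 :> R[i] by rewrite mulrNN mulr1.
have cm : conjc (-1) = -1 :> R[i] by rewrite conjcN conjc1.
rewrite (@compress_odd Z r (-1) Zc Zs _ m1 cm nr hr) ?ZZ ?val.
  by rewrite mulNr mul1r mulNr linearN.
by move=> x; rewrite scaleN1r.
Qed.

(** [Z] is self-adjoint and commutes with [rho a]. This symmetry on [A_L] later makes the phase [s]
    real. *)
Lemma parity_vector_adj a : alg neg a ->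
  inner (pi (adj a) zeta) Om = conjc (inner (pi a zeta) Om).
Proof.
move=> na; have na' := @alg_adj _ _ F _ _ na.
rewrite -Vom /zeta -!Vrho // !Vi -innerC (gns_adj GK); last exact: negL.
by rewrite Zs Zrho // [RHS]innerC -innerC.
Qed.

(** If [rho a om] is close to [Z om], then [rho a (Z om) = Z (rho a om)] is close to
    [Z (Z om) = om]. *)
Lemma parity_vector_cyclic (e : R) : 0 < e ->
  exists2 a, alg neg a & hn (pi a zeta - Om) < e.
Proof.
move=> /(K_dense (Z om))[_ [a na <-] h]; exists a => //.
rewrite -Vom /zeta -Vrho // -(lopB Vl) hnV -Zrho // -[X in _ - X](ZZ om).
have [[/bounded_operatorP[Zl _] _] _] := Zc.
by rewrite -(lopB Zl) hnZ (sn_sub inner_si).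
Qed.

(** [Z om] is odd for [gam], so it is approximated by [rho b om] with [b] odd and local; then
    [Q * b] is odd and [psi] vanishes on it. *)
Lemma parity_vector_even Q : alg setT Q -> theta Q = Q ->
  inner (pi Q zeta) Om = 0.
Proof.
move=> TQ eQ; have /bounded_operatorP[gl _] := gb.
apply/eqP; rewrite -cabs_eq0 eq_le cabs_ge0 andbT.
apply: (@le0_eps _ _ (cnorm Q * hn Om)) => e e0 _.
have [_ [a na <-] h] := K_dense (Z om) e0.
have nb := @alg_odd_of _ _ F _ _ na; pose b := odd_of F a.
have La : L a by exact: negL.
have Lta : L (theta a) by apply: negL; exact: alg_theta.
have -> : inner (pi Q zeta) Om = inner (pi Q (V (Z om - rho b om))) Om.
  rewrite (lopB Vl) (lopB (gns_linear GH _)) // (siBl inner_si) -/zeta.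
  rewrite (Vrho nb) Vom -(gns_mul GH) // -(gns_state GH) //.
  rewrite (psi_odd psip psi_ti) ?subr0 //; first by apply: algM => //; exact: alg_T nb.
  by rewrite lrM eQ (theta_odd_of na) mulrN.
have gZ : gam (Z om) = - Z om by rewrite -{2}gom Zg opprK.
have hb : hn (Z om - rho b om) <= e.
  pose x := Z om - rho a om.
  have -> : Z om - rho b om = 2^-1%:C *: (x - gam x).
    have -> : x - gam x = (Z om + Z om) - (rho a om - rho (theta a) om).
      rewrite /x (lopB gl) gZ grho // gom opprB opprK addrACA opprB.
      by rewrite [- _ + _]addrC addrACA.
    rewrite scalerBr scalerDr -scalerDl half2 scale1r -(gns_sub GK) //.
    congr (_ - _); rewrite /b /odd_of -[in LHS](addr0 (_ *: _)) (gns_lin GK).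
    + have -> : rho 0 om = 0.
        by rewrite -(subrr (1 : A)) (gns_sub GK) ?subrr //; exact: subalg1 Lsub.
      by rewrite addr0.
    + exact: subalgB Lsub La Lta.
    + exact: subalg0 Lsub.
  rewrite (snZ inner_si) cabs_real ger0_norm ?invr_ge0 //.
  have hg : hn (gam x) = hn x by rewrite /sn gsa gg.
  have := snB inner_si x (gam x); rewrite hg; lra.
rewrite (le_trans (si_CS inner_si _ _)) // mulrAC ler_wpM2r ?sn_ge0 //.
rewrite (le_trans (gns_bounded_by psis Tsub Tadj GH I _)) //.
by rewrite ler_wpM2l ?cnorm_ge0 // hnV.
Qed.

End ParityVector.

End Center.

(** * From a central element to string order *)

Section StringOrder.
Context {R : realType} {A : cstarAlgType R} (F : fermionChain A).
Implicit Types (P Q a : A).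
Local Notation theta := (theta F).
Local Notation tau := (tau F).
Local Notation alg := (alg F).
Local Notation sstr := (sstr F).
Local Notation sigma := (sigma F).
Variable psi : {scalar A}.
Hypotheses (psip : pure psi) (psi_ti : translation_invariant F psi).
Let psis : state psi := proj1 psip.
Local Notation N := (sn (sform psi)).
Let Tsub : is_subalgebra [set: A]. Proof. by []. Qed.
Let Tadj (x : A) : [set: A] x -> [set: A] (adj x). Proof. by []. Qed.

Variables (H : hilbertType R) (pi : A -> H -> H) (Om : H).
Hypothesis GH : is_gns setT psi pi Om.
Implicit Types x y z v : H.

Let piM P Q x : pi (P * Q) x = pi P (pi Q x).
Proof. exact: (gns_mul GH). Qed.
Let pi1 x : pi 1 x = x. Proof. exact: (gns_unit GH). Qed.
Let pil Q : linear_op (pi Q). Proof. exact: (gns_linear GH). Qed.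
Let piadj Q x y : inner (pi Q x) y = inner x (pi (adj Q) y).
Proof. exact: (gns_adjl Tadj GH). Qed.
Let pib Q x : hn (pi Q x) <= cnorm Q * hn x.
Proof. exact: (gns_bounded_by psis Tsub Tadj GH). Qed.
Let pistate Q : inner (pi Q Om) Om = psi Q.
Proof. by rewrite -(gns_state GH). Qed.

Lemma local_dense : dense_in [set pi Q Om | Q in alg setT].
Proof.
by apply: (gns_dense psis Tsub Tadj GH) => // Q e _ e0; exact: alg_dense.
Qed.

Lemma hn_Om : hn Om = 1.
Proof. by rewrite -(pi1 Om) (gns_hn Tsub Tadj GH) // (sn1 psis). Qed.

Lemma hn_sstr b k x : hn (pi (sstr b k) x) = hn x.
Proof. by rewrite /sn piadj sstr_adj -piM sstr_sq pi1. Qed.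

Lemma translation_exists (k : int) : exists U : H -> H, [/\ linear_op U,
  bounded_by U 1, forall x y, inner (U x) (U y) = inner x y, U Om = Om
  & forall Q, alg setT Q -> forall x, U (pi Q x) = pi (tau k Q) (U x)].
Proof.
have [||||U [Ul Ub UE]] := @dense_extension _ H H _ (alg setT) (fun a => pi a Om)
   (fun a => pi (tau k a) Om) 1 ler01 (fun b P Q => @alg_lin _ _ F setT b P Q).
- by move=> b P Q _ _; rewrite (gns_lin GH).
- by move=> b P Q _ _; rewrite lrP (gns_lin GH).
- exact: local_dense.
- by move=> a _; rewrite mul1r !(gns_hn Tsub Tadj GH) // sn_tau.
exists U; split => //.
- apply: (isometric_inner local_dense Ul Ub) => _ _ [a Ta <-] [b Tb <-].
  by rewrite !UE // !(gns_inner Tsub Tadj GH) // /sform -tau_adj -lrM psi_ti.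
- by rewrite -{1}(pi1 Om) UE ?lr1 ?pi1 //; exact: alg1.
move=> Q TQ x.
apply: (@lop_ext_dense _ _ _ _ (U \o pi Q) (pi (tau k Q) \o U)
  (1 * cnorm Q) (cnorm (tau k Q) * 1) local_dense).
- by move=> b y z /=; rewrite pil Ul.
- by move=> b y z /=; rewrite Ul pil.
- by move=> y /=; rewrite (le_trans (Ub _)) // -mulrA ler_wpM2l.
- by move=> y /=; rewrite (le_trans (pib _ _)) // -mulrA ler_wpM2l ?cnorm_ge0.
by move=> _ [b Tb <-] /=; rewrite -piM ?UE ?lrM ?piM //; exact: algM.
Qed.

Variables (U : int -> H -> H).
Hypothesis UP : forall k, [/\ linear_op (U k),
  bounded_by (U k) 1, forall x y, inner (U k x) (U k y) = inner x y, U k Om = Om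
  & forall Q, alg setT Q -> forall x, U k (pi Q x) = pi (tau k Q) (U k x)].

Let Ul k : linear_op (U k). Proof. by have [] := UP k. Qed.
Let Ub k : bounded_by (U k) 1. Proof. by have [] := UP k. Qed.
Let Ui k x y : inner (U k x) (U k y) = inner x y. Proof. by have [] := UP k. Qed.
Let UOm k : U k Om = Om. Proof. by have [] := UP k. Qed.
Let Upi k Q x : alg setT Q -> U k (pi Q x) = pi (tau k Q) (U k x).
Proof. by move=> TQ; have [_ _ _ _] := UP k; apply. Qed.

Lemma alg_tauT k Q : alg setT Q -> alg setT (tau k Q).
Proof. by move=> /(alg_tau (k := k)); exact: alg_T. Qed.

Lemma translationD k l x : U k (U l x) = U (l + k) x.
Proof.
apply: (@lop_ext_dense _ _ _ _ (U k \o U l) (U (l + k)) (1 * 1) 1 local_dense) => //.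
- by move=> b y z /=; rewrite !Ul.
- by move=> y /=; rewrite -mulrA mul1r (le_trans (Ub _ _)) // mul1r; exact: Ub.
by move=> _ [Q TQ <-] /=; rewrite !Upi // ?UOm ?(tauD _ _ TQ) //; exact: alg_tauT.
Qed.

Lemma translation0 x : U 0 x = x.
Proof.
apply: (@lop_ext_dense _ _ _ _ (U 0) id 1 1 local_dense) => //.
- by move=> y; rewrite mul1r.
by move=> _ [Q TQ <-] /=; rewrite Upi // UOm (tau0 TQ).
Qed.

Lemma translationK k x : U k (U (- k) x) = x.
Proof. by rewrite translationD addNr translation0. Qed.

(** Mixing of [psi] on local elements says that [U k] tends weakly to the projection onto [Om]; the
    uniform bound on [U k] extends this from local vectors to all vectors. *)
Lemma vector_mixing x y (e : R) : 0 < e -> exists M : nat, forall k : nat,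
  (M <= k)%N -> cabs (inner (U k%:Z x) y - inner x Om * inner Om y) <= e.
Proof.
(* [B k] is [U k] minus the rank-one projection; its norm is at most 2 for every [k]. *)
move=> e0; pose B k z := U k z - inner z Om *: Om.
have Bl k : linear_op (B k).
  move=> b z w; rewrite /B Ul innerPl scalerDl -scalerA scalerBr opprD addrACA.
  by [].
have Bb k z : hn (B k z) <= 2 * hn z.
  rewrite /B (le_trans (snB inner_si _ _)) // (snZ inner_si) hn_Om mulr1.
  have := Ub k z; have := si_CS inner_si z Om; rewrite hn_Om; lra.
have Bi k z w : inner (B k z) w = inner (U k z) w - inner z Om * inner Om w.
  by rewrite (siBl inner_si) (siZl inner_si).
pose C := 2 * hn y + 2 * (hn x + 1) + 1.
have C0 : 0 < C by have := sn_ge0 (@inner _ _) x; have := sn_ge0 (@inner _ _) y; rewrite /C; lra.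
pose d := Num.min 1 (e / C).
have d0 : 0 < d by rewrite lt_min ltr01 divr_gt0.
have d1 : d <= 1 by rewrite ge_min lexx.
have dC : d * C <= e by rewrite -ler_pdivlMr // ge_min lexx orbT.
have [_ [Q TQ <-] xQ] := local_dense x d0.
have [_ [P TP <-] yP] := local_dense y d0.
have [M mix] := mixing psip psi_ti (adj P) TQ d0.
exists M => k /mix h.
have h0 : cabs (inner (B k%:Z (pi Q Om)) (pi P Om)) <= d.
  rewrite Bi Upi // UOm pistate (gns_inner Tsub Tadj GH) //.
  by rewrite -[in inner Om _](adjK P) -piadj pistate mulrC.
rewrite -Bi.
have -> : inner (B k%:Z x) y = inner (B k%:Z (x - pi Q Om)) y
    + inner (B k%:Z (pi Q Om)) (y - pi P Om) + inner (B k%:Z (pi Q Om)) (pi P Om).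
  rewrite (siBr inner_si) (lopB (Bl _)) (siBl inner_si (B k%:Z x) (B k%:Z (pi Q Om))).
  by rewrite addrA !subrK.
have h1 := si_CS inner_si (B k%:Z (x - pi Q Om)) y.
have h2 := si_CS inner_si (B k%:Z (pi Q Om)) (y - pi P Om).
have h3 : hn (B k%:Z (x - pi Q Om)) * hn y <= (2 * d) * hn y.
  by rewrite ler_wpM2r ?sn_ge0 // (le_trans (Bb _ _)) // ler_pM2l // ltW.
have h4 := snB inner_si x (x - pi Q Om); rewrite opprB addrCA subrr addr0 in h4.
have h5 : hn (B k%:Z (pi Q Om)) * hn (y - pi P Om) <= (2 * (hn x + 1)) * d.
  rewrite ler_pM ?sn_ge0 // ?(ltW yP) // (le_trans (Bb _ _)) // ler_pM2l //; lra.
have h6 := cabsD (inner (B k%:Z (x - pi Q Om)) y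
    + inner (B k%:Z (pi Q Om)) (y - pi P Om)) (inner (B k%:Z (pi Q Om)) (pi P Om)).
have h7 := cabsD (inner (B k%:Z (x - pi Q Om)) y) (inner (B k%:Z (pi Q Om)) (y - pi P Om)).
apply: le_trans dC; rewrite /C; lra.
Qed.

Variable zeta : H.
(** From here on [zeta] is any vector with the four properties below; the operator [Z] no longer
    appears. *)
Hypothesis zstate : forall Q, alg setT Q -> exists M : nat, forall k : nat,
  (M <= k)%N -> inner (pi Q zeta) zeta = psi (sstr 0 k * Q * sstr 0 k).
Hypothesis zadj : forall a, alg neg a ->
  inner (pi (adj a) zeta) Om = conjc (inner (pi a zeta) Om).
Hypothesis zcyc : forall e : R, 0 < e ->
  exists2 a, alg neg a & hn (pi a zeta - Om) < e.
Hypothesis zeven : forall Q, alg setT Q -> theta Q = Q -> inner (pi Q zeta) Om = 0.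

Let f Q := inner (pi Q zeta) Om.
Let sg := sigma (-1).
(** [U (-1)] and [sigma (-1)] both move the cut of the chain one site to the left, so [z1] and [z2]
    are two candidates for the parity vector of the half-line [j >= -1]. *)
Let z1 := U (-1) zeta.
Let z2 := pi sg zeta.

Let Tsg : alg setT sg. Proof. by apply: alg_T; exact: alg_sigma. Qed.

Let sgE k : sg * sstr 0 k = sstr (-1) k.+1.
Proof.
by rewrite -add1n sstr_cat sstrS sstr0 mul1r addr0.
Qed.

Let sgE' k : sstr 0 k * sg = sstr (-1) k.+1.
Proof.
rewrite -sgE (sstr_comm_out (J := [set (-1)])) //; last exact: alg_sigma.
by move=> j; rewrite /itv /= => /[swap] ->; lia.
Qed.

Lemma z1_state Q : alg setT Q -> exists M : nat, forall k : nat,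
  (M <= k)%N -> inner (pi Q z1) z1 = psi (sstr (-1) k * Q * sstr (-1) k).
Proof.
move=> TQ; have Tt := alg_tauT 1 TQ.
have [M hM] := zstate Tt; exists M => k /hM e.
have -> : inner (pi Q z1) z1 = inner (pi (tau 1 Q) zeta) zeta.
  rewrite /z1 -[RHS](Ui (-1)) Upi // (tauD _ _ TQ) subrr (tau0 TQ).
  by [].
by rewrite e -(psi_ti 1 (sstr (-1) k * Q * sstr (-1) k)) !lrM tau_sstr addNr.
Qed.

Lemma z2_state Q : alg setT Q -> exists M : nat, forall k : nat,
  (M <= k)%N -> inner (pi Q z2) z2 = psi (sstr (-1) k * Q * sstr (-1) k).
Proof.
(* The string starting at -1 has one more site than the one starting at 0, hence [M.+1]. *)
move=> TQ; have TS : alg setT (sg * Q * sg) by apply: algM => //; exact: algM.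
have [M hM] := zstate TS; exists M.+1 => [[//|k]]; rewrite ltnS => /hM e.
rewrite /z2 -[RHS]/(psi _) -piM; have -> : inner (pi (Q * sg) zeta) (pi sg zeta)
    = inner (pi (sg * Q * sg) zeta) zeta.
  by rewrite -!mulrA [in RHS]piM [in RHS]piadj sigma_adj.
by rewrite e !mulrA sgE' -mulrA sgE.
Qed.

(** The longer string is the shorter one times a tail; the two shorter ones cancel, and the tail
    commutes with [P] once it lies beyond the support of [P]. *)
Lemma sstr_stable P : alg setT P -> exists M : nat, forall k m : nat,
  (M <= k)%N -> (k <= m)%N ->
  sstr (-1) m * (sstr (-1) k * P * sstr (-1) k) * sstr (-1) m = P.
Proof.
move=> /alg_fin[M MP]; exists M.+2 => k m Mk km.
pose T := sstr (-1 + k%:Z) (m - k).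
have dT : disj (itv (-1 + k%:Z) (m - k)) [set j | setT j /\ - M%:Z <= j <= M%:Z].
  by move=> j; rewrite /itv /= => h [_]; lia.
have Tk : sstr (-1) k * T = T * sstr (-1) k.
  apply: (sstr_comm_out (J := itv (-1) k)); last by apply: alg_sstr.
  by move=> j; rewrite /itv /=; lia.
have -> : sstr (-1) m = sstr (-1) k * T by rewrite /T -sstr_cat subnKC.
rewrite {1}Tk -!mulrA [sstr (-1) k * (sstr (-1) k * T)]mulrA sstr_sq mul1r.
rewrite [sstr (-1) k * (sstr (-1) k * _)]mulrA sstr_sq mul1r.
by rewrite mulrA (sstr_conj_out dT MP).
Qed.

(* The functional [P |-> lim_k <S_k P S_k z2, z1>], with [S_k] the string on
   [-1, k - 2], is dominated by [psi], which is the corresponding functional of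
   [z1] and of [z2]; so it is a multiple of [psi]. *)
Lemma z1_proportional_form : exists mu : R[i], forall Q, alg setT Q ->
  inner (pi Q z2) z1 = mu * inner (pi Q z2) z2.
Proof.
have [G [GP FG Gcpt]] := @ultra_limits R \oo _.
have Goo (M : nat) : G [set k | (M <= k)%N] by apply: FG; exists M.
pose S k := sstr (-1) k.
pose u P k := inner (pi (S k * P * S k) z2) z1.
have piS k x : hn (pi (S k) x) = hn x by exact: hn_sstr.
have ub P k : cabs (u P k) <= hn z2 * hn z1 * cnorm P.
  rewrite /u !piM piadj sstr_adj (le_trans (si_CS inner_si _ _)) // piS.
  by rewrite mulrAC ler_wpM2r ?sn_ge0 // (le_trans (pib _ _)) // piS mulrC.
have ubd P : cbounded (u P) by exists (hn z2 * hn z1 * cnorm P) => k; exact: ub.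
pose phi P := ulim G (u P).
have TS k P : alg setT P -> alg setT (S k * P * S k).
  by move=> TP; apply: algM; [apply: algM => //|]; exact: alg_sstr.
(* For [z1] and [z2] the strings inserted around [P] undo those of the state, exactly and not only
   in the limit. *)
have dom z P k : (forall Q, alg setT Q -> exists M : nat, forall m : nat,
    (M <= m)%N -> inner (pi Q z) z = psi (S m * Q * S m)) -> alg setT P ->
    (forall m, (k <= m)%N -> S m * (S k * P * S k) * S m = P) ->
    inner (pi (S k * P * S k) z) z = psi P.
  move=> zst TP st; have [M hM] := zst _ (TS k P TP).
  by rewrite (hM (maxn M k)) ?leq_maxl // st // leq_maxr.
have phiE : forall P, phi P = phi 1 * psi P.
  apply: (@pure_dominated _ _ psi psip phi 1 (hn z2 * hn z1) (alg setT)).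
  - move=> b P Q; rewrite /phi -ulim_lin //; congr (ulim G _); apply/funext => k.
    by rewrite /u mulrDr mulrDl -scalerAr -scalerAl (gns_lin GH) // innerPl.
  - by move=> P; apply: ulim_le => //; apply: filterS filterT => k _ /=; exact: ub.
  - by move=> P e e0; exact: alg_dense.
  - move=> P TP; have TPP : alg setT (adj P * P) by apply: algM => //; exact: alg_adj.
    have [M st] := sstr_stable TPP.
    apply: ulim_le => //; apply: filterS (Goo M) => k /= Mk.
    have st' m : (k <= m)%N -> S m * (S k * (adj P * P) * S k) * S m = adj P * P.
      exact: st.
    have SP : S k * (adj P * P) * S k = adj (P * S k) * (P * S k).
      by rewrite adjM sstr_adj !mulrA.
    have nrm z : (forall Q, alg setT Q -> exists M : nat, forall m : nat,
        (M <= m)%N -> inner (pi Q z) z = psi (S m * Q * S m)) ->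
        hn (pi (P * S k) z) ^+ 2 = cabs (psi (adj P * P)).
      move=> zst; rewrite -(dom z _ k zst TPP st').
      rewrite -[LHS]ger0_norm ?sqr_ge0 // -cabs_real -(si_self inner_si).
      by rewrite SP [in RHS]piM (gns_adj GH).
    rewrite mul1r /u.
    have -> : inner (pi (S k * (adj P * P) * S k) z2) z1 =
        inner (pi (P * S k) z2) (pi (P * S k) z1).
      by rewrite SP [in LHS]piM (gns_adj GH).
    rewrite -(@ler_pXn2r _ 2%N) ?nnegrE ?cabs_ge0 //.
    rewrite (le_trans (si_CS2 inner_si _ _)) // (nrm _ z1_state) (nrm _ z2_state).
    by rewrite expr2.
  - exact: ler01.
  - by rewrite mulr_ge0 ?sn_ge0.
exists (phi 1) => Q TQ.
(* Evaluated at [S_k Q S_k], [phi] is [<Q z2, z1>], since its longer strings undo [S_k], and [psi]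
   is [<Q z2, z2>]. *)
have [M st] := sstr_stable TQ; have [M2 st2] := z2_state TQ.
pose k := maxn M M2.
have := phiE (S k * Q * S k); rewrite -(st2 k) ?leq_maxr // => <-.
symmetry; apply: ulim_cst => //; apply: filterS (Goo k) => m /= km.
by rewrite /u st // leq_maxl.
Qed.
Lemma zeta_cyclic v : (forall Q, alg setT Q -> inner (pi Q zeta) v = 0) -> v = 0.
Proof.
move=> zv; apply: (inner_ext_dense local_dense) => _ [Q TQ <-].
rewrite (si0l inner_si) innerC -[RHS]conjc0; congr conjc.
apply: (@eq_eps _ _ _ (cnorm Q * hn v)) => e e0 _.
have [a na h] := zcyc e0.
have -> : inner (pi Q Om) v - 0 = inner (pi Q (Om - pi a zeta)) v.
  rewrite (lopB (pil Q)) (siBl inner_si (pi Q Om)) -piM zv //.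
  by apply: algM => //; exact: alg_T na.
rewrite (le_trans (si_CS inner_si _ _)) // mulrAC ler_wpM2r ?sn_ge0 //.
rewrite (le_trans (pib _ _)) // ler_wpM2l ?cnorm_ge0 //.
by rewrite (sn_sub inner_si) ltW.
Qed.

(** By [z1_proportional_form], [z1 - conjc mu *: z2] is orthogonal to every [pi Q z2]. These vectors
    are the [pi Q zeta], because [sigma (-1)] squares to 1, and [zeta] is cyclic. *)
Lemma translation_zeta : exists s : R[i], z1 = s *: z2.
Proof.
have [mu muE] := z1_proportional_form; exists (conjc mu).
apply/eqP; rewrite -subr_eq0; apply/eqP/zeta_cyclic => Q TQ.
have -> : pi Q zeta = pi (Q * sg) z2.
  by rewrite /z2 -piM -mulrA sigma_sq mulr1.
have TQs : alg setT (Q * sg) by exact: algM.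
by rewrite (siBr inner_si) (siZr inner_si) conjcK muE // subrr.
Qed.

(** If [f a = 0], the component of [pi a zeta - Om] along the unit vector [Om] has modulus 1, so the
    distance is not below 1. *)
Lemma alg_neg_witness : exists2 P, alg neg P & f P != 0.
Proof.
have [a na h] := zcyc ltr01; exists a => //; apply/eqP => fa.
have := si_CS inner_si (pi a zeta - Om) Om; rewrite (siBl inner_si) -/(f a) fa.
rewrite sub0r cabsN hn_Om mulr1 (si_self inner_si) hn_Om expr1n cabs1.
by rewrite leNgt h.
Qed.

Section Phase.
Variable s : R[i].
Hypothesis sE : z1 = s *: z2.

Lemma f_tau Q : alg setT Q -> f (tau 1 Q) = s * f (Q * sg).
Proof.
move=> TQ; rewrite /f -(Ui (-1)) UOm Upi; last exact: alg_tauT.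
rewrite (tauD _ _ TQ) subrr (tau0 TQ) -/z1 sE (lopZ (pil Q)) (siZl inner_si).
by rewrite /z2 -piM.
Qed.

Lemma phase_abs : cabs s = 1.
Proof.
have h1 : hn z1 = hn zeta by rewrite /sn Ui.
have h2 : hn z2 = hn zeta.
  have sg1 : sg = sstr (-1) 1 by rewrite sstrS sstr0 mul1r addr0.
  by rewrite /z2 sg1 hn_sstr.
have zn : hn zeta != 0.
  rewrite hn_eq0; apply/eqP => z0; have [P _] := alg_neg_witness.
  by rewrite /f z0 (lop0 (pil P)) (si0l inner_si) eqxx.
by move: h1; rewrite sE (snZ inner_si) h2 -{2}[hn zeta]mul1r => /(mulIf zn).
Qed.

(** [zadj] holds for [P] and for [Q * sg], both in the left half-chain. Comparing
    [f P = s * f (Q * sg)] with its version for adjoints gives [conjc s = s]. *)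
Lemma phase_sq : s * s = 1.
Proof.
have [P nP fP] := alg_neg_witness; have TP := alg_T nP.
pose Q := tau (-1) P; have TQ : alg setT Q by exact: alg_tauT.
have QP : tau 1 Q = P by rewrite /Q (tauD _ _ TP) addNr (tau0 TP).
(* The shift clears site -1, so [Q] commutes with [sg]. *)
have nQ : alg [set j | j < -1] Q.
  have := alg_tau (k := -1) nP; apply: alg_le => j.
  by rewrite /shift_set /neg /=; lia.
have nQs : alg neg (Q * sg).
  apply: algM; first by move: nQ; apply: alg_le => j; rewrite /neg /=; lia.
  by have := @alg_sigma _ _ F (-1); apply: alg_le => _ ->; rewrite /neg /=.
have e1 : f P = s * f (Q * sg) by rewrite -f_tau // QP.
have e2 : f (adj P) = s * f (adj Q * sg).
  by rewrite -f_tau ?tau_adj ?QP //; exact: alg_adj.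
have sQ : adj Q * sg = adj (Q * sg).
  rewrite adjM sigma_adj.
  apply: (comm_even (J := [set (-1)]) (K := [set j | j < -1])).
  - by move=> j /= ->; lia.
  - exact: alg_sigma.
  - exact: alg_adj.
  - exact: theta_sigma.
move: e2; rewrite sQ /f (zadj nP) (zadj nQs) -!/(f _) e1 conjcM.
have fQ : conjc (f (Q * sg)) != 0.
  rewrite -cabs_eq0 cabsJ cabs_eq0; apply: contra fP => /eqP fQ0.
  by rewrite e1 fQ0 mulr0.
move=> /(mulIf fQ) sc.
by rewrite -{2}sc mul_conjC phase_abs expr1n.
Qed.

Lemma translation_zeta_iter (k : nat) :
  U (- k%:Z) zeta = s ^+ k *: pi (sstr (- k%:Z) k) zeta.
Proof.
elim: k => [|k IH]; first by rewrite oppr0 translation0 expr0 scale1r sstr0 pi1.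
have -> : - k.+1%:Z = - k%:Z + -1 by lia.
rewrite -translationD IH (lopZ (Ul _)) Upi; last exact: alg_sstr.
rewrite -/z1 sE (lopZ (pil _)) scalerA exprSr tau_sstr /z2 -piM sstrS.
by have -> : - k%:Z + -1 + k%:Z = -1 by lia.
Qed.

(** The place where even string lengths matter: an odd power would leave the sign [s]. *)
Lemma phase_even (k : nat) : s ^+ (2 * k) = 1.
Proof. by rewrite exprM expr2 phase_sq expr1n. Qed.

Lemma translation_zeta_even (k : nat) :
  U (2 * k)%N%:Z zeta = pi (sstr 0 (2 * k)) zeta.
Proof.
have := congr1 (U (2 * k)%N%:Z) (translation_zeta_iter (2 * k)).
rewrite translationK phase_even scale1r Upi; last exact: alg_sstr.
rewrite tau_sstr addNr => {2}->.
by rewrite -piM sstr_sq pi1.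
Qed.

(** Translate a witness [P] of the left half-chain by [M] into the right one. Moving [zeta] back
    produces [s ^+ M] and a string, which the string built into [X] cancels. *)
Lemma alg_nonneg_witness : exists2 Q, alg nonneg Q & f Q != 0.
Proof.
have [P nP fP] := alg_neg_witness; have TP := alg_T nP.
have [M MP] := alg_fin nP.
pose X := P * sstr (- M%:Z) M.
have MX : alg [set j | - M%:Z <= j] X.
  apply: algM; first by move: MP; apply: alg_le => j /= [_]; lia.
  by apply: alg_sstr => j; rewrite /itv /=; lia.
have TX := alg_T MX.
exists (tau M%:Z X).
  have := alg_tau (k := M%:Z) MX; apply: alg_le => j.
  by rewrite /shift_set /nonneg /=; lia.
have -> : f (tau M%:Z X) = s ^+ M * f P.
  rewrite /f -(Ui (- M%:Z)) UOm Upi; last exact: alg_tauT.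
  rewrite (tauNK _ TX) translation_zeta_iter (lopZ (pil X)) (siZl inner_si).
  by rewrite -piM /X -mulrA sstr_sq mulr1.
rewrite mulf_neq0 // expf_neq0 //.
by rewrite -cabs_eq0 phase_abs oner_eq0.
Qed.

Lemma odd_witness J : (exists2 Q, alg J Q & f Q != 0) ->
  exists Q, [/\ alg J Q, theta Q = - Q & f Q != 0].
Proof.
move=> [Q JQ fQ]; exists (odd_of F Q); split.
- exact: alg_odd_of.
- exact: theta_odd_of JQ.
move: fQ; rewrite -{1}(even_odd_of F Q) /f -[even_of _ _]scale1r (gns_lin GH) //.
rewrite innerPl zeven ?mulr0 ?add0r //; first by apply: alg_even_of; exact: alg_T JQ.
exact: theta_even_of JQ.
Qed.

(** Translating [pi Q2 zeta] by [2k] gives [tau_{2k}(Q2) S zeta]. The functional of [zeta] is [psi]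
    conjugated by a long string, which fixes [Q1] and [S] and changes the sign of the odd
    [tau_{2k}(Q2)]: hence the minus sign. *)
Lemma string_expectation Q1 Q2 : alg neg Q1 -> alg nonneg Q2 ->
  theta Q1 = - Q1 -> theta Q2 = - Q2 -> forall k : nat,
  psi (Q1 * string F (2 * k) * tau (2 * k)%N%:Z Q2) =
  - inner (U (2 * k)%N%:Z (pi Q2 zeta)) (pi (adj Q1) zeta).
Proof.
move=> n1 n2 o1 o2 k; pose t := tau (2 * k)%N%:Z Q2.
have [M MQ] := alg_fin n2.
have It : alg [set j | (2 * k)%N%:Z <= j <= (2 * k + M)%N%:Z] t.
  have := alg_tau (k := (2 * k)%N%:Z) MQ; apply: alg_le => j.
  by rewrite /shift_set /nonneg /= => -[]; lia.
have ot : theta t = - t by rewrite /t (theta_tau _ n2) o2 lrN.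
have Tt := alg_T It.
have TS : alg setT (sstr 0 (2 * k)) by exact: alg_sstr.
have TX : alg setT (Q1 * t * sstr 0 (2 * k)).
  by apply: algM => //; apply: algM => //; exact: alg_T n1.
have -> : inner (U (2 * k)%N%:Z (pi Q2 zeta)) (pi (adj Q1) zeta) =
    inner (pi (Q1 * t * sstr 0 (2 * k)) zeta) zeta.
  rewrite Upi; last exact: alg_T n2.
  by rewrite translation_zeta_even !piM [RHS]piadj.
have [L hL] := zstate TX; pose m := maxn L (2 * k + M).+1.
rewrite (hL m) ?leq_maxl //.
have tS : t * sstr 0 (2 * k) = sstr 0 (2 * k) * t.
  by apply: sstr_comm_out It => j; rewrite /itv /=; lia.
have d1 : disj (itv 0 m) neg by move=> j; rewrite /itv /neg /=; lia.
have mt : [set j | (2 * k)%N%:Z <= j <= (2 * k + M)%N%:Z] `<=` itv 0 m.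
  by move=> j; rewrite /itv /m /=; lia.
have mS : sstr 0 m * sstr 0 (2 * k) * sstr 0 m = sstr 0 (2 * k).
  have I2 : alg (itv 0 (2 * k)) (sstr 0 (2 * k)) by exact: alg_sstr.
  rewrite (sstr_conj_in (J := itv 0 (2 * k))) ?theta_sstr // => j.
  by rewrite /itv /m /=; lia.
have -> : sstr 0 m * (Q1 * t * sstr 0 (2 * k)) * sstr 0 m =
    - (Q1 * (t * sstr 0 (2 * k))).
  have -> : sstr 0 m * (Q1 * t * sstr 0 (2 * k)) * sstr 0 m =
      Q1 * (sstr 0 m * t * sstr 0 m) * (sstr 0 m * sstr 0 (2 * k) * sstr 0 m).
    rewrite !mulrA -[sstr 0 m * Q1](sstr_comm_out d1 n1) -!mulrA.
    by rewrite [sstr 0 m * (sstr 0 m * _)]mulrA sstr_sq mul1r.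
  by rewrite mS (sstr_conj_in mt It) ot mulrN mulNr mulrA.
by rewrite linearN opprK tS string_sstr mulrA.
Qed.

Lemma string_order_of_vector : string_order F psi.
Proof.
have [Q1 [n1 o1 f1]] := odd_witness alg_neg_witness.
have [Q2 [n2 o2 f2]] := odd_witness alg_nonneg_witness.
have [M1 m1] := alg_fin n1; have [M2 m2] := alg_fin n2.
exists (- M1.+1%:Z), M2%:Z, Q1, Q2; split.
- by split; lia.
- split => //; move: m1; apply: alg_le => j; rewrite /neg /= => -[]; lia.
- split => //; move: m2; apply: alg_le => j; rewrite /nonneg /= => -[]; lia.
exists (- (f Q2 * f Q1)); first by rewrite oppr_eq0 mulf_neq0.
apply/cvg_cabs => e e0; have e2 : 0 < e / 2 by rewrite divr_gt0.
have [M mix] := vector_mixing (pi Q2 zeta) (pi (adj Q1) zeta) e2.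
exists M => k Mk; have Mk2 : (M <= 2 * k)%N by lia.
have := mix _ Mk2; rewrite (string_expectation n1 n2 o1 o2) -opprD cabsN.
rewrite -/(f Q2) [inner Om _]innerC (zadj n1) conjcK -/(f Q1) => h.
by apply: (le_lt_trans h); lra.
Qed.

End Phase.

End StringOrder.

(** * The equivalence of string order with a non-trivial centre *)

Section Main.
Context {R : realType} {A : cstarAlgType R} (F : fermionChain A).
Variable psi : {scalar A}.
Hypotheses (psip : pure psi) (psi_ti : translation_invariant F psi).

Lemma not_factor_string_order : ~ factor_state (alg_L F) psi -> string_order F psi.
Proof.
have psis := proj1 psip; move=> nf; apply: contrapT => ns; apply: nf.
(* The contrapositive supplies a GNS triple on [K] and a non-scalar [T] in the centre; the triple on
   [H] for all of [A] is built next to it. *)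
move=> K rho om GK T T1 T2; apply: contrapT => nT; apply: ns.
have Tc := centralP psip GK T1 T2.
have Tsub : is_subalgebra [set: A] by [].
have [H [pi [Om GH]]] := gns_exists psis Tsub (fun x _ => I).
have [gam [gb gg gs gom grho]] := parity_exists psip psi_ti GK.
have [V [Vl Vb Vi Vom Vrho]] := embedding_exists psip GK GH.
have [Z [Zc Zs ZZ Zg]] := odd_central_unitary psip GK GH gb gg gs grho
  Vl Vb Vi Vom Vrho Tc nT.
have /choice[U UP] := translation_exists psip psi_ti GH.
have zst := @parity_vector_state _ _ _ _ psip _ _ _ GK _ _ _ GH _ gb gg grho
  _ Vl Vb Vom Vrho _ Zc Zs ZZ Zg.
have zad := @parity_vector_adj _ _ _ _ _ _ _ GK _ _ _ _ Vi Vom Vrho _ Zc Zs.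
have zcy := @parity_vector_cyclic _ _ _ _ psip _ _ _ GK _ _ _ _ Vl Vi Vom Vrho
  _ Zc Zs ZZ.
have zev := @parity_vector_even _ _ _ _ psip psi_ti _ _ _ GK _ _ _ GH _ gb gg gs
  gom grho _ Vl Vi Vom Vrho _ Zg.
have [s sE] := translation_zeta psip psi_ti GH UP zst zcy.
exact: (string_order_of_vector psip psi_ti GH UP zst zad zcy zev sE).
Qed.

End Main.

Theorem mainTheorem4 (R : realType) (A : cstarAlgType R) (F : fermionChain A)
    (n : nat) (hn : (1 < n)%N) (h : A) (hh : interaction F n h)
    (psi : {scalar A}) (psi_ti : translation_invariant F psi)
    (psi_pure : pure psi) (psi_ground : ground_state F h psi)
    (psi_gapped : gapped F n h psi) :
  (string_order F psi <-> ind_Z2 F psi = - 1) /\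
  (~ string_order F psi <-> ind_Z2 F psi = 1).
Proof.
have so : string_order F psi <-> ~ factor_state (alg_L F) psi.
  split; first exact: string_order_not_factor.
  exact: not_factor_string_order.
have m1 : (1 : int) <> - 1 by [].
rewrite /ind_Z2; case: asboolP => fac; split; split.
- by move=> /so.
- by move=> /m1.
- by [].
- by move=> _ /so.
- by [].
- by move=> _; apply/so.
- by move=> nso; case: nso; apply/so.
- by move=> /esym /m1.
Qed.
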